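(* Let $d,n\in\mathbb{N}$. Then there is a prime $p_0=p_0(n,d)$ such that if: (i) $k$ is any field of characteristic $p\geq p_0$; (ii) $G$ is any affine algebraic $k$-group of complexity at most $d$ (with respect to $n$ variables); (iii) $X$ is any locally finitely presented, separated $k$-scheme on which $G$ acts, of complexity at most $d$ and $(G,\Delta)$-complexity at most $d$; then for any closed subscheme $Y$ of $X$, the centraliser $C_G(Y)$ is a smooth closed subscheme of $G$.
   Context: Complexity of groups. Let $S=k[x_1,\dots,x_n]$, and identify $S\otimes S$ with a polynomial ring in $2n$ variables. An algebraic $k$-group $G$ has complexity at most $d$ if $G=\operatorname{Spec}(S/I)$, where $I$ is generated by polynomials of total degree at most $d$ and the comultiplication, antipode and counit of $S/I$ are induced by $k$-algebra homomorphisms $\Delta\colon S\to S\otimes S$, $\sigma\colon S\to S$, $\epsilon\colon S\to k$ sending each $x_i$ to a polynomial of total degree at most $d$. Such a description of $G$ is fixed; $G$ is not assumed smooth. Complexity of $X$. A locally finitely presented $k$-scheme $X$ comes with a fixed open cover $\{X_i\mid i\in\mathbb{I}\}$ (with $\mathbb{I}$ possibly infinite) by affine schemes with $k[X_i]$ a finitely presented $k$-algebra, and a fixed closed embedding of each $X_i$ in some affine space $\mathbb{A}^{n_i}_k$. $X$ has complexity at most $d$ if each $X_i$ does, i.e. the ideal of each $X_i$ in $\mathbb{A}^{n_i}_k$ is generated by polynomials of total degree at most $d$. $(G,\Delta)$-complexity. Let $\alpha\colon G\times X\to X$ be the action, $\Delta_X\subseteq X\times X$ the (closed) diagonal, $A=k[G]=S/I$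 and $B_i=k[X_i]$. Let $\beta=\alpha\times\mathrm{pr}_2\colon G\times X\to X\times X$, i.e. $\beta(g,x)=(\alpha(g,x),x)$, and let $\beta_i$ be its restriction to $G\times X_i$. Then $\beta_i^{-1}(\Delta_X)$ is a closed subscheme of $G\times X_i$, given by an ideal $K_i$ of $A\otimes_k B_i$. $X$ has $(G,\Delta)$-complexity at most $d$ if for each $i$ there are finitely many generators $f^{(i)}_j=\sum_m a^{(i)}_{mj}\otimes b^{(i)}_{mj}$ of $K_i$ (finite sums, $a^{(i)}_{mj}\in A$, $b^{(i)}_{mj}\in B_i$) such that each $a^{(i)}_{mj}$ has a representative in $S$ of total degree at most $d$. Centraliser. $C_G(Y)$ is the $k$-subgroup functor of $G$ with $C_G(Y)(Q)=\{g\in G(Q)\mid \alpha(g,h)=h \text{ for all } h\in Y(Q') \text{ and all } Q\text{-algebras } Q'\}$. *)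

(* Defs.v *)
(* Schemes and group schemes over a field k are treated through their functors
   of points (Demazure-Gabriel, Jantzen): a k-functor is a covariant functor
   from commutative k-algebras to sets, and a k-scheme is a k-functor that is a
   sheaf for Zariski covers and is covered by affine open subfunctors.
   The k-algebras are the [comAlgType k] of MathComp, which are nonzero.  Since
   a scheme has exactly one point over the zero ring, leaving this ring out
   changes neither the schemes nor their morphisms and subschemes; the empty
   scheme is the functor with no points. *)
From HB Require Import structures.
From mathcomp Require Export all_boot all_algebra.
From mathcomp Require Export mpoly.
From Stdlib Require Import ProofIrrelevance.

Set Implicit Arguments.
Unset Strict Implicit.
Unset Printing Implicit Defensive.

Import GRing.Theory.
Local Open Scope ring_scope.

(* ------------------------------------------------------------------ *)
(** ** Ideals *)

(* The ideals of [ring_quotient] are boolean and proper; here they may be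
   arbitrary. *)
Definition is_ideal (R : comNzRingType) (I : R -> Prop) : Prop :=
  [/\ I 0, forall x y, I x -> I y -> I (x + y) & forall a x, I x -> I (a * x)].

Definition ideal_gen (R : comNzRingType) (P : R -> Prop) (x : R) : Prop :=
  exists2 s : seq (R * R),
    forall ab, ab \in s -> P ab.2 & x = \sum_(ab <- s) ab.1 * ab.2.

Definition fin_gen (R : comNzRingType) (I : R -> Prop) : Prop :=
  exists s : seq R, forall x, I x <-> ideal_gen (fun y => y \in s) x.

(* [msize p] is 1 + total degree, and 0 for p = 0. *)
Definition tdeg_le (k : fieldType) (n d : nat) (p : {mpoly k[n]}) : Prop :=
  (msize p <= d.+1)%N.

Definition gen_tdeg_le (k : fieldType) (n d : nat)
    (I : {mpoly k[n]} -> Prop) : Prop :=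
  exists2 P : {mpoly k[n]} -> Prop,
    forall p, P p -> tdeg_le d p & forall p, I p <-> ideal_gen P p.

(* ------------------------------------------------------------------ *)
(** ** k-functors *)

Record kfunctor (k : fieldType) := KFunctor {
  points :> comAlgType k -> Type;
  fmap : forall A B : comAlgType k, {lrmorphism A -> B} -> points A -> points B;
  fmap_id : forall (A : comAlgType k) (x : points A),
    fmap (idfun : {lrmorphism A -> A}) x = x;
  fmap_comp : forall (A B C : comAlgType k) (f : {lrmorphism A -> B})
      (g : {lrmorphism B -> C}) (x : points A),
    fmap (g \o f : {lrmorphism A -> C}) x = fmap g (fmap f x)
}.

Record ktrans (k : fieldType) (F F' : kfunctor k) := KTrans {
  trans :> forall A : comAlgType k, F A -> F' A;
  trans_nat : forall (A B : comAlgType k) (f : {lrmorphism A -> B}) (x : F A),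
    trans (fmap f x) = fmap f (trans x)
}.

Record subfunctor (k : fieldType) (F : kfunctor k) := SubFunctor {
  sub_mem :> forall A : comAlgType k, F A -> Prop;
  sub_stable : forall (A B : comAlgType k) (f : {lrmorphism A -> B}) (x : F A),
    sub_mem x -> sub_mem (fmap f x)
}.

Lemma sig_eqP (T : Type) (P : T -> Prop) (u v : {x | P x}) :
  proj1_sig u = proj1_sig v -> u = v.
Proof.
case: u v => [x px] [y py] /= exy; case: y / exy py => py.
by rewrite (proof_irrelevance _ px py).
Qed.

Section FunctorOperations.
Variable k : fieldType.
Implicit Types F H : kfunctor k.

Definition sub_fmap F (Z : subfunctor F) (A B : comAlgType k)
    (f : {lrmorphism A -> B}) (u : {x : F A | Z A x}) : {x : F B | Z B x} :=
  exist _ (fmap f (proj1_sig u)) (sub_stable f (proj2_sig u)).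

Lemma sub_fmap_id F (Z : subfunctor F) (A : comAlgType k)
    (u : {x : F A | Z A x}) : sub_fmap (idfun : {lrmorphism A -> A}) u = u.
Proof. by apply: sig_eqP; rewrite /= fmap_id. Qed.

Lemma sub_fmap_comp F (Z : subfunctor F) (A B C : comAlgType k)
    (f : {lrmorphism A -> B}) (g : {lrmorphism B -> C}) (u : {x : F A | Z A x}) :
  sub_fmap (g \o f : {lrmorphism A -> C}) u = sub_fmap g (sub_fmap f u).
Proof. by apply: sig_eqP; rewrite /= fmap_comp. Qed.

Definition functor_of_sub F (Z : subfunctor F) : kfunctor k :=
  KFunctor (@sub_fmap_id F Z) (@sub_fmap_comp F Z).

Definition prod_fmap F H (A B : comAlgType k) (f : {lrmorphism A -> B})
    (u : F A * H A) : F B * H B := (fmap f u.1, fmap f u.2).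

Lemma prod_fmap_id F H (A : comAlgType k) (u : F A * H A) :
  prod_fmap (idfun : {lrmorphism A -> A}) u = u.
Proof. by case: u => x y; rewrite /prod_fmap !fmap_id. Qed.

Lemma prod_fmap_comp F H (A B C : comAlgType k) (f : {lrmorphism A -> B})
    (g : {lrmorphism B -> C}) (u : F A * H A) :
  prod_fmap (g \o f : {lrmorphism A -> C}) u = prod_fmap g (prod_fmap f u).
Proof. by rewrite /prod_fmap /= !fmap_comp. Qed.

Definition prod_functor F H : kfunctor k :=
  KFunctor (@prod_fmap_id F H) (@prod_fmap_comp F H).

Lemma diagonal_stable F (A B : comAlgType k) (f : {lrmorphism A -> B})
    (u : prod_functor F F A) : u.1 = u.2 -> (fmap f u).1 = (fmap f u).2.
Proof. by move=> /= ->. Qed.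

Definition diagonal F : subfunctor (prod_functor F F) :=
  SubFunctor (@diagonal_stable F).

Lemma preimage_stable F H (t : ktrans F H) (Z : subfunctor H)
    (A B : comAlgType k) (f : {lrmorphism A -> B}) (x : F A) :
  Z A (t A x) -> Z B (t B (fmap f x)).
Proof. by rewrite trans_nat; apply: sub_stable. Qed.

Definition preimage F H (t : ktrans F H) (Z : subfunctor H) : subfunctor F :=
  SubFunctor (@preimage_stable F H t Z).

(* A point x of F over A is a morphism Sp(A) -> F, and its preimage of Z has to
   be the closed (resp. open) subfunctor of Sp(A) given by an ideal J. *)
Definition closed_sub F (Z : subfunctor F) : Prop :=
  forall (A : comAlgType k) (x : F A), exists2 J : A -> Prop, is_ideal J &
    forall (B : comAlgType k) (f : {lrmorphism A -> B}),
      Z B (fmap f x) <-> (forall a, J a -> f a = 0).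

Definition open_sub F (Z : subfunctor F) : Prop :=
  forall (A : comAlgType k) (x : F A), exists2 J : A -> Prop, is_ideal J &
    forall (B : comAlgType k) (f : {lrmorphism A -> B}),
      Z B (fmap f x) <-> ideal_gen (fun b => exists2 a, J a & b = f a) 1.

Definition separated F : Prop := closed_sub (diagonal F).

(* [l : A -> L] is a localisation of A at the powers of a. *)
Definition is_localisation (A L : comAlgType k) (l : {lrmorphism A -> L})
    (a : A) : Prop :=
  [/\ exists y : L, l a * y = 1,
      forall y : L, exists m b, y * l a ^+ m = l b
    & forall b, l b = 0 -> exists m, a ^+ m * b = 0].

(* Sheaf condition for the cover of Sp(A) by the Sp(A_(a_i)), where the a_i
   generate the unit ideal.  The localisations L i are nonzero, i.e. no a_i is
   nilpotent, but nilpotent a_i could be dropped from the cover anyway; if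
   a_i * a_j is nilpotent, there is no L' and nothing to agree upon. *)
Definition local_functor F : Prop :=
  forall (A : comAlgType k) (r : nat) (a : 'I_r -> A)
    (L : 'I_r -> comAlgType k) (l : forall i, {lrmorphism A -> L i}),
  (forall i, is_localisation (l i) (a i)) ->
  ideal_gen (fun b => exists i, b = a i) 1 ->
  forall x : forall i, F (L i),
  (forall i j (L' : comAlgType k) (u : {lrmorphism L i -> L'})
      (v : {lrmorphism L j -> L'}),
    u \o l i =1 v \o l j ->
    is_localisation (u \o l i : {lrmorphism A -> L'}) (a i * a j) ->
    fmap u (x i) = fmap v (x j)) ->
  exists! y : F A, forall i, fmap (l i) y = x i.

Definition covers F (J : Type) (U : J -> subfunctor F) : Prop :=
  forall K : comAlgType k,
  (forall a : K, a <> 0 -> exists b, a * b = 1) ->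
  forall x : F K, exists j, U j K x.

End FunctorOperations.

(* ------------------------------------------------------------------ *)
(** ** Affine space and closed embeddings *)

Section AffineSpace.
Variables (k : fieldType) (n : nat).

Definition aff_fmap (A B : comAlgType k) (f : {lrmorphism A -> B})
    (v : {ffun 'I_n -> A}) : {ffun 'I_n -> B} := [ffun i => f (v i)].

Lemma aff_fmap_id (A : comAlgType k) (v : {ffun 'I_n -> A}) :
  aff_fmap (idfun : {lrmorphism A -> A}) v = v.
Proof. by apply/ffunP=> i; rewrite ffunE. Qed.

Lemma aff_fmap_comp (A B C : comAlgType k) (f : {lrmorphism A -> B})
    (g : {lrmorphism B -> C}) (v : {ffun 'I_n -> A}) :
  aff_fmap (g \o f : {lrmorphism A -> C}) v = aff_fmap g (aff_fmap f v).
Proof. by apply/ffunP=> i; rewrite !ffunE. Qed.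

Definition affine_space : kfunctor k := KFunctor aff_fmap_id aff_fmap_comp.

Definition peval (A : comAlgType k) (v : {ffun 'I_n -> A})
    (p : {mpoly k[n]}) : A := mmap (in_alg A) v p.

(* An isomorphism of F with Spec (k[x_1, .., x_n] / eqs), seen as the closed
   subscheme of affine n-space on which eqs vanishes. *)
Record closed_embedding (F : kfunctor k) := ClosedEmbedding {
  coord : ktrans F affine_space;
  eqs : {mpoly k[n]} -> Prop;
  eqs_ideal : is_ideal eqs;
  coord_inj : forall A : comAlgType k, injective (coord A);
  coord_image : forall (A : comAlgType k) (v : affine_space A),
    (exists x, coord A x = v) <-> (forall p, eqs p -> peval v p = 0)
}.

End AffineSpace.

Section ProductCoordinates.
Variables (k : fieldType) (n m : nat).

Definition pair_pt (A : Type) (u : {ffun 'I_n -> A}) (v : {ffun 'I_m -> A}) :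
    {ffun 'I_(n + m) -> A} :=
  [ffun i => match split i with inl i1 => u i1 | inr i2 => v i2 end].

(* The element a (x) b of k[x_1, .., x_n] (x) k[y_1, .., y_m], identified with
   the polynomial ring in the variables x_1, .., x_n, y_1, .., y_m. *)
Definition inx (a : {mpoly k[n]}) : {mpoly k[n + m]} :=
  mmap (@mpolyC (n + m) k) (fun i => 'X_(lshift m i)) a.
Definition iny (b : {mpoly k[m]}) : {mpoly k[n + m]} :=
  mmap (@mpolyC (n + m) k) (fun i => 'X_(rshift n i)) b.
Definition tens (a : {mpoly k[n]}) (b : {mpoly k[m]}) : {mpoly k[n + m]} :=
  inx a * iny b.

End ProductCoordinates.

(* Finite presentation together with the infinitesimal lifting property
   (EGA IV 17.3.1), for an affine k-scheme. *)
Definition smooth (k : fieldType) (F : kfunctor k) : Prop :=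
  (exists (m : nat) (E : closed_embedding m F), fin_gen (eqs E)) /\
  (forall (A B : comAlgType k) (f : {lrmorphism A -> B}),
     (forall b, exists a, f a = b) ->
     (forall a a', f a = 0 -> f a' = 0 -> a * a' = 0) ->
     forall y : F B, exists x : F A, fmap f x = y).

(* ------------------------------------------------------------------ *)
(** ** Groups, schemes and actions *)

Record kgroup (k : fieldType) := KGroup {
  gfunctor :> kfunctor k;
  gmul : forall A : comAlgType k, gfunctor A -> gfunctor A -> gfunctor A;
  ginv : forall A : comAlgType k, gfunctor A -> gfunctor A;
  gone : forall A : comAlgType k, gfunctor A;
  gmul_nat : forall (A B : comAlgType k) (f : {lrmorphism A -> B})
      (g h : gfunctor A), fmap f (gmul g h) = gmul (fmap f g) (fmap f h);
  ginv_nat : forall (A B : comAlgType k) (f : {lrmorphism A -> B})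
      (g : gfunctor A), fmap f (ginv g) = ginv (fmap f g);
  gone_nat : forall (A B : comAlgType k) (f : {lrmorphism A -> B}),
    fmap f (gone A) = gone B;
  gmulA : forall A : comAlgType k, associative (@gmul A);
  gmul1g : forall A : comAlgType k, left_id (gone A) (@gmul A);
  gmulg1 : forall A : comAlgType k, right_id (gone A) (@gmul A);
  gmulVg : forall A : comAlgType k, left_inverse (gone A) (@ginv A) (@gmul A);
  gmulgV : forall A : comAlgType k, right_inverse (gone A) (@ginv A) (@gmul A)
}.

(* Here k[G] = S / eqs E, and its comultiplication, antipode and counit are the
   comorphisms of the group operations.  They are induced by the homomorphisms
   x_i |-> Delta i, sigma i, eps i exactly when these polynomials compute the
   coordinates of g h, g^-1 and 1.  The eps i are constants, so that the bound
   on their degree always holds. *)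
Definition group_complexity_le (k : fieldType) (n d : nat) (G : kgroup k)
    (E : closed_embedding n G) : Prop :=
  gen_tdeg_le d (eqs E) /\
  exists (Delta : 'I_n -> {mpoly k[n + n]}) (sigma : 'I_n -> {mpoly k[n]})
      (eps : 'I_n -> k),
    [/\ forall i, tdeg_le d (Delta i) /\ tdeg_le d (sigma i),
        forall (A : comAlgType k) (g h : G A) i,
          coord E A (gmul g h) i =
          peval (pair_pt (coord E A g) (coord E A h)) (Delta i),
        forall (A : comAlgType k) (g : G A) i,
          coord E A (ginv g) i = peval (coord E A g) (sigma i)
      & forall (A : comAlgType k) i,
          coord E A (gone G A) i = (eps i)%:A].

Record lfp_scheme (k : fieldType) := LfpScheme {
  sfunctor :> kfunctor k;
  slocal : local_functor sfunctor;
  index : Type;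
  chart : index -> subfunctor sfunctor;
  chart_open : forall i, open_sub (chart i);
  chart_cover : covers chart;
  nvars : index -> nat;
  chart_emb : forall i, closed_embedding (nvars i) (functor_of_sub (chart i));
  chart_fp : forall i, fin_gen (eqs (chart_emb i))
}.

Definition scheme_complexity_le (k : fieldType) (d : nat) (X : lfp_scheme k) :
    Prop :=
  forall i : index X, gen_tdeg_le d (eqs (chart_emb i)).

Record action (k : fieldType) (G : kgroup k) (X : kfunctor k) := Action {
  act :> forall A : comAlgType k, G A -> X A -> X A;
  act_nat : forall (A B : comAlgType k) (f : {lrmorphism A -> B})
      (g : G A) (x : X A), fmap f (act g x) = act (fmap f g) (fmap f x);
  act1 : forall (A : comAlgType k) (x : X A), act (gone G A) x = x;
  actM : forall (A : comAlgType k) (g h : G A) (x : X A),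
    act (gmul g h) x = act g (act h x)
}.

Section Actions.
Variables (k : fieldType) (G : kgroup k).

Definition beta_on_fun (X : kfunctor k) (alpha : action G X)
    (U : subfunctor X) (A : comAlgType k)
    (u : prod_functor G (functor_of_sub U) A) : prod_functor X X A :=
  (alpha A u.1 (proj1_sig u.2), proj1_sig u.2).

Lemma beta_on_nat (X : kfunctor k) (alpha : action G X) (U : subfunctor X)
    (A B : comAlgType k) (f : {lrmorphism A -> B})
    (u : prod_functor G (functor_of_sub U) A) :
  beta_on_fun alpha (fmap f u) = fmap f (beta_on_fun alpha u).
Proof. by rewrite /beta_on_fun /= /prod_fmap /= act_nat. Qed.

(* The restriction to G x U of (g, x) |-> (g x, x). *)
Definition beta_on (X : kfunctor k) (alpha : action G X) (U : subfunctor X) :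
    ktrans (prod_functor G (functor_of_sub U)) (prod_functor X X) :=
  KTrans (@beta_on_nat X alpha U).

(* The inverse image in k[x_1, .., x_n, y_1, .., y_(n_i)] of the ideal K_i of
   k[G] (x) k[X_i]: all functions that vanish on the closed subscheme
   beta_i^-1 (diagonal X) of G x X_i. *)
Definition fix_ideal (n : nat) (E : closed_embedding n G) (X : lfp_scheme k)
    (alpha : action G X) (i : index X) (p : {mpoly k[n + nvars i]}) : Prop :=
  forall (A : comAlgType k)
    (u : prod_functor G (functor_of_sub (chart i)) A),
  preimage (beta_on alpha (chart i)) (diagonal X) A u ->
  peval (pair_pt (coord E A u.1) (coord (chart_emb i) A u.2)) p = 0.

(* Each f in fs is the list of the pairs (a, b), with a and b representatives of
   the tensor factors of one generator \sum a (x) b of K_i.  To generate K_i in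
   k[G] (x) k[X_i] is to generate [fix_ideal] together with the ideals of G and
   X_i. *)
Definition GDelta_complexity_le (n d : nat) (E : closed_embedding n G)
    (X : lfp_scheme k) (alpha : action G X) : Prop :=
  forall i : index X,
  exists2 fs : seq (seq ({mpoly k[n]} * {mpoly k[nvars i]})),
    forall f ab, f \in fs -> ab \in f -> tdeg_le d ab.1 &
    forall p : {mpoly k[n + nvars i]},
      fix_ideal E alpha p <->
      ideal_gen (fun q =>
        [\/ exists2 a, eqs E a & q = inx (nvars i) a,
            exists2 b, eqs (chart_emb i) b & q = iny n b
          | exists2 f, f \in fs & q = \sum_(ab <- f) tens ab.1 ab.2]) p.

Definition centraliser_mem (X : kfunctor k) (alpha : action G X)
    (Y : subfunctor X) (A : comAlgType k) (g : G A) : Prop :=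
  forall (B : comAlgType k) (f : {lrmorphism A -> B}) (h : X B),
    Y B h -> alpha B (fmap f g) h = h.

Lemma centraliser_stable (X : kfunctor k) (alpha : action G X)
    (Y : subfunctor X) (A B : comAlgType k) (f : {lrmorphism A -> B})
    (g : G A) :
  centraliser_mem alpha Y g -> centraliser_mem alpha Y (fmap f g).
Proof. by move=> cg C f' h Yh; rewrite -fmap_comp; apply: cg. Qed.

Definition centraliser (X : kfunctor k) (alpha : action G X)
    (Y : subfunctor X) : subfunctor G :=
  SubFunctor (@centraliser_stable X alpha Y).

End Actions.

(* Main.v *)
(* The equations of the centraliser C of Y in a chart of X are the coefficients,
   with respect to a k-basis of functions on Y in that chart, of the generators
   of the fixed point ideal; so C is cut out in affine n-space by polynomials of
   degree at most d, and it remains to make Cartier's theorem effective.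

   Let I be the ideal of an algebraic group in affine n-space, translated so that
   1 is the origin.  Choose generators h of I whose linear parts form a basis of
   the linear parts of I, a right inverse C of their Jacobian M at 0, and put
   F(x) = x - C h(x).  The map F is the identity modulo I, and modulo high powers
   of the maximal ideal m its iterates are functions of the tangential
   coordinates (1 - C M) x only.  For q in I the lowest form of q o F^N hence
   survives restriction to the tangent space; differentiating it along the
   invariant vector fields, which is harmless in degree less than p, shows that
   q o F^N lies in m^(N+1) for N < p.  By the Hilbert basis theorem over the ring
   of universal coefficients there is a bound D = D(n, d) such that this
   vanishing for N <= D forces it for all N, whatever the field.  So for p > D,
   Krull's intersection theorem gives I = (h) near the origin: the conormal
   sequence is left exact there, and by translation everywhere.  Invariant
   vector fields split it, which is smoothness. *)

(* The obstacle is a gap between two ranges of orders. Differentiation says nothing about forms of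
   degree p, whose derivatives may all vanish, and infinitesimal groups such as x^p = 0 show that
   this failure is genuine; Krull's theorem, on the other hand, asks for every order. Iterating F
   bridges the gap: the coefficients of q o F^N are polynomials over the integers in the
   coefficients of F and q, so the conditions for all N form one system over one noetherian ring.
   The degree bound makes the number of these variables finite.

   The passage from 1 to the whole group cannot use translation by points, since there may be too
   few of them over k. It uses the morphisms (z, y) |-> z y and (z, y) |-> z y^-1 on G x G, together
   with the expansion of functions on G x G along families that are free modulo an ideal. The same
   expansion, i.e. flatness over k, yields the equations of the centraliser. *)
Require Import Defs.
From HB Require Import structures.
From mathcomp Require Import boolp ring.
From mathcomp Require ring_quotient classical_sets.

Set Implicit Arguments.
Unset Strict Implicit.
Unset Printing Implicit Defensive.

Import GRing.Theory.
Local Open Scope ring_scope.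

(** * Ideals, quotient algebras and generic points *)

(* The unused proofs let the instances below be found by unification. *)
Definition ideal_pred (R : comNzRingType) (I : R -> Prop) (_ : is_ideal I)
  (_ : ~ I 1) : {pred R} := fun x => `[< I x >].

Section QuotientAlgebra.
Variables (k : fieldType) (R : comNzRingType) (phi : {rmorphism k -> R}).
Variables (I : R -> Prop) (idI : is_ideal I) (propI : ~ I 1).

Let memI := ideal_pred idI propI.

Fact ideal_pred_zmod_closed : zmod_closed memI.
Proof.
case: idI => I0 ID IM; split; first exact/asboolP.
move=> x y /asboolP Ix /asboolP Iy; apply/asboolP.
by apply: ID => //; rewrite -mulN1r; apply: IM.
Qed.

Fact ideal_pred_proper : ring_quotient.proper_ideal memI.
Proof.
case: idI => I0 ID IM; split; first exact/asboolPn.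
by move=> a x /asboolP Ix; apply/asboolP/IM.
Qed.

HB.instance Definition _ := GRing.isZmodClosed.Build R memI ideal_pred_zmod_closed.
HB.instance Definition _ :=
  ring_quotient.isProperIdeal.Build R memI ideal_pred_proper.

Definition quotient_algebra : Type := ring_quotient.Quotient.quot memI.
Local Notation Q := quotient_algebra.
HB.instance Definition _ := GRing.ComNzRing.on Q.

Definition quotient_proj : R -> Q := \pi_(ring_quotient.Quotient.quot memI)%qT.

Fact quotient_proj_zmod : zmod_morphism quotient_proj.
Proof. exact: ring_quotient.pi_is_zmod_morphism. Qed.
Fact quotient_proj_monoid : monoid_morphism quotient_proj.
Proof. exact: ring_quotient.pi_is_monoid_morphism. Qed.
HB.instance Definition _ :=
  GRing.isZmodMorphism.Build R Q quotient_proj quotient_proj_zmod.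
HB.instance Definition _ :=
  GRing.isMonoidMorphism.Build R Q quotient_proj quotient_proj_monoid.

Definition quotient_scale (c : k) (x : Q) : Q := quotient_proj (phi c) * x.
Fact quotient_scaleA a b v :
  quotient_scale a (quotient_scale b v) = quotient_scale (a * b) v.
Proof. by rewrite /quotient_scale !rmorphM mulrA. Qed.
Fact quotient_scale1 : left_id 1 quotient_scale.
Proof. by move=> v; rewrite /quotient_scale !rmorph1 mul1r. Qed.
Fact quotient_scaleDr : right_distributive quotient_scale +%R.
Proof. by move=> a u v; rewrite /quotient_scale mulrDr. Qed.
Fact quotient_scaleDl v : {morph quotient_scale^~ v : a b / a + b}.
Proof. by move=> a b; rewrite /quotient_scale !rmorphD mulrDl. Qed.
HB.instance Definition _ := GRing.Zmodule_isLmodule.Build k Q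
  quotient_scaleA quotient_scale1 quotient_scaleDr quotient_scaleDl.
Fact quotient_scaleAl (a : k) (u v : Q) : a *: (u * v) = a *: u * v.
Proof. exact: mulrA. Qed.
HB.instance Definition _ := GRing.Lmodule_isLalgebra.Build k Q quotient_scaleAl.
HB.instance Definition _ := GRing.Lalgebra_isComAlgebra.Build k Q.

(** The scalars come through [phi] and not from an algebra structure on [R]: [{mpoly A[m]}] and
    [{poly B}] are algebras over [A] and [B], while their quotients are needed as algebras over
    [k]. *)
Lemma quotient_algebraP : exists (A : comAlgType k) (pi : {rmorphism R -> A}),
  [/\ forall c, pi (phi c) = c%:A, forall x, pi x = 0 <-> I x
    & forall y, exists x, pi x = y].
Proof.
exists (Q : comAlgType k), (quotient_proj : {rmorphism R -> Q}); split.
- by move=> c; rewrite -[LHS]mulr1.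
- move=> x; rewrite -[0](rmorph0 quotient_proj).
  have := ring_quotient.Quotient.idealrBE memI x 0.
  rewrite subr0 => e; split.
    by move=> h; apply/asboolP; move: e; rewrite /memI unfold_in /= => ->; apply/eqP.
  by move=> /asboolP h; apply/eqP; rewrite -e.
- by move=> y; exists (generic_quotient.repr y); exact: generic_quotient.reprK.
Qed.
End QuotientAlgebra.

Section IdealTheory.
Variable R : comNzRingType.
Implicit Types I P : R -> Prop.

Lemma ideal0 I : is_ideal I -> I 0. Proof. by case. Qed.
Lemma idealD I x y : is_ideal I -> I x -> I y -> I (x + y).
Proof. by case=> _ h _; apply: h. Qed.
Lemma idealMl I a x : is_ideal I -> I x -> I (a * x).
Proof. by case=> _ _ h; apply: h. Qed.
Lemma idealMr I a x : is_ideal I -> I x -> I (x * a).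
Proof. by move=> h ?; rewrite mulrC; apply: idealMl. Qed.
Lemma idealN I x : is_ideal I -> I x -> I (- x).
Proof. by move=> h ?; rewrite -mulN1r; apply: idealMl. Qed.
Lemma idealB I x y : is_ideal I -> I x -> I y -> I (x - y).
Proof. by move=> h ? ?; apply: idealD => //; apply: idealN. Qed.
Lemma ideal_sum I (T : eqType) (r : seq T) (Q : pred T) (F : T -> R) :
  is_ideal I -> (forall i, i \in r -> Q i -> I (F i)) ->
  I (\sum_(i <- r | Q i) F i).
Proof.
move=> h hF; rewrite big_seq_cond; apply: big_ind => [|x y|i /andP[]].
- exact: ideal0.
- exact: idealD.
- exact: hF.
Qed.

Lemma ideal_gen_ideal P : is_ideal (ideal_gen P).
Proof.
split.
- by exists [::] => //; rewrite big_nil.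
- move=> _ _ [s1 h1 ->] [s2 h2 ->]; exists (s1 ++ s2); last by rewrite big_cat.
  by move=> ab; rewrite mem_cat => /orP[]; [apply: h1 | apply: h2].
- move=> a _ [s h ->]; exists [seq (a * ab.1, ab.2) | ab <- s].
    by move=> _ /mapP[ab abs ->]; apply: (h ab).
  by rewrite big_map mulr_sumr; apply: eq_bigr => ab _; rewrite mulrA.
Qed.

Lemma mem_ideal_gen P x : P x -> ideal_gen P x.
Proof.
move=> Px; exists [:: (1, x)]; last by rewrite big_seq1 mul1r.
by move=> ab; rewrite inE => /eqP ->.
Qed.

Lemma ideal_gen_min P I x : is_ideal I -> (forall y, P y -> I y) ->
  ideal_gen P x -> I x.
Proof.
move=> idI PI [s h ->]; apply: ideal_sum => // ab abs _.
by apply: idealMl => //; apply/PI/h.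
Qed.

Lemma ideal_gen_sub P P' x : (forall y, P y -> P' y) ->
  ideal_gen P x -> ideal_gen P' x.
Proof.
move=> PP'; apply: ideal_gen_min => [|y /PP']; first exact: ideal_gen_ideal.
exact: mem_ideal_gen.
Qed.
End IdealTheory.

Lemma ideal_preimage (R S : comNzRingType) (f : {rmorphism R -> S})
    (I : S -> Prop) : is_ideal I -> is_ideal (fun x => I (f x)).
Proof.
move=> idI; split; first by rewrite rmorph0; apply: ideal0.
  by move=> x y; rewrite rmorphD; apply: idealD.
by move=> a x; rewrite rmorphM; apply: idealMl.
Qed.

Lemma ideal_gen_morph (R S : comNzRingType) (f : {rmorphism R -> S})
    (P : R -> Prop) (P' : S -> Prop) x : (forall y, P y -> ideal_gen P' (f y)) ->
  ideal_gen P x -> ideal_gen P' (f x).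
Proof.
move=> h; apply: (@ideal_gen_min _ _ (fun x => ideal_gen P' (f x))) => //.
exact/ideal_preimage/ideal_gen_ideal.
Qed.

Lemma kernel_ideal (R S : comNzRingType) (f : {rmorphism R -> S}) :
  is_ideal (fun x => f x = 0).
Proof.
split; first exact: rmorph0.
  by move=> x y ex ey; rewrite rmorphD ex ey addr0.
by move=> a x ex; rewrite rmorphM ex mulr0.
Qed.

Lemma quotient_lift (k : fieldType) (R : comNzRingType)
    (phi : {rmorphism k -> R}) (A B : comAlgType k) (pi : {rmorphism R -> A})
    (f : {rmorphism R -> B}) :
  (forall c, pi (phi c) = c%:A) -> (forall y, exists x, pi x = y) ->
  (forall c, f (phi c) = c%:A) -> (forall x, pi x = 0 -> f x = 0) ->
  exists g : {lrmorphism A -> B}, forall x, g (pi x) = f x.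
Proof.
move=> piC pis fC fI.
have fE x x' : pi x = pi x' -> f x = f x'.
  move=> e; apply/eqP; rewrite -subr_eq0 -rmorphB; apply/eqP/fI.
  by rewrite rmorphB e subrr.
pose s y := projT1 (cid (pis y)).
have sK y : pi (s y) = y by rewrite /s; case: (cid _).
pose g y := f (s y).
have gE x : g (pi x) = f x by apply: fE; rewrite sK.
have g_zmod : zmod_morphism g.
  move=> x y; rewrite -[x]sK -[y]sK -rmorphB !gE.
  exact: rmorphB.
have g_mon : monoid_morphism g.
  split; first by rewrite -(rmorph1 pi) gE rmorph1.
  by move=> x y; rewrite -[x]sK -[y]sK -rmorphM !gE rmorphM.
have g_lin : scalable g.
  move=> c x; rewrite -[x]sK -[LHS]/(g _) -mulr_algl -piC -rmorphM !gE rmorphM.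
  by rewrite fC mulr_algl.
pose gA : {additive A -> B} := HB.pack g (GRing.isZmodMorphism.Build A B g g_zmod).
pose gR : {rmorphism A -> B} :=
  HB.pack g gA (GRing.isMonoidMorphism.Build A B g g_mon).
pose gL : {lrmorphism A -> B} :=
  HB.pack g gR (GRing.isScalable.Build k A B *:%R g g_lin).
by exists gL.
Qed.

Lemma mmap_morph (k : comNzRingType) (n : nat) (S T : comNzRingType)
    (f : {rmorphism k -> S}) (g : {rmorphism k -> T}) (h : {rmorphism S -> T})
    (v : 'I_n -> S) (w : 'I_n -> T) (p : {mpoly k[n]}) :
  (forall c, h (f c) = g c) -> (forall i, h (v i) = w i) ->
  h (mmap f v p) = mmap g w p.
Proof.
move=> hf hv; rewrite /mmap rmorph_sum; apply: eq_bigr => m _ /=.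
rewrite rmorphM hf /mmap1 rmorph_prod; congr (_ * _).
by apply: eq_bigr => i _; rewrite rmorphXn hv.
Qed.

Lemma mmap_id (k : comNzRingType) (n : nat) (p : {mpoly k[n]}) :
  mmap (@mpolyC n k) (fun i => 'X_i) p = p.
Proof.
rewrite [RHS]mpolyE /mmap; apply: eq_bigr => m _.
by rewrite mmap1_id mul_mpolyC.
Qed.

Section Evaluation.
Variables (k : fieldType) (n : nat).
Implicit Types A B : comAlgType k.

Lemma peval_fmap A B (f : {lrmorphism A -> B}) (v : {ffun 'I_n -> A}) p :
  f (peval v p) = peval (aff_fmap f v) p.
Proof.
apply: mmap_morph => [c|i]; last by rewrite ffunE.
exact: rmorph_alg.
Qed.

(** The algebra is k[x_1, .., x_n] / I and the point consists of the classes of the variables. The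
    ideal has to be proper since algebras are nonzero. *)
Lemma generic_point (I : {mpoly k[n]} -> Prop) : is_ideal I -> ~ I 1 ->
  exists (A : comAlgType k) (v : {ffun 'I_n -> A}),
  [/\ forall p, peval v p = 0 <-> I p,
      forall B (w : {ffun 'I_n -> B}), (forall p, I p -> peval w p = 0) ->
        exists f : {lrmorphism A -> B}, aff_fmap f v = w
    & forall a, exists p, a = peval v p].
Proof.
move=> idI I1; have [A [pi [piC pi0 pis]]] :=
  quotient_algebraP (@mpolyC n k : {rmorphism k -> {mpoly k[n]}}) idI I1.
pose v := [ffun i : 'I_n => pi 'X_i].
have vE p : peval v p = pi p.
  rewrite -{2}[p]mmap_id; symmetry; apply: mmap_morph => [//|i].
  by rewrite ffunE.
exists A, v; split=> [p|B w wI|a]; first by rewrite vE.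
  pose f : {rmorphism {mpoly k[n]} -> B} := mmap (in_alg B) w.
  have [||g gE] := quotient_lift (f := f) piC pis.
  - by move=> c; rewrite /f /= mmapC.
  - by move=> x /pi0/wI.
  exists g; apply/ffunP=> i; rewrite !ffunE gE /f /= mmapX mmap1U.
  by [].
by have [p <-] := pis a; exists p; rewrite vE.
Qed.

(** The generic point alone decides membership; as nilpotents are allowed in the algebras, no
    radical appears. *)
Lemma ideal_points (I : {mpoly k[n]} -> Prop) p : is_ideal I ->
  (forall A (v : {ffun 'I_n -> A}), (forall q, I q -> peval v q = 0) ->
     peval v p = 0) -> I p.
Proof.
move=> idI h; have [I1|nI1] := pselect (I 1).
  by rewrite -[p]mulr1; apply: idealMl.
have [A [v [v0 _ _]]] := generic_point idI nI1.
by apply/v0/h => q /v0.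
Qed.
End Evaluation.

(** * Families that are free modulo a subspace *)

Definition is_subspace (k : fieldType) (V : lmodType k) (I : V -> Prop) :=
  I 0 /\ forall a x y, I x -> I y -> I (a *: x + y).

Section Subspaces.
Variables (k : fieldType) (V : lmodType k) (I : V -> Prop).
Hypothesis subI : is_subspace I.

(** Finite families independent modulo [I] replace a basis of V / I, which may be infinite: each
    argument meets only finitely many vectors. *)
Definition free_mod (r : nat) (c : 'I_r -> V) :=
  forall a : 'I_r -> k, I (\sum_i a i *: c i) -> forall i, a i = 0.

Definition span_mod (r : nat) (c : 'I_r -> V) (x : V) :=
  exists a : 'I_r -> k, I (x - \sum_i a i *: c i).

Lemma subspaceZ a x : I x -> I (a *: x).
Proof. by move=> Ix; rewrite -[_ *: _]addr0; apply: subI.2 => //; apply: subI.1. Qed.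
Lemma subspaceD x y : I x -> I y -> I (x + y).
Proof. by move=> Ix Iy; rewrite -[x]scale1r; apply: subI.2. Qed.
Lemma subspaceB x y : I x -> I y -> I (x - y).
Proof. by move=> Ix Iy; apply: subspaceD => //; rewrite -scaleN1r; apply: subspaceZ. Qed.
Lemma subspace_sum (T : eqType) (r : seq T) (F : T -> V) :
  (forall i, i \in r -> I (F i)) -> I (\sum_(i <- r) F i).
Proof.
move=> h; rewrite big_seq; apply: big_ind => //; first exact: subI.1.
exact: subspaceD.
Qed.

Lemma span_mod_mem r (c : 'I_r -> V) i : span_mod c (c i).
Proof.
exists (fun j => (j == i)%:R).
rewrite (bigD1 i) //= eqxx scale1r big1 ?addr0 ?subrr; first exact: subI.1.
by move=> j /negPf ->; rewrite scale0r.
Qed.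

Lemma free_mod_extract (s : seq V) : exists (r : nat) (c : 'I_r -> V),
  [/\ free_mod c, forall x, x \in s -> span_mod c x & forall i, c i \in s].
Proof.
elim: s => [|x s [r [c [cf cs ci]]]].
  by exists 0%N, (fun=> 0); split=> [a _ []|//|[]].
have [xs|nxs] := pselect (span_mod c x).
  exists r, c; split=> // [y|i]; rewrite inE.
    by case/orP=> [/eqP ->|/cs].
  by rewrite ci orbT.
pose c' (i : 'I_r.+1) := if unlift ord0 i is Some j then c j else x.
have c'0 : c' ord0 = x by rewrite /c' unlift_none.
have c'S j : c' (lift ord0 j) = c j by rewrite /c' liftK.
have c'E (a : 'I_r.+1 -> k) : \sum_i a i *: c' i =
    a ord0 *: x + \sum_i a (lift ord0 i) *: c i.
  rewrite big_ord_recl c'0; congr (_ + _).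
  by apply: eq_bigr => i _; rewrite c'S.
exists r.+1, c'; split.
- move=> a; rewrite c'E => Ia.
  have a0 : a ord0 = 0.
    apply: contra_notP nxs => /eqP a0.
    exists (fun i => - ((a ord0)^-1 * a (lift ord0 i))).
    have := subspaceZ (a ord0)^-1 Ia.
    rewrite scalerDr scalerA mulVf // scale1r scaler_sumr; congr (I (_ + _)).
    by rewrite -sumrN; apply: eq_bigr => i _; rewrite scalerA scaleNr opprK.
  move: Ia; rewrite a0 scale0r add0r => /cf h i.
  by case: (unliftP ord0 i) => [j ->|->]; rewrite ?h ?a0.
- move=> y; rewrite inE => /orP[/eqP ->|/cs [a h]].
    by rewrite -c'0; apply: span_mod_mem.
  exists (fun i => if unlift ord0 i is Some j then a j else 0).
  rewrite c'E unlift_none scale0r add0r; move: h; congr (I (_ - _)).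
  by apply: eq_bigr => i _; rewrite liftK.
- move=> i; rewrite inE; case: (unliftP ord0 i) => [j ->|->].
    by rewrite c'S ci orbT.
  by rewrite c'0 eqxx.
Qed.
End Subspaces.

Lemma ideal_subspace (k : fieldType) (A : algType k) (I : A -> Prop) :
  I 0 -> (forall x y, I x -> I y -> I (x + y)) -> (forall a x, I x -> I (a * x)) ->
  is_subspace I.
Proof.
move=> I0 ID IM; split=> // a x y Ix Iy.
by apply: ID => //; rewrite -mulr_algl; apply: IM.
Qed.

(* Flatness over the field k: the family c stays free modulo I after the base
   change from k to R/Q.  Elements of R (x) k[x_1, .., x_m] are given by their
   coefficients. *)
Lemma free_mod_tensor (k : fieldType) (R : lmodType k) (Q : R -> Prop) (m : nat)
    (I : {mpoly k[m]} -> Prop) (r : nat) (c : 'I_r -> {mpoly k[m]})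
    (w : 'I_r -> R) (s : seq (R * {mpoly k[m]})) :
  is_subspace Q -> is_subspace I -> free_mod I c ->
  (forall x, x \in s -> I x.2) ->
  (forall u, Q (\sum_l (c l)@_u *: w l - \sum_(x <- s) x.2@_u *: x.1)) ->
  forall l, Q (w l).
Proof.
move=> subQ subI cf sI h.
have [t [e [ef es _]]] :=
  free_mod_extract subQ ([seq w l | l <- enum 'I_r] ++ [seq x.1 | x <- s]).
have /choice[a aP] : forall l, exists a : 'I_t -> k, Q (w l - \sum_i a i *: e i).
  by move=> l; apply: es; rewrite mem_cat map_f // mem_enum.
have /choice[b bP] : forall x, exists b : 'I_t -> k,
    x \in s -> Q (x.1 - \sum_i b i *: e i).
  move=> x; have [xs|xs] := boolP (x \in s); last by exists (fun=> 0).
  suff [b ?] : span_mod Q e x.1 by exists b.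
  by apply: es; rewrite mem_cat map_f ?orbT.
(* [d i] collects the terms in [e i]. Freeness of [e] modulo [Q] makes its coefficients vanish, so
   \sum_l a l i *: c l lies in [I], and freeness of [c] gives a l i = 0. *)
pose d i := \sum_l a l i *: c l - \sum_(x <- s) b x i *: x.2.
have d0 i : d i = 0.
  apply/mpolyP=> u; rewrite mcoeff0; move: i; apply: ef.
  have := h u.
  have Qc : Q (\sum_l (c l)@_u *: (w l - \sum_i a l i *: e i)).
    by apply: subspace_sum => // l _; apply: subspaceZ.
  have Qs : Q (\sum_(x <- s) x.2@_u *: (x.1 - \sum_i b x i *: e i)).
    by apply: subspace_sum => // x xs; apply: subspaceZ => //; apply: bP.
  move=> Qh; have := subspaceD subQ (subspaceB subQ Qh Qc) Qs; congr Q.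
  have -> : \sum_l (c l)@_u *: (w l - \sum_i a l i *: e i) =
      \sum_l (c l)@_u *: w l - \sum_l (c l)@_u *: \sum_i a l i *: e i.
    by rewrite -sumrB; apply: eq_bigr => l _; rewrite scalerBr.
  have -> : \sum_(x <- s) x.2@_u *: (x.1 - \sum_i b x i *: e i) =
      \sum_(x <- s) x.2@_u *: x.1 - \sum_(x <- s) x.2@_u *: \sum_i b x i *: e i.
    by rewrite -sumrB; apply: eq_bigr => x _; rewrite scalerBr.
  have -> (x y z t' : R) : x - y - (x - z) + (y - t') = z - t'.
    by rewrite opprB [z - x]addrC [X in X + _]addrACA subrr add0r addrACA addNr add0r.
  have -> : \sum_i (d i)@_u *: e i =
      \sum_i \sum_l (c l)@_u *: (a l i *: e i) -
      \sum_i \sum_(x <- s) x.2@_u *: (b x i *: e i).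
    rewrite -sumrB; apply: eq_bigr => i _.
    rewrite /d mcoeffB scalerBl; congr (_ - _); rewrite raddf_sum scaler_suml.
      by apply: eq_bigr => l _; rewrite /= mcoeffZ scalerA mulrC.
    by apply: eq_bigr => x _; rewrite /= mcoeffZ scalerA mulrC.
  rewrite [in RHS]exchange_big [X in _ = _ - X]exchange_big /=; congr (_ - _).
    by apply: eq_bigr => l _; rewrite scaler_sumr.
  by apply: eq_bigr => l _; rewrite scaler_sumr.
move=> l; suff a0 i : a l i = 0.
  by have := aP l; rewrite big1 ?subr0 // => i _; rewrite a0 scale0r.
move: l; apply: (cf (a^~ i)); have /eqP := d0 i; rewrite subr_eq0 => /eqP ->.
by apply: subspace_sum => // x xs; apply: (subspaceZ subI); exact: sI.
Qed.

Lemma free_mod_base_change (k : fieldType) (A : comAlgType k) (Q : A -> Prop)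
    (m : nat) (I : {mpoly k[m]} -> Prop) (r : nat) (c : 'I_r -> {mpoly k[m]})
    (w : 'I_r -> A) :
  is_ideal Q -> is_ideal I -> free_mod I c ->
  ideal_gen (fun z : {mpoly A[m]} => (exists2 q, Q q & z = q%:MP) \/
      (exists2 i, I i & z = map_mpoly (in_alg A) i))
    (\sum_l (w l)%:MP * map_mpoly (in_alg A) (c l)) ->
  forall l, Q (w l).
Proof.
move=> idQ idI cf.
have subQ : is_subspace Q by case: idQ => *; apply: ideal_subspace.
have subI : is_subspace I by case: idI => *; apply: ideal_subspace.
(* [D z] says that, modulo [Q], [z] is a sum of tensors whose second factors lie in [I]. It holds on
   the whole generated ideal and is the form in which [free_mod_tensor] takes its hypothesis. *)
pose D (z : {mpoly A[m]}) := exists2 s : seq (A * {mpoly k[m]}),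
  forall x, x \in s -> I x.2 & forall u, Q (z@_u - \sum_(x <- s) x.2@_u *: x.1).
have D0 : D 0.
  by exists [::] => // u; rewrite mcoeff0 big_nil subrr; apply: ideal0.
have DD z z' : D z -> D z' -> D (z + z').
  move=> [s sI sz] [s' sI' sz']; exists (s ++ s').
    by move=> x; rewrite mem_cat => /orP[/sI|/sI'].
  move=> u; rewrite big_cat mcoeffD opprD addrACA.
  by apply: subspaceD.
suff DI z : ideal_gen (fun z : {mpoly A[m]} => (exists2 q, Q q & z = q%:MP) \/
      (exists2 i, I i & z = map_mpoly (in_alg A) i)) z -> D z.
  move=> /DI[s sI sz]; apply: (free_mod_tensor subQ subI cf sI) => u.
  have := sz u; congr (Q (_ - _)); rewrite raddf_sum /=; apply: eq_bigr => l _.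
  by rewrite mcoeffCM mcoeff_map_mpoly /= mulr_algr.
case=> s sP ->; rewrite big_seq; apply: big_ind => // -[a b] /sP /= [] [x xP ->].
  exists [::] => // u; rewrite big_nil subr0 mulrC mcoeffCM.
  by apply: idealMr.
exists [seq (a@_v, 'X_[v] * x) | v <- msupp a].
  by move=> _ /mapP[v _ ->]; apply: idealMl.
move=> u; rewrite big_map {1}[a]mpolyE mulr_suml raddf_sum /=.
rewrite -sumrB big1 => [|v _]; first exact: ideal0.
apply/eqP; rewrite subr_eq0 -scalerAl mcoeffZ; apply/eqP.
have -> : 'X_[v] = map_mpoly (in_alg A) 'X_[v] by rewrite map_mpolyX.
by rewrite -rmorphM mcoeff_map_mpoly /= mulr_algr.
Qed.

Section TensorPolynomials.
Variables (k : fieldType) (n m : nat).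
Implicit Types (a : {mpoly k[n]}) (b : {mpoly k[m]}) (W : {mpoly k[n + m]}).

HB.instance Definition _ := GRing.RMorphism.copy (@inx k n m)
  (mmap (@mpolyC (n + m) k) (fun i => 'X_(lshift m i))).
HB.instance Definition _ := GRing.RMorphism.copy (@iny k n m)
  (mmap (@mpolyC (n + m) k) (fun i => 'X_(rshift n i))).

(** The ideal of the product of two closed subschemes: the quotient by it is k[x] / I (x) k[y] /
    J. *)
Definition sum_ideal (I : {mpoly k[n]} -> Prop) (J : {mpoly k[m]} -> Prop) :
    {mpoly k[n + m]} -> Prop :=
  ideal_gen (fun q => (exists2 a, I a & q = inx m a) \/
                      (exists2 b, J b & q = iny n b)).

Lemma tens_decomp W :
  exists s : seq ({mpoly k[n]} * {mpoly k[m]}), W = \sum_(x <- s) tens x.1 x.2.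
Proof.
exists [seq (W@_u *: 'X_[[multinom u (lshift m i) | i < n]],
  'X_[[multinom u (rshift n i) | i < m]]) | u <- msupp W].
rewrite big_map {1}[W]mpolyE; apply: eq_bigr => u _ /=.
rewrite /tens /inx /iny mmapZ !mmapX -mulrA mul_mpolyC; congr (_ *: _).
rewrite -mmap1_id /mmap1 big_split_ord; congr (_ * _); apply: eq_bigr => i _ /=.
  by rewrite mnmE.
by rewrite mnmE.
Qed.

Lemma inxC c : inx m (c%:MP : {mpoly k[n]}) = c%:MP.
Proof. exact: mmapC. Qed.
Lemma inyC c : iny n (c%:MP : {mpoly k[m]}) = c%:MP.
Proof. exact: mmapC. Qed.

Lemma tens_sumr a (r : nat) (t : 'I_r -> k) (b : 'I_r -> {mpoly k[m]}) :
  tens a (\sum_i t i *: b i) = \sum_i tens (t i *: a) (b i).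
Proof.
rewrite /tens rmorph_sum mulr_sumr; apply: eq_bigr => i _.
by rewrite -!mul_mpolyC !rmorphM /= inxC inyC mulrCA mulrA.
Qed.

Lemma tens_decomp_free (J : {mpoly k[m]} -> Prop) W : is_ideal J ->
  exists (r : nat) (w : 'I_r -> {mpoly k[n]}) (c : 'I_r -> {mpoly k[m]})
    (s : seq ({mpoly k[n]} * {mpoly k[m]})),
  [/\ free_mod J c, forall x, x \in s -> J x.2
    & W = \sum_l tens (w l) (c l) + \sum_(x <- s) tens x.1 x.2].
Proof.
move=> idJ; have subJ : is_subspace J by case: idJ => *; apply: ideal_subspace.
have [s ->] := tens_decomp W.
have [r [c [cf cs _]]] := free_mod_extract subJ [seq x.2 | x <- s].
have /choice[t tP] : forall x : {mpoly k[n]} * {mpoly k[m]},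
    exists t : 'I_r -> k, x \in s -> J (x.2 - \sum_i t i *: c i).
  move=> x; have [xs|xs] := boolP (x \in s); last by exists (fun=> 0).
  suff [t ?] : span_mod J c x.2 by exists t.
  by apply: cs; apply: map_f.
exists r, (fun l => \sum_(x <- s) t x l *: x.1), c,
  [seq (x.1, x.2 - \sum_i t x i *: c i) | x <- s]; split=> //.
  by move=> _ /mapP[x xs ->]; apply: tP.
rewrite big_map /= /tens.
have -> : \sum_l inx m (\sum_(x <- s) t x l *: x.1) * iny n (c l) =
    \sum_(x <- s) tens x.1 (\sum_i t x i *: c i).
  under [RHS]eq_bigr do rewrite tens_sumr.
  rewrite [RHS]exchange_big /=; apply: eq_bigr => l _.
  by rewrite rmorph_sum mulr_suml.
rewrite -big_split /=; apply: eq_bigr => x _.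
by rewrite rmorphB mulrBr addrC subrK.
Qed.

(** Base change from k to k[x], with k[x, y] read as k[x][y] and [I] as the ideal of scalars. *)
Lemma free_mod_sum_ideal (I : {mpoly k[n]} -> Prop) (J : {mpoly k[m]} -> Prop)
    (r : nat) (w : 'I_r -> {mpoly k[n]}) (c : 'I_r -> {mpoly k[m]}) :
  is_ideal I -> is_ideal J -> free_mod J c ->
  sum_ideal I J (\sum_l tens (w l) (c l)) -> forall l, I (w l).
Proof.
move=> idI idJ cf h; apply: (free_mod_base_change idI idJ cf).
pose f : {rmorphism {mpoly k[n + m]} -> {mpoly {mpoly k[n]}[m]}} :=
  mmap (@mpolyC m _ \o @mpolyC n k) (fun i => match split i with
    inl i1 => ('X_i1)%:MP | inr i2 => 'X_i2 end).
have fx a : f (inx m a) = a%:MP.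
  transitivity (mmap (@mpolyC m _ \o @mpolyC n k) (fun i => ('X_i)%:MP) a).
    apply: mmap_morph => [t|i]; rewrite /f /= ?mmapC // mmapX mmap1U.
    by rewrite (unsplitK (inl i)).
  by symmetry; rewrite -[in LHS](mmap_id a); apply: mmap_morph.
have fy b : f (iny n b) = map_mpoly (in_alg _) b.
  transitivity (mmap (@mpolyC m _ \o @mpolyC n k) (fun i => 'X_i) b).
    apply: mmap_morph => [t|i]; rewrite /f /= ?mmapC // mmapX mmap1U.
    by rewrite (unsplitK (inr i)).
  rewrite -[in RHS](mmap_id b); symmetry; apply: mmap_morph => [t|i].
    by rewrite /= map_mpolyC /= alg_mpolyC.
  by rewrite /= map_mpolyX.
have -> : \sum_l (w l)%:MP * map_mpoly (in_alg {mpoly k[n]}) (c l) =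
   f (\sum_l tens (w l) (c l)).
  by rewrite rmorph_sum; apply: eq_bigr => l _; rewrite rmorphM fx fy.
move: h; apply: ideal_gen_morph => _ [] [x xP ->]; apply: mem_ideal_gen.
  by left; exists x.
by right; exists x.
Qed.
End TensorPolynomials.

(** * Noetherian rings *)

Definition noetherian (R : comNzRingType) :=
  forall I : R -> Prop, is_ideal I -> fin_gen I.

Lemma noetherian_field (k : fieldType) : noetherian k.
Proof.
move=> I idI; have [[x Ix x0]|h] := pselect (exists2 x, I x & x != 0).
  exists [:: x] => y; split=> [Iy|].
    exists [:: (y / x, x)]; last by rewrite big_seq1 divfK.
    by move=> ab; rewrite inE => /eqP ->; rewrite mem_head.
  by apply: ideal_gen_min => // z; rewrite inE => /eqP ->.
exists [::] => y; split=> [Iy|].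
  have [->|y0] := eqVneq y 0; first exact: (ideal0 (ideal_gen_ideal _)).
  by case: h; exists y.
exact: ideal_gen_min.
Qed.

Lemma noetherian_int : noetherian int.
Proof.
move=> I idI; have [[x Ix x0]|h] := pselect (exists2 x, I x & x != 0).
  pose P m := `[< (0 < m)%N /\ I m%:Z >].
  have exP : exists m, P m.
    exists `|x|%N; apply/asboolP; split; first by rewrite absz_gt0.
    case: x Ix {x0} => // j Ij; rewrite /= -[Posz _]opprK -NegzE.
    exact: idealN.
  have /asboolP[m0 Im] : P (ex_minn exP) by case: ex_minnP.
  have minm j : (0 < j)%N -> I j%:Z -> (ex_minn exP <= j)%N.
    by move=> j0 Ij; case: ex_minnP => i _; apply; apply/asboolP.
  move: (ex_minn exP) m0 Im minm => m m0 Im minm.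
  exists [:: m%:Z] => y; split=> [Iy|]; last first.
    by apply: ideal_gen_min => // z; rewrite inE => /eqP ->.
  exists [:: ((y %/ m)%Z, m%:Z)].
    by move=> ab; rewrite inE => /eqP ->; rewrite mem_head.
  rewrite big_seq1 /= {1}(divz_eq y m).
  have Ir : I (y %% m)%Z.
    by rewrite /modz; apply: idealB => //; apply: idealMl.
  have r0 : (0 <= y %% m)%Z by apply: modz_ge0; rewrite -lt0n.
  have rm : (y %% m < m)%Z by apply: ltz_pmod.
  case: (y %% m)%Z r0 rm Ir => [[|j]|//] _ jm Ij; first by rewrite addr0.
  by have := minm j.+1 isT Ij; rewrite leqNgt -ltz_nat jm.
exists [::] => y; split=> [Iy|].
  have [->|y0] := eqVneq y 0; first exact: (ideal0 (ideal_gen_ideal _)).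
  by case: h; exists y.
exact: ideal_gen_min.
Qed.

Lemma noetherian_surj (R S : comNzRingType) (f : {rmorphism R -> S}) :
  (forall y, exists x, f x = y) -> noetherian R -> noetherian S.
Proof.
move=> fs nR I idI; have [s sP] := nR _ (ideal_preimage f idI).
exists [seq f x | x <- s] => y; split=> [|].
  have [x <-] := fs y => /sP; apply: ideal_gen_morph => z zs.
  by apply: mem_ideal_gen; apply: map_f.
apply: ideal_gen_min => // _ /mapP[x xs ->]; apply/sP.
exact: mem_ideal_gen.
Qed.

Lemma noetherian_poly (R : comNzRingType) : noetherian R -> noetherian {poly R}.
Proof.
move=> nR I idI.
(* The ideals of leading coefficients in Hilbert's proof, one for each degree bound d. *)
pose L d x := exists f : {poly R}, [/\ I f, (size f <= d.+1)%N & f`_d = x].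
have idL d : is_ideal (L d).
  split.
  - by exists 0; rewrite size_poly0 coef0; split=> //; apply: ideal0.
  - move=> _ _ [f [If sf <-]] [g [Ig sg <-]]; exists (f + g).
    split; [exact: idealD| |exact: coefD].
    by rewrite (leq_trans (size_polyD _ _)) // geq_max sf.
  - move=> a _ [f [If sf <-]]; exists (a%:P * f); rewrite coefCM; split=> //.
      exact: idealMl.
    by rewrite mul_polyC (leq_trans (size_scale_leq _ _)).
have L_mono d e x : (d <= e)%N -> L d x -> L e x.
  move=> /subnK <-; elim: (e - d)%N => // i IH /IH[f [If sf <-]].
  exists (f * 'X); rewrite coefMX /=; split=> //; first exact: idealMr.
  have [->|f0] := eqVneq f 0; first by rewrite mul0r size_poly0.
  by rewrite size_mulX.
have idLu : is_ideal (fun x => exists d, L d x).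
  split; first by exists 0%N; apply: ideal0.
    move=> x y [d Lx] [e Ly]; exists (maxn d e).
    by apply: idealD => //; [apply: L_mono Lx | apply: L_mono Ly];
      rewrite ?leq_maxl ?leq_maxr.
  by move=> a x [d Lx]; exists d; apply: idealMl.
have [sL sLP] := nR _ idLu.
(* The union of the increasing ideals [L d] is finitely generated, so they are constant from some
   [D] on. *)
have [D LD] : exists D, forall d x, L d x -> L D x.
  suff [D sD] : exists D, forall y, y \in sL -> L D y.
    exists D => d x Lx; have /sLP : exists d, L d x by exists d.
    exact: ideal_gen_min.
  have {sLP} : forall y, y \in sL -> exists d, L d y.
    by move=> y ys; apply/sLP; apply: mem_ideal_gen.
  elim: sL => [|y s IH] h; first by exists 0%N.
  have [|D DP] := IH; first by move=> z zs; apply: h; rewrite inE zs orbT.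
  have [|d Ly] := h y; first by rewrite mem_head.
  exists (maxn d D) => z; rewrite inE => /orP[/eqP ->|/DP].
    by apply: L_mono Ly; rewrite leq_maxl.
  by apply: L_mono; rewrite leq_maxr.
have /choice[G GP] : forall d, exists G : seq {poly R},
    (forall g, g \in G -> I g) /\
    forall x, L d x -> exists h : {poly R}, [/\ ideal_gen (fun g => g \in G) h,
      (size h <= d.+1)%N & h`_d = x].
  move=> d; have [s sP] := nR _ (idL d).
  have /choice[F FP] : forall y, exists f : {poly R},
      y \in s -> [/\ I f, (size f <= d.+1)%N & f`_d = y].
    move=> y; have [ys|ys] := boolP (y \in s); last by exists 0.
    have /sP[f fP] : ideal_gen (fun y => y \in s) y by apply: mem_ideal_gen.
    by exists f.
  exists [seq F y | y <- s]; split=> [_ /mapP[y /FP[? _ _] ->] //|x /sP].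
  apply: (@ideal_gen_min _ _ (fun x => exists h : {poly R},
    [/\ ideal_gen (fun g => g \in [seq F y | y <- s]) h,
      (size h <= d.+1)%N & h`_d = x])).
    split.
    - exists 0; rewrite size_poly0 coef0; split=> //.
      exact: (ideal0 (ideal_gen_ideal _)).
    - move=> _ _ [f [If sf <-]] [g [Ig sg <-]]; exists (f + g).
      split; [exact: (idealD (ideal_gen_ideal _))| |exact: coefD].
      by rewrite (leq_trans (size_polyD _ _)) // geq_max sf.
    - move=> a _ [f [If sf <-]]; exists (a%:P * f); rewrite coefCM; split=> //.
        exact: (idealMl _ (ideal_gen_ideal _)).
      by rewrite mul_polyC (leq_trans (size_scale_leq _ _)).
  move=> y ys; have [IF sF Fy] := FP y ys; exists (F y); split=> //.
  by apply: mem_ideal_gen; apply: map_f.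
pose s := flatten [seq G d | d <- iota 0 D.+1].
have Gs d g : (d <= D)%N -> g \in G d -> g \in s.
  move=> dD gG; apply/flattenP; exists (G d) => //; apply: map_f.
  by rewrite mem_iota add0n ltnS.
exists s => f; split=> [|]; last first.
  by apply: ideal_gen_min => // g /flattenP[_ /mapP[d _ ->]]; apply: (GP d).1.
have [m] := ubnP (size f); elim: m f => // m IH f; rewrite ltnS => sf If.
case: m => [|m] in IH sf *.
  move: sf; rewrite leqn0 size_poly_eq0 => /eqP ->.
  exact: (ideal0 (ideal_gen_ideal _)).
(* In degrees above [D] the generators found for [L D], multiplied by powers of X, still cancel the
   leading coefficient. *)
pose e := minn m D.
have : L e f`_m.
  have Lm : L m f`_m by exists f.
  by rewrite /e; case: (leqP m D) => // _; apply: LD Lm.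
case/(GP e).2 => h [hG sh hm].
have hs : ideal_gen (fun g => g \in s) ('X^(m - e) * h).
  apply: idealMl; first exact: ideal_gen_ideal.
  by apply: ideal_gen_sub hG => g; apply: Gs; rewrite geq_minr.
have em : (e <= m)%N by rewrite geq_minl.
rewrite -(subrK ('X^(m - e) * h) f); apply: idealD => //; first exact: ideal_gen_ideal.
apply: IH.
  rewrite ltnS; apply/leq_sizeP => j; rewrite leq_eqVlt => /orP[/eqP <-|mj].
    by rewrite coefB coefXnM ltnNge leq_subr /= subKn // hm subrr.
  rewrite coefB coefXnM nth_default ?(leq_trans sf) // sub0r.
  case: ltnP => _; rewrite ?oppr0 // nth_default ?oppr0 //.
  by rewrite (leq_trans sh) // ltn_subRL subnK.
apply: idealB => //.
have [GI _] := GP e; apply: idealMl => //.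
exact: ideal_gen_min GI hG.
Qed.

(* A noetherian substitute for the polynomial ring R[t_1, .., t_N]. *)
Lemma noetherian_universal (R : comNzRingType) (N : nat) : noetherian R ->
  exists (U : comNzRingType) (t : 'I_N -> U), noetherian U /\
  exists inj : {rmorphism R -> U},
  forall (S : comNzRingType) (phi : {rmorphism R -> S}) (c : 'I_N -> S),
  exists2 psi : {rmorphism U -> S},
    forall x, psi (inj x) = phi x & forall i, psi (t i) = c i.
Proof.
move=> nR; elim: N => [|N [U [t [nU [inj injP]]]]].
  exists R, (fun=> 0); split=> //; exists idfun => S phi c.
  by exists phi => // -[].
exists {poly U}, (fun i => if unlift ord0 i is Some j then (t j)%:P else 'X).
split; first exact: noetherian_poly.
exists (polyC \o inj) => S phi c.
have [psi psi1 psi2] := injP S phi (fun j => c (lift ord0 j)).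
pose psi' : {rmorphism {poly U} -> S} :=
  horner_morph (fun x => mulrC (c ord0) (psi x)).
exists psi' => [x|i]; first by rewrite /psi' /= horner_morphC.
case: unliftP => [j ->|->]; first by rewrite /psi' /= horner_morphC.
by rewrite /psi' /= horner_morphX.
Qed.

Lemma noetherian_mpoly (k : fieldType) (n : nat) : noetherian {mpoly k[n]}.
Proof.
have [U [t [nU [inj injP]]]] := noetherian_universal n (@noetherian_field k).
have [psi psi1 psi2] := injP {mpoly k[n]} (@mpolyC n k) (fun i => 'X_i).
apply: (noetherian_surj (f := psi)) nU => p.
exists (mmap inj t p); rewrite -[RHS]mmap_id.
exact: mmap_morph.
Qed.

(** * Orders of vanishing and Krull's intersection theorem *)

(** Zorn's lemma for predicates. [L0] bounds the empty chain; for the maximal predicate to contain a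
    given one, this containment has to be part of [P]. *)
Lemma maximal_predicate (T : Type) (P : (T -> Prop) -> Prop) (L0 : T -> Prop) :
  P L0 ->
  (forall C : (T -> Prop) -> Prop, (exists L, C L) -> (forall L, C L -> P L) ->
    (forall L L', C L -> C L' ->
      (forall x, L x -> L' x) \/ (forall x, L' x -> L x)) ->
    P (fun x => exists2 L, C L & L x)) ->
  exists2 L, P L & forall L', P L' -> (forall x, L x -> L' x) ->
    forall x, L' x -> L x.
Proof.
move=> P0 PU; pose S := {L | P L}.
pose le (s t : S) := `[< forall x, proj1_sig s x -> proj1_sig t x >].
have [||||[L PL] Lmax] := @classical_sets.Zorn S le.
- by move=> s; apply/asboolP.
- by move=> r s t /asboolP rs /asboolP st; apply/asboolP => x /rs/st.
- move=> s t /asboolP st /asboolP ts; apply: sig_eqP; apply/funext => x.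
  by apply/propext; split; [apply: st | apply: ts].
- move=> A Atot; have [[s As]|nA] := pselect (exists s, A s); last first.
    by exists (exist _ L0 P0) => s As; case: nA; exists s.
  pose C L := exists2 s, A s & L = proj1_sig s.
  have PC : P (fun x => exists2 L, C L & L x).
    apply: PU; first by exists (proj1_sig s), s.
      by move=> _ [[L ?] _ ->].
    move=> _ _ [s1 A1 ->] [s2 A2 ->].
    by case: (Atot _ _ A1 A2) => /asboolP; [left | right].
  exists (exist _ _ PC) => s' As'; apply/asboolP => x sx.
  by exists (proj1_sig s') => //; exists s'.
- exists L => // L' PL' LL' x L'x.
  have := Lmax (exist _ L' PL').
  have -> : le (exist _ L PL) (exist _ L' PL') by apply/asboolP.
  by move=> /(_ isT) [<-].
Qed.

Lemma chain_ideal (R : comNzRingType) (C : (R -> Prop) -> Prop) :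
  (exists L, C L) -> (forall L, C L -> is_ideal L) ->
  (forall L L', C L -> C L' ->
    (forall x, L x -> L' x) \/ (forall x, L' x -> L x)) ->
  is_ideal (fun x => exists2 L, C L & L x).
Proof.
move=> [L CL] CI Ctot; split.
- by exists L => //; apply: ideal0; apply: CI.
- move=> x y [L1 C1 L1x] [L2 C2 L2y].
  case: (Ctot _ _ C1 C2) => h.
    by exists L2 => //; apply: idealD; [apply: CI | apply: h |].
  by exists L1 => //; apply: idealD; [apply: CI | | apply: h].
- by move=> a x [L1 C1 L1x]; exists L1 => //; apply: idealMl => //; apply: CI.
Qed.

(** Membership in m^a, where m is the ideal generated by the variables. *)
Definition vanish_order (R : comNzRingType) (n a : nat) (f : {mpoly R[n]}) :=
  forall u : 'X_{1..n}, (mdeg u < a)%N -> f@_u = 0.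

Section VanishingOrder.
Variables (R : comNzRingType) (n : nat).
Implicit Types (f g : {mpoly R[n]}).

Lemma vanish_order0 a : vanish_order a (0 : {mpoly R[n]}).
Proof. by move=> u _; rewrite mcoeff0. Qed.
Lemma vanish_orderD a f g :
  vanish_order a f -> vanish_order a g -> vanish_order a (f + g).
Proof. by move=> hf hg u ua; rewrite mcoeffD hf ?hg ?addr0. Qed.
Lemma vanish_orderN a f : vanish_order a f -> vanish_order a (- f).
Proof. by move=> hf u ua; rewrite mcoeffN hf ?oppr0. Qed.
Lemma vanish_order_le a b f : (a <= b)%N -> vanish_order b f -> vanish_order a f.
Proof. by move=> ab h u ua; apply: h; apply: leq_trans ab. Qed.
Lemma vanish_order_sum a (T : eqType) (r : seq T) (Q : pred T)
    (F : T -> {mpoly R[n]}) :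
  (forall i, i \in r -> Q i -> vanish_order a (F i)) ->
  vanish_order a (\sum_(i <- r | Q i) F i).
Proof.
move=> h; rewrite big_seq_cond; apply: big_ind.
- exact: vanish_order0.
- exact: vanish_orderD.
- by move=> i /andP[]; apply: h.
Qed.
Lemma vanish_orderM a b f g :
  vanish_order a f -> vanish_order b g -> vanish_order (a + b) (f * g).
Proof.
move=> hf hg u uab; rewrite mcoeffM big1 // => -[u1 u2] /eqP /= e.
have [u1a|u1a] := ltnP (mdeg u1) a; first by rewrite hf ?mul0r.
have em : mdeg u = (mdeg u1 + mdeg u2)%N by rewrite -mdegD -e.
rewrite (hg u2) ?mulr0 // -(ltn_add2l a); apply: leq_ltn_trans uab.
by apply: leq_trans (eq_leq (esym em)); rewrite leq_add2r.
Qed.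
Lemma vanish_orderMl a f g : vanish_order a g -> vanish_order a (f * g).
Proof. by move=> h; rewrite -[a]add0n; apply: vanish_orderM. Qed.
Lemma vanish_orderMr a f g : vanish_order a f -> vanish_order a (f * g).
Proof. by rewrite mulrC; apply: vanish_orderMl. Qed.
Lemma vanish_order1 f : f@_0 = 0 <-> vanish_order 1 f.
Proof.
split=> [f0 u|]; last by apply; rewrite mdeg0.
by rewrite ltnS leqn0 mdeg_eq0 => /eqP ->.
Qed.
Lemma vanish_orderX a u : (a <= mdeg u)%N -> vanish_order a ('X_[u] : {mpoly R[n]}).
Proof.
move=> au v va; rewrite mcoeffX; case: eqP => // e.
by move: va; rewrite -e ltnNge au.
Qed.
End VanishingOrder.

Lemma mcoeff0M (R : comNzRingType) (n : nat) (p q : {mpoly R[n]}) :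
  (p * q)@_0 = p@_0 * q@_0.
Proof. exact: (rmorphM (@mcoeff n R 0%MM)). Qed.

(** Zorn's lemma takes the place of the Artin-Rees lemma. Put E = J + m x and let L be maximal among
    the ideals that contain E and meet J + (x) in E. Noetherianity forces L to contain a power of
    each element of m, hence a power of m. So x - j lies in L for some j in J, thus in E, which
    gives x = j + j' + a x with j' in J and a in m. *)
Lemma krull_intersection (k : fieldType) (n : nat) (J : {mpoly k[n]} -> Prop)
    (x : {mpoly k[n]}) : is_ideal J ->
  (forall N, exists2 j, J j & vanish_order N (x - j)) ->
  exists2 u, u@_0 = 1 & J (u * x).
Proof.
move=> idJ xJ.
pose E f := exists j a, [/\ J j, a@_0 = 0 & f = j + a * x].
have E0 : is_ideal E.
  split.
  - by exists 0, 0; rewrite mcoeff0 mul0r addr0; split=> //; apply: ideal0.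
  - move=> _ _ [j [a [Jj a0 ->]]] [j' [a' [Jj' a0' ->]]].
    exists (j + j'), (a + a'); rewrite mcoeffD a0 a0' addr0 mulrDl addrACA.
    by split=> //; apply: idealD.
  - move=> b _ [j [a [Jj a0 ->]]]; exists (b * j), (b * a).
    rewrite mulrDr mulrA; split=> //; first exact: idealMl.
    by rewrite mcoeff0M a0 mulr0.
pose P L := [/\ is_ideal L, forall f, E f -> L f &
  forall j c, J j -> L (j + c * x) -> E (j + c * x)].
have [||L [idL EL LE] Lmax] := @maximal_predicate _ P E; first by split.
  move=> C [L0 C0] CP Ctot; split.
  - by apply: chain_ideal => //; [exists L0 | move=> L /CP[]].
  - by move=> f Ef; exists L0 => //; case: (CP _ C0) => _ h _; apply: h.
  - by move=> j c Jj [L CL]; case: (CP _ CL) => _ _; apply.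
have powL a : a@_0 = 0 -> exists s, L (a ^+ s).
  move=> a0.
  have idK : is_ideal (fun b => exists s, L (a ^+ s * b)).
    split.
    - by exists 0%N; rewrite mulr0; apply: ideal0.
    - move=> b c [s Ls] [t Lt]; exists (s + t)%N; rewrite mulrDr.
      apply: idealD => //; rewrite exprD; last by rewrite -mulrA; apply: idealMl.
      by rewrite mulrAC; apply: idealMr.
    - by move=> c b [s Ls]; exists s; rewrite mulrCA; apply: idealMl.
  (* The union of the ideals (L : a^s) is finitely generated, so it equals (L : a^t) for some
     [t]. *)
  have [s sP] := noetherian_mpoly idK.
  have [t tP] : exists t, forall b, b \in s -> L (a ^+ t * b).
    have {sP} : forall b, b \in s -> exists t, L (a ^+ t * b).
      by move=> b bs; apply/sP; apply: mem_ideal_gen.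
    elim: s => [|b s IH] h; first by exists 0%N.
    have [|t tP] := IH; first by move=> c cs; apply: h; rewrite inE cs orbT.
    have [|t' Lt'] := h b; first by rewrite mem_head.
    exists (t + t')%N => c; rewrite inE exprD -mulrA.
    move=> /orP[/eqP ->|/tP ?]; first exact: idealMl.
    by rewrite mulrCA; apply: idealMl.
  have {sP}tP b t' : L (a ^+ t' * b) -> L (a ^+ t * b).
    move=> Lb; have /sP : exists s, L (a ^+ s * b) by exists t'.
    apply: (@ideal_gen_min _ _ (fun b => L (a ^+ t * b))) => //.
    split; [by rewrite mulr0; apply: ideal0| |].
      by move=> y z; rewrite mulrDr; apply: idealD.
    by move=> y z; rewrite mulrCA; apply: idealMl.
  exists t.
  (* L + (a^t) still meets J + (x) in E: if l + b a^t = j + c x, then a (j + c x) lies in E, so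
     a^(t+1) b lies in L, hence so does a^t b, and j + c x is in L. *)
  apply: (Lmax (fun f => exists l b, L l /\ f = l + b * a ^+ t)).
  - split.
    + split.
      * by exists 0, 0; rewrite mul0r addr0; split=> //; apply: ideal0.
      * move=> _ _ [l [b [Ll ->]]] [l' [b' [Ll' ->]]]; exists (l + l'), (b + b').
        by rewrite mulrDl addrACA; split=> //; apply: idealD.
      * move=> c _ [l [b [Ll ->]]]; exists (c * l), (c * b).
        by rewrite mulrDr mulrA; split=> //; apply: idealMl.
    + by move=> f /EL Lf; exists f, 0; rewrite mul0r addr0.
    + move=> j c Jj [l [b [Ll e]]]; apply: LE => //; rewrite e.
      apply: idealD => //; rewrite mulrC; apply: (tP _ t.+1).
      have -> : a ^+ t.+1 * b = a * (j + c * x) - a * l.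
        by rewrite e mulrDr addrC addKr exprS -mulrA [b * _]mulrC.
      apply: idealB => //; last exact: idealMl.
      apply: EL; exists (a * j), (a * c); rewrite mulrDr mulrA; split=> //.
        exact: idealMl.
      by rewrite mcoeff0M a0 mul0r.
  - by move=> f Lf; exists f, 0; rewrite mul0r addr0.
  - by exists 0, 1; rewrite mul1r add0r; split=> //; apply: ideal0.
have /choice[s sP] : forall i : 'I_n, exists s, L ('X_i ^+ s).
  by move=> i; apply: powL; rewrite mcoeffX mnm1_eq0.
(* A monomial of at least this degree is divisible by some X_i^(s i); the successor makes this true
   for n = 0 as well. *)
have [j Jj xj] := xJ (\sum_i s i).+1%N.
have Lxj : L (x - j).
  rewrite [x - j]mpolyE; apply: ideal_sum => // u.
  rewrite mcoeff_msupp => u0 _; rewrite -mul_mpolyC; apply: idealMl => //.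
  have [i si] : exists i, (s i <= u i)%N.
    apply/existsP; apply: contraNT u0; rewrite negb_exists => /forallP us.
    apply/eqP/xj; rewrite ltnS mdegE; apply: leq_sum => i _.
    by apply: ltnW; rewrite ltnNge us.
  have -> : u = (U_(i) *+ s i + (u - U_(i) *+ s i))%MM.
    rewrite addmC submK //; apply/mnm_lepP => i'; rewrite mulmnE mnm1E.
    by case: eqP => [<-|]; rewrite ?mul1n ?mul0n.
  by rewrite mpolyXD -mpolyXn; apply: idealMr.
have := LE (- j) 1; rewrite mul1r addrC => /(_ (idealN idJ Jj) Lxj).
case=> j' [a [Jj' a0 e]]; exists (1 - a); first by rewrite mcoeffB mcoeff1 eqxx a0 subr0.
rewrite mulrBl mul1r; have -> : x - a * x = j + j'.
  by rewrite -[x in x - _](subrK j) e; rewrite addrAC addrK addrC.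
exact: idealD.
Qed.

(** * Substitution of polynomials *)

Lemma mpoly_ring_ind (R : comNzRingType) (n : nat) (P : {mpoly R[n]} -> Prop) :
  (forall c, P c%:MP) -> (forall i, P 'X_i) ->
  (forall p q, P p -> P q -> P (p + q)) ->
  (forall p q, P p -> P q -> P (p * q)) -> forall p, P p.
Proof.
move=> PC PX PD PM p; rewrite [p]mpolyE.
apply: big_ind; [exact: PC | exact: PD | move=> u _].
rewrite -mul_mpolyC; apply: (PM) => //; rewrite mpolyXE_id.
apply: big_ind; [exact: PC | exact: PM | move=> i _].
by elim: (u i) => [|j IH]; [exact: PC | rewrite exprS; apply: PM].
Qed.

Definition subst (R : comNzRingType) (n N : nat) (v : 'I_n -> {mpoly R[N]})
  (p : {mpoly R[n]}) : {mpoly R[N]} := mmap (@mpolyC N R) v p.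

Section Substitution.
Variable R : comNzRingType.

HB.instance Definition _ (n N : nat) (v : 'I_n -> {mpoly R[N]}) :=
  GRing.RMorphism.copy (subst v) (mmap (@mpolyC N R) v).

Lemma substC n N (v : 'I_n -> {mpoly R[N]}) c : subst v c%:MP = c%:MP.
Proof. exact: mmapC. Qed.
Lemma substX n N (v : 'I_n -> {mpoly R[N]}) i : subst v 'X_i = v i.
Proof. by rewrite /subst mmapX mmap1U. Qed.
Lemma subst_id n (p : {mpoly R[n]}) : subst (fun i => 'X_i) p = p.
Proof. exact: mmap_id. Qed.
Lemma substZ n N (v : 'I_n -> {mpoly R[N]}) c p : subst v (c *: p) = c *: subst v p.
Proof. by rewrite -!mul_mpolyC rmorphM /= substC. Qed.

Lemma mmap_subst n N (S : comNzRingType) (f : {rmorphism R -> S})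
    (a : 'I_N -> S) (v : 'I_n -> {mpoly R[N]}) p :
  mmap f a (subst v p) = mmap f (fun i => mmap f a (v i)) p.
Proof. by apply: mmap_morph => // c; rewrite /= mmapC. Qed.

Lemma subst_comp n N N' (w : 'I_N -> {mpoly R[N']}) (v : 'I_n -> {mpoly R[N]}) p :
  subst w (subst v p) = subst (fun i => subst w (v i)) p.
Proof. exact: mmap_subst. Qed.

Lemma eq_subst n N (v w : 'I_n -> {mpoly R[N]}) p : v =1 w -> subst v p = subst w p.
Proof. by move=> /funext ->. Qed.

Lemma mderivXU n (i j : 'I_n) : ('X_i : {mpoly R[n]})^`M(j) = (i == j)%:R.
Proof.
rewrite mderivX mnm1E; case: eqP => [->|_]; last by rewrite scale0r.
by rewrite scale1r -{1}[U_(j)%MM]add0m addmK mpolyX0.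
Qed.

Lemma mderiv_subst n N (v : 'I_n -> {mpoly R[N]}) p j :
  (subst v p)^`M(j) = \sum_i subst v (p^`M(i)) * (v i)^`M(j).
Proof.
elim/mpoly_ring_ind: p => [c|i|p q IHp IHq|p q IHp IHq].
- rewrite substC mderivC big1 // => i _.
  by rewrite mderivC rmorph0 mul0r.
- rewrite substX (bigD1 i) //= mderivXU eqxx rmorph1 mul1r.
  rewrite big1 ?addr0 // => i' /negPf i'i.
  by rewrite mderivXU eq_sym i'i rmorph0 mul0r.
- rewrite rmorphD mderivD IHp IHq -big_split; apply: eq_bigr => i _ /=.
  by rewrite mderivD rmorphD mulrDl.
- rewrite rmorphM mderivM IHp IHq mulr_suml mulr_sumr -big_split.
  apply: eq_bigr => i _ /=; rewrite mderivM rmorphD !rmorphM mulrDl.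
  by rewrite mulrAC -!mulrA.
Qed.

Lemma subst_congr n N (I : {mpoly R[N]} -> Prop) (v w : 'I_n -> {mpoly R[N]}) p :
  is_ideal I -> (forall i, I (v i - w i)) -> I (subst v p - subst w p).
Proof.
move=> idI vw; elim/mpoly_ring_ind: p => [c|i|p q IHp IHq|p q IHp IHq].
- by rewrite !substC subrr; apply: ideal0.
- by rewrite !substX.
- by rewrite !rmorphD opprD addrACA; apply: idealD.
- rewrite !rmorphM /=.
  have -> (x y z t : {mpoly R[N]}) : x * y - z * t = y * (x - z) + z * (y - t).
    by rewrite !mulrBr addrA [y * x]mulrC [y * z]mulrC subrK.
  by apply: idealD => //; apply: idealMl.
Qed.

Lemma vanish_order_subst n N a (v : 'I_n -> {mpoly R[N]}) p :
  (forall i, (v i)@_0 = 0) -> vanish_order a p -> vanish_order a (subst v p).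
Proof.
move=> v0 pa; rewrite [p]mpolyE rmorph_sum; apply: vanish_order_sum => u up _ /=.
rewrite substZ -mul_mpolyC; apply: vanish_orderMl.
have au : (a <= mdeg u)%N.
  by rewrite leqNgt; apply/negP => /pa /eqP; rewrite mcoeff_eq0 up.
apply: (vanish_order_le au); rewrite /subst mmapX /mmap1 mdegE.
elim/big_rec2: _ => [|i a' b _ IH]; first by move=> ? //.
apply: vanish_orderM => //; elim: (u i) => [|e IHe]; first by move=> ? //.
by rewrite exprS -add1n; apply: vanish_orderM => //; apply/vanish_order1.
Qed.

Lemma subst_coeff0 n N (v : 'I_n -> {mpoly R[N]}) p :
  (forall i, (v i)@_0 = 0) -> (subst v p)@_0 = p@_0.
Proof.
move=> v0; rewrite -[in LHS](subrK (p@_0)%:MP p) rmorphD mcoeffD.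
rewrite [X in _ + X]/= substC mcoeffC eqxx mulr1 (vanish_order_subst (a := 1)) ?add0r //.
  by apply/vanish_order1; rewrite mcoeffB mcoeffC eqxx mulr1 subrr.
by rewrite mdeg0.
Qed.
End Substitution.

(* By the Hilbert basis theorem over the ring of universal coefficients of F and
   q, a bound D works for all fields at once. *)
Lemma uniform_vanishing (n d : nat) : exists D : nat,
  forall (k : fieldType) (F : 'I_n -> {mpoly k[n]}) (q : {mpoly k[n]}),
  (forall i, (msize (F i) <= d.+1)%N) -> (msize q <= d.+1)%N ->
  (forall N, (N <= D)%N -> vanish_order N.+1 (iter N (subst F) q)) ->
  forall N, vanish_order N.+1 (iter N (subst F) q).
Proof.
(* One variable for each coefficient of each [F i] (tag [Some i]) and of [q] (tag [None]). *)
pose T : finType := (option 'I_n * 'X_{1..n < d.+1})%type.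
(* With the integers as base ring the bound does not depend on the characteristic. *)
have [U [t [nU [inj injP]]]] := noetherian_universal #|T| noetherian_int.
pose gen (o : option 'I_n) : {mpoly U[n]} :=
  \sum_(m : 'X_{1..n < d.+1}) t (enum_rank ((o, m) : T)) *: 'X_[m].
pose Fu i := gen (Some i); pose qu := gen None.
(* The coefficients of the generic iterates whose vanishing is assumed for the bound [D]. Over all
   [D] they generate a finitely generated ideal, and each generator involves finitely many
   iterates. *)
pose K D x := exists N (u : 'X_{1..n}), [/\ (mdeg u <= N)%N, (N <= D)%N &
  x = (iter N (subst Fu) qu)@_u].
have [s sP] := nU _ (ideal_gen_ideal (fun x => exists D, K D x)).
have [D DP] : exists D, forall x, x \in s -> ideal_gen (K D) x.
  have {sP} : forall x, x \in s -> ideal_gen (fun x => exists D, K D x) x.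
    by move=> x xs; apply/sP; apply: mem_ideal_gen.
  have K_mono D D' x : (D <= D')%N -> K D x -> K D' x.
    by move=> DD' [N [u [uN ND ->]]]; exists N, u; rewrite uN (leq_trans ND).
  elim: s => [|x s IH] h; first by exists 0%N.
  have [|D DP] := IH; first by move=> y ys; apply: h; rewrite inE ys orbT.
  have [D' D'P] : exists D, ideal_gen (K D) x.
    have [r rP ->] := h x (mem_head _ _); elim: r rP => [|ab r IHr] rP.
      by exists 0%N; rewrite big_nil; apply: (ideal0 (ideal_gen_ideal _)).
    have [|D1 D1P] := IHr; first by move=> y yr; apply: rP; rewrite inE yr orbT.
    have [D2 D2P] := rP ab (mem_head _ _); exists (maxn D1 D2).
    rewrite big_cons; apply: idealD; first exact: ideal_gen_ideal.
      apply: idealMl; first exact: ideal_gen_ideal.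
      by apply: mem_ideal_gen; apply: K_mono D2P; rewrite leq_maxr.
    by apply: ideal_gen_sub D1P => y; apply: K_mono; rewrite leq_maxl.
  exists (maxn D D') => y; rewrite inE => /orP[/eqP ->|/DP].
    by apply: ideal_gen_sub D'P => z; apply: K_mono; rewrite leq_maxr.
  by apply: ideal_gen_sub => z; apply: K_mono; rewrite leq_maxl.
exists D => k F q Fd qd h N u uN.
pose c (o : option 'I_n) := if o is Some i then F i else q.
have [psi _ psit] := injP k intr (fun i => let x := enum_val i in (c x.1)@_(x.2)).
have genE o : map_mpoly psi (gen o) = c o.
  have cd : (msize (c o) <= d.+1)%N by case: o.
  rewrite [RHS](mpolywE cd) rmorph_sum; apply: eq_bigr => m _ /=.
  by rewrite map_mpolyZ map_mpolyX psit enum_rankK.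
have substE p : map_mpoly psi (subst Fu p) = subst F (map_mpoly psi p).
  transitivity (mmap (@mpolyC n k \o psi) F p).
    apply: mmap_morph => [x|i]; first by rewrite /= map_mpolyC.
    exact: genE.
  rewrite -[in RHS](mmap_id p); symmetry.
  apply: (mmap_morph (h := subst F \o map_mpoly psi)) => [x|i] /=.
    by rewrite map_mpolyC substC.
  by rewrite map_mpolyX substX.
have iterE M : map_mpoly psi (iter M (subst Fu) qu) = iter M (subst F) q.
  by elim: M => [|M IH]; [exact: genE | rewrite !iterS substE IH].
rewrite -iterE mcoeff_map_mpoly.
have : ideal_gen (K D) (iter N (subst Fu) qu)@_u.
  have /sP : ideal_gen (fun x => exists D, K D x) (iter N (subst Fu) qu)@_u.
    by apply: mem_ideal_gen; exists N, N, u.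
  by apply: ideal_gen_min => //; apply: ideal_gen_ideal.
apply: (ideal_gen_min (kernel_ideal psi)) => _ [M [v [vM MD ->]]].
by rewrite -mcoeff_map_mpoly iterE; apply: h.
Qed.

(** * The local structure of a group at the origin *)

Lemma multinom_split (n : nat) (u : 'X_{1..n}) s : mdeg u = s.+1 ->
  exists i u', u = (u' + U_(i))%MM /\ mdeg u' = s.
Proof.
move=> us; have /forallPn[i ui] : ~~ [forall i, u i == 0%N].
  apply/negP => /forallP u0; move: us; rewrite mdegE big1 // => i _.
  exact/eqP.
have e : u = (u - U_(i) + U_(i))%MM by rewrite submK // lep1mP.
exists i, (u - U_(i))%MM; split=> //.
by move: us; rewrite {1}e mdegD mdeg1 addn1 => -[].
Qed.

(** In a monomial the factors are exchanged one at a time: v_i - w_i contributes a + 1 and every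
    other factor 1. For s = 2 agreement to order a + 1 becomes agreement to order a + 2; this is the
    contraction behind the iteration of F. *)
Lemma subst_vanish_order (R : comNzRingType) (n N a s : nat)
    (v w : 'I_n -> {mpoly R[N]}) (p : {mpoly R[n]}) :
  (forall i, (v i)@_0 = 0) -> (forall i, (w i)@_0 = 0) ->
  (forall i, vanish_order a.+1 (v i - w i)) -> vanish_order s p ->
  vanish_order (a + s) (subst v p - subst w p).
Proof.
move=> v0 w0 vw ps.
have key t (u : 'X_{1..n}) : mdeg u = t ->
    vanish_order (a + t) (subst v 'X_[u] - subst w 'X_[u]).
  elim: t u => [u /eqP|t IH u /multinom_split[i [u' [-> u't]]]].
    rewrite mdeg_eq0 => /eqP ->; rewrite mpolyX0 !rmorph1 subrr.
    exact: vanish_order0.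
  rewrite mpolyXD !rmorphM /= !substX.
  have -> (x y z t' : {mpoly R[N]}) : x * y - z * t' = (x - z) * y + z * (y - t').
    by rewrite mulrBl mulrBr addrA subrK.
  apply: vanish_orderD.
    rewrite addnS -addn1; apply: vanish_orderM; first exact: IH.
    exact/vanish_order1.
  rewrite addnS -addSn addnC; apply: vanish_orderM => //.
  apply: vanish_order_subst => //; apply: vanish_orderX.
  by rewrite u't.
rewrite [p]mpolyE !rmorph_sum -sumrB; apply: vanish_order_sum => u up _ /=.
rewrite !substZ -scalerBr -mul_mpolyC; apply: vanish_orderMl.
have su : (s <= mdeg u)%N.
  by rewrite leqNgt; apply/negP => /ps /eqP; rewrite mcoeff_eq0 up.
by apply: vanish_order_le (key _ u erefl); rewrite leq_add2l.
Qed.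

Lemma vanish_order_ideal (R : comNzRingType) (n a : nat) :
  is_ideal (@vanish_order R n a).
Proof.
split; [exact: vanish_order0|exact: vanish_orderD|exact: vanish_orderMl].
Qed.

Lemma mcoeff_mderiv0 (R : comNzRingType) (n : nat) (p : {mpoly R[n]}) i :
  (p^`M(i))@_0 = p@_U_(i).
Proof. by rewrite mcoeff_deriv mnm0E mulr1n add0m. Qed.

Lemma vanish_order_mderiv (R : comNzRingType) (n s : nat) (p : {mpoly R[n]}) i :
  vanish_order s.+1 p -> vanish_order s (p^`M(i)).
Proof.
move=> ps u us; rewrite mcoeff_deriv ps ?mul0rn // mdegD mdeg1 addn1 ltnS.
exact: us.
Qed.

Definition grad0 (R : comNzRingType) (n : nat) (f : {mpoly R[n]}) : 'rV[R]_n :=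
  \row_i (f^`M(i))@_0.

(** The [h l] are taken among the generators [P], not from the whole ideal, so that they inherit the
    degree bound. [P] may be infinite, but ranks are at most n, so some finite family has maximal
    rank; a maximal independent set of its rows has a right inverse. *)
Lemma linear_parts (k : fieldType) (n : nat) (P : {mpoly k[n]} -> Prop) :
  (forall f, P f -> f@_0 = 0) ->
  exists (c : nat) (h : 'I_c -> {mpoly k[n]}) (C : 'M[k]_(n, c)),
  [/\ forall l, P (h l), (\matrix_l grad0 (h l)) *m C = 1%:M
    & forall f, ideal_gen P f -> exists a, grad0 f = a *m \matrix_l grad0 (h l)].
Proof.
move=> P0.
pose X r := `[< exists m (h : 'I_m -> {mpoly k[n]}),
  (forall l, P (h l)) /\ \rank (\matrix_l grad0 (h l)) = r >].
have X0 : exists r, X r.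
  exists 0%N; apply/asboolP; exists 0%N, (fun=> 0); split; first by case.
  by apply/eqP; rewrite -leqn0; apply: rank_leq_row.
have Xn r : X r -> (r <= n)%N.
  by move=> /asboolP[m [h [_ <-]]]; apply: rank_leq_col.
have [r /asboolP[m [h [Ph hr]]] rmax] := ex_maxnP X0 Xn.
set M := \matrix_l grad0 (h l) in hr.
have spanM f : P f -> (grad0 f <= M)%MS.
  move=> Pf; apply: contraT => nfM.
  pose h' (l : 'I_(1 + m)) := if split l is inr j then h j else f.
  have e : \matrix_l grad0 (h' l) = col_mx (grad0 f) M.
    apply/row_matrixP => l; rewrite rowK /h'; case: (splitP l) => j lj.
      have -> : l = lshift m j by apply: val_inj.
      by rewrite rowKu; apply/rowP => i; rewrite !mxE.
    have -> : l = rshift 1 j by apply: val_inj.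
    by rewrite rowKd rowK.
  have /rmax : X (\rank (col_mx (grad0 f) M)).
    apply/asboolP; exists (1 + m)%N, h'; rewrite e; split=> // l.
    by rewrite /h'; case: split.
  rewrite -hr leqNgt => /negP; case; apply: rank_ltmx.
  by rewrite ltmxE col_mx_sub negb_and nfM andbT -addsmxE addsmxSr.
pose g := maxrankfun M.
have gE : \matrix_l grad0 (h (g l)) = rowsub g M.
  by apply/row_matrixP => l; rewrite row_rowsub !rowK.
have /row_freeP[C CP] : row_free (rowsub g M) by apply: maxrowsub_free.
exists (\rank M), (h \o g), C; split=> [l||f fP]; first exact: Ph.
  by rewrite gE.
suff [_ /submxP[a ->]] : f@_0 = 0 /\ (grad0 f <= \matrix_l grad0 (h (g l)))%MS.
  by exists a.
rewrite gE eq_maxrowsub.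
apply: (@ideal_gen_min _ _ (fun f => f@_0 = 0 /\ (grad0 f <= M)%MS)) fP.
  split.
  - rewrite mcoeff0 (_ : grad0 0 = 0) ?sub0mx //.
    by apply/rowP => i; rewrite !mxE mderiv0 mcoeff0.
  - move=> x y [x0 xM] [y0 yM]; rewrite mcoeffD x0 y0 addr0; split=> //.
    rewrite (_ : grad0 _ = grad0 x + grad0 y) ?addmx_sub //.
    by apply/rowP => i; rewrite !mxE mderivD mcoeffD.
  - move=> a x [x0 xM]; rewrite mcoeff0M x0 mulr0; split=> //.
    rewrite (_ : grad0 _ = a@_0 *: grad0 x) ?scalemx_sub //.
    by apply/rowP => i; rewrite !mxE mderivM mcoeffD !mcoeff0M x0 mulr0 add0r.
by move=> y Py; split; [apply: P0 | apply: spanM].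
Qed.

Definition square_ideal (R : comNzRingType) (I : R -> Prop) : R -> Prop :=
  ideal_gen (fun z => exists a b, [/\ I a, I b & z = a * b]).

Lemma mem_square_ideal (R : comNzRingType) (I : R -> Prop) a b :
  I a -> I b -> square_ideal I (a * b).
Proof. by move=> Ia Ib; apply: mem_ideal_gen; exists a, b. Qed.

Section LocalStructure.
Variables (k : fieldType) (n p : nat).
Hypothesis charp : p \in [pchar k].
Variable I : {mpoly k[n]} -> Prop.
Hypotheses (idI : is_ideal I) (I0 : forall f, I f -> f@_0 = 0).
(* Every tangent vector at 0 extends to a vector field preserving I. *)
Hypothesis fieldsI : forall v : 'I_n -> k,
  (forall f, I f -> \sum_i (f^`M(i))@_0 * v i = 0) ->
  exists delta : 'I_n -> {mpoly k[n]}, (forall i, (delta i)@_0 = v i) /\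
    forall f, I f -> I (\sum_i f^`M(i) * delta i).
Variables (c : nat) (h : 'I_c -> {mpoly k[n]}) (C : 'M[k]_(n, c)).
Let M := \matrix_l grad0 (h l).
Hypotheses (Ih : forall l, I (h l)) (MC : M *m C = 1%:M).
Hypothesis gradM : forall f, I f -> exists a, grad0 f = a *m M.

(** The projector onto the kernel of [M], which is the tangent space, along the image of [C]. *)
Let Pr : 'M[k]_n := 1%:M - C *m M.
Let T i : {mpoly k[n]} := \sum_j Pr i j *: 'X_j.
Let F i : {mpoly k[n]} := 'X_i - \sum_l C i l *: h l.

Let MPr : M *m Pr = 0.
Proof. by rewrite mulmxBr mulmx1 mulmxA MC mul1mx subrr. Qed.
Let PrC : Pr *m C = 0.
Proof. by rewrite mulmxBl mul1mx -mulmxA MC mulmx1 subrr. Qed.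
Let PrPr : Pr *m Pr = Pr.
Proof. by rewrite {2}/Pr mulmxBr mulmx1 mulmxA PrC mul0mx subr0. Qed.

Let T0 i : (T i)@_0 = 0.
Proof.
rewrite raddf_sum big1 // => j _.
by rewrite /= mcoeffZ mcoeffX mnm1_eq0 mulr0.
Qed.

Let h2 l := h l - \sum_i M l i *: 'X_i.

Let h2_order l : vanish_order 2 (h2 l).
Proof.
move=> u; rewrite ltnS leq_eqVlt ltnS leqn0 => /orP[/mdeg1P[i /eqP ->]|].
  rewrite mcoeffB raddf_sum (bigD1 i) //= big1 => [|j ji].
    by rewrite addr0 mcoeffZ mcoeffXU eqxx mulr1 !mxE mcoeff_mderiv0 subrr.
  by rewrite mcoeffZ mcoeffXU (negPf ji) mulr0.
rewrite mdeg_eq0 => /eqP ->; rewrite mcoeffB I0 // sub0r raddf_sum big1 ?oppr0 //.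
by move=> j _; rewrite /= mcoeffZ mcoeffX mnm1_eq0 mulr0.
Qed.

Let sum_Pr (x : 'I_n -> {mpoly k[n]}) i :
  \sum_j Pr i j *: x j = x i - \sum_l C i l *: \sum_j M l j *: x j.
Proof.
under eq_bigr do rewrite !mxE scalerBl.
rewrite sumrB (bigD1 i) //= eqxx scale1r big1 ?addr0; last first.
  by move=> j /negPf ji; rewrite eq_sym ji scale0r.
congr (_ - _); under [RHS]eq_bigr do rewrite scaler_sumr.
rewrite [RHS]exchange_big /=; apply: eq_bigr => j _; rewrite scaler_suml.
by apply: eq_bigr => l _; rewrite scalerA.
Qed.

Let F_eq i : F i = T i - \sum_l C i l *: h2 l.
Proof.
rewrite /F /T (sum_Pr (fun j => 'X_j)) /h2.
under [X in _ = _ - X]eq_bigr do rewrite scalerBr.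
by rewrite sumrB opprB addrA subrK.
Qed.

Let F0 i : (F i)@_0 = 0.
Proof.
rewrite mcoeffB mcoeffX mnm1_eq0 sub0r raddf_sum big1 ?oppr0 // => l _.
by rewrite /= mcoeffZ I0 ?mulr0.
Qed.

Let phiN N q := iter N (subst F) q.
Let phiNE N q : phiN N q = subst (fun i => phiN N 'X_i) q.
Proof.
elim: N => [|N IH]; first by rewrite /phiN /= subst_id.
by rewrite /phiN /= -/(phiN _ _) IH subst_comp.
Qed.
Let phiN0 N i : (phiN N 'X_i)@_0 = 0.
Proof.
elim: N => [|N IH]; first by rewrite mcoeffX mnm1_eq0.
by rewrite /phiN /= subst_coeff0.
Qed.

(** F moves x only along the image of C, which the projector kills. *)
Let phiN_T N i : phiN N (T i) = T i.
Proof.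
elim: N => // N IH; rewrite /phiN /= -/(phiN _ _) IH /T rmorph_sum.
under eq_bigr do rewrite /= substZ substX /F scalerBr scaler_sumr.
rewrite sumrB exchange_big /= [X in _ - X]big1 ?subr0 // => l _.
under eq_bigr do rewrite scalerA.
rewrite -scaler_suml; have /matrixP/(_ i l) := PrC; rewrite !mxE => ->.
by rewrite scale0r.
Qed.

(** The iterates satisfy phi^(N+1) x = T - C h2(phi^N x), because phi fixes T. As h2 has order 2,
    being a function of T modulo m^(N+1) improves to modulo m^(N+2). *)
Let subst_T N q : vanish_order N.+1 (subst T (phiN N q) - phiN N q).
Proof.
suff key i : vanish_order N.+1 (subst T (phiN N 'X_i) - phiN N 'X_i).
  rewrite (phiNE N q) subst_comp.
  exact: (subst_congr _ (vanish_order_ideal _ _ _)).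
elim: N i => [|N IH] i.
  by rewrite /= substX; apply/vanish_order1; rewrite mcoeffB T0 mcoeffX mnm1_eq0 subr0.
have -> : phiN N.+1 'X_i = T i - \sum_l C i l *: phiN N (h2 l).
  rewrite /phiN iterSr substX F_eq -/(phiN _ _) phiNE rmorphB /=; congr (_ - _).
    by rewrite -(phiNE N (T i)) phiN_T.
  rewrite rmorph_sum; apply: eq_bigr => l _ /=.
  by rewrite substZ -(phiNE N (h2 l)).
have TT : subst T (T i) = T i.
  rewrite {2}/T rmorph_sum.
  under eq_bigr do rewrite /= substZ substX /T scaler_sumr.
  rewrite exchange_big /=; apply: eq_bigr => j _.
  under eq_bigr do rewrite scalerA.
  by rewrite -scaler_suml -[in RHS]PrPr mxE.
rewrite rmorphB /= TT rmorph_sum opprB addrC addrA subrK -sumrB.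
apply: vanish_order_sum => l _ _ /=.
rewrite substZ -scalerBr -mul_mpolyC; apply: vanish_orderMl.
rewrite -opprB; apply: vanish_orderN.
rewrite (phiNE N (h2 l)) subst_comp -[N.+2]addn2.
apply: subst_vanish_order => // j.
by rewrite subst_coeff0.
Qed.

(** Let delta be a field that preserves I and extends the j-th column of Pr. Then delta f lies in I
    and has order at least s - 1, so by induction its restriction to the tangent space has order at
    least s. By the chain rule the derivative of f o T in x_j differs from this restriction by
    products of a factor of order s - 1 and one of order 1. Hence all derivatives of f o T have
    order at least s. *)
Let initial_form s f : (s < p)%N -> I f -> vanish_order s f ->
  vanish_order s.+1 (subst T f).
Proof.
elim: s f => [|s IH] f sp If fs.
  by apply/vanish_order1; rewrite subst_coeff0 // I0.
move=> u; rewrite ltnS leq_eqVlt => /orP[/eqP us|us]; last first.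
  exact: vanish_order_subst fs _ us.
have [j [u' [-> u's]]] := multinom_split us.
(* The derivative multiplies the coefficient in question by the exponent of x_j, a number between 1
   and s + 1 < p, which is invertible in k. *)
suff : vanish_order s.+1 (subst T f)^`M(j).
  move=> /(_ u'); rewrite u's leqnn mcoeff_deriv => /(_ isT) /eqP.
  rewrite -mulr_natr mulf_eq0 -(dvdn_pcharf charp) => /orP[/eqP //|].
  move=> /(dvdn_leq (ltn0Sn _)); rewrite leqNgt => /negP; case.
  apply: leq_ltn_trans sp; rewrite ltnS -u's mdegE (bigD1 j) //=.
  exact: leq_addr.
have [|delta [delta0 deltaI]] := @fieldsI (fun i => Pr i j).
  move=> g /gradM[a ga]; have : grad0 g *m Pr = 0 by rewrite ga -mulmxA MPr mulmx0.
  move=> /matrixP/(_ 0 j); rewrite [LHS]mxE [RHS]mxE => e; rewrite -[RHS]e.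
  by apply: eq_bigr => i _; rewrite [grad0 g 0 i]mxE.
have := IH _ (ltnW sp) (deltaI _ If); rewrite mderiv_subst => IHf.
set g := (X in vanish_order _ X); rewrite -(subrK (subst T (\sum_i f^`M(i) * delta i)) g).
apply: vanish_orderD; last first.
  apply: IHf; apply: vanish_order_sum => i _ _; apply: vanish_orderMr.
  exact: vanish_order_mderiv.
rewrite /g rmorph_sum -sumrB; apply: vanish_order_sum => i _ _ /=.
rewrite rmorphM -mulrBr -addn1; apply: vanish_orderM.
  by apply: vanish_order_subst => //; apply: vanish_order_mderiv.
apply/vanish_order1; rewrite mcoeffB subst_coeff0 // delta0 mcoeff_mderiv0.
rewrite raddf_sum (bigD1 j) //= big1 => [|l lj].
  by rewrite addr0 mcoeffZ mcoeffXU eqxx mulr1 subrr.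
by rewrite mcoeffZ mcoeffXU (negPf lj) mulr0.
Qed.

Let phi_I q : I q -> I (subst F q).
Proof.
move=> Iq; rewrite -(subrK q (subst F q)); apply: idealD => //.
rewrite -{2}(subst_id q); apply: subst_congr => // i.
rewrite /F addrAC subrr sub0r; apply: idealN => //; apply: ideal_sum => // l _ _.
by rewrite -mul_mpolyC; apply: idealMl.
Qed.

(** The order rises one step at a time: [initial_form] raises it on the tangent space, and up to
    order N + 1 the iterate agrees with its restriction there. *)
Let phiN_order N q : (N < p)%N -> I q -> vanish_order N.+1 (phiN N q).
Proof.
move=> Np Iq; have Iphi : I (phiN N q).
  by elim: (N) => // m; apply: phi_I.
suff key s : (s <= N)%N -> vanish_order s.+1 (phiN N q) by apply: key.
elim: s => [|s IH] sN.
  by apply/vanish_order1; apply: I0.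
rewrite -(subrK (subst T (phiN N q)) (phiN N q)); apply: vanish_orderD; last first.
  by apply: initial_form => //; [apply: leq_ltn_trans Np | apply/IH/ltnW].
rewrite -opprB; apply: vanish_orderN.
by apply: vanish_order_le (@subst_T N q).
Qed.

Variables (d D : nat) (P : {mpoly k[n]} -> Prop).
Hypotheses (d0 : (0 < d)%N) (Pd : forall f, P f -> tdeg_le d f).
Hypotheses (IP : forall f, I f <-> ideal_gen P f) (Ph : forall l, P (h l)).
Hypothesis uniformD : forall (F : 'I_n -> {mpoly k[n]}) (q : {mpoly k[n]}),
  (forall i, (msize (F i) <= d.+1)%N) -> (msize q <= d.+1)%N ->
  (forall N, (N <= D)%N -> vanish_order N.+1 (iter N (subst F) q)) ->
  forall N, vanish_order N.+1 (iter N (subst F) q).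
Hypothesis Dp : (D < p)%N.

Let J := ideal_gen (fun y => exists l, y = h l).

(** F is the identity modulo (h), so q - q o F^N lies in (h), and q lies in (h) + m^N for every N.
    The uniform bound concerns degree at most d, so Krull's theorem is applied to the generators
    [P]; products of the factors u obtained there serve the rest of I. *)
Lemma local_equations f : I f -> exists2 u, u@_0 = 1 & J (u * f).
Proof.
have idJ : is_ideal J by apply: ideal_gen_ideal.
have PI q : P q -> I q by move=> Pq; apply/IP/mem_ideal_gen.
move=> /IP; apply: (@ideal_gen_min _ _ (fun f => exists2 u, u@_0 = 1 & J (u * f))).
  split.
  - by exists 1; rewrite ?mcoeff1 ?eqxx // mulr0; apply: ideal0.
  - move=> x y [u u0 ux] [v v0 vy]; exists (u * v); rewrite ?mcoeff0M ?u0 ?v0 ?mulr1 //.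
    rewrite mulrDr; apply: idealD => //; last by rewrite -mulrA; apply: idealMl.
    by rewrite mulrAC; apply: idealMr.
  - by move=> a x [u u0 ux]; exists u => //; rewrite mulrCA; apply: idealMl.
move=> q Pq; apply: krull_intersection => // N.
have Fd i : (msize (F i) <= d.+1)%N.
  apply: leq_trans (msizeD_le _ _) _; rewrite geq_max msizeX mdeg1 ltnS d0 /=.
  rewrite msizeN; apply: leq_trans (msize_sum _ _ _) _; apply/bigmax_leqP => l _.
  by apply: leq_trans (msizeZ_le _ _) _; apply: Pd.
have := uniformD Fd (Pd Pq) (fun N ND => phiN_order (leq_ltn_trans ND Dp) (PI q Pq)).
move=> /(_ N) qN; exists (q - phiN N q); last first.
  by rewrite opprB addrC subrK; apply: vanish_order_le qN.
elim: (N) => [|m IH]; first by rewrite subrr; apply: ideal0.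
have -> : q - phiN m.+1 q = q - phiN m q + (phiN m q - phiN m.+1 q).
  by rewrite addrA subrK.
apply: idealD => //; rewrite -opprB; apply: idealN => //.
rewrite {1}/phiN /= -/(phiN m q).
rewrite -{2}(subst_id (phiN m q)); apply: subst_congr => // i.
rewrite /F addrAC subrr sub0r; apply: idealN => //; apply: ideal_sum => // l _ _.
by rewrite -mul_mpolyC; apply: idealMl => //; apply: mem_ideal_gen; exists l.
Qed.

(** Differentiating u f = \sum_l a_l h_l puts \sum_l a_l (d h_l / d x_i) into I for each i. Combined
    with the columns of C, this is a linear system in the a_l whose matrix G satisfies G(0) = M C =
    1. By Cramer's rule each a_l det G lies in I, so det G u f lies in I^2. *)
Lemma local_conormal f : I f -> (forall i, I f^`M(i)) ->
  exists2 u, u@_0 = 1 & square_ideal I (u * f).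
Proof.
move=> If dIf; have [u u0 uf] := local_equations If.
have [a ea] : exists a : 'I_c -> {mpoly k[n]}, u * f = \sum_l a l * h l.
  apply: (@ideal_gen_min _ _ (fun x => exists a : 'I_c -> {mpoly k[n]},
    x = \sum_l a l * h l)) uf.
    split.
    - by exists (fun=> 0); rewrite big1 // => l _; rewrite mul0r.
    - move=> _ _ [a ->] [b ->]; exists (fun l => a l + b l).
      by rewrite -big_split; apply: eq_bigr => l _ /=; rewrite mulrDl.
    - move=> b _ [a ->]; exists (fun l => b * a l).
      by rewrite mulr_sumr; apply: eq_bigr => l _; rewrite mulrA.
  move=> _ [l ->]; exists (fun i => (i == l)%:R).
  by rewrite (bigD1 l) //= eqxx mul1r big1 ?addr0 // => i /negPf ->; rewrite mul0r.
have aI i : I (\sum_l a l * (h l)^`M(i)).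
  have e : (u * f)^`M(i) = \sum_l (a l)^`M(i) * h l + \sum_l a l * (h l)^`M(i).
    rewrite ea raddf_sum -big_split; apply: eq_bigr => l _ /=.
    by rewrite mderivM.
  rewrite -[X in I X](addKr (\sum_l (a l)^`M(i) * h l)) -e addrC.
  apply: idealB => //.
    by rewrite mderivM; apply: idealD => //; apply: idealMl.
  by apply: ideal_sum => // l _ _; apply: idealMl.
pose G : 'M[{mpoly k[n]}]_c :=
  \matrix_(l, l') \sum_i (h l)^`M(i) * (C i l')%:MP.
pose av : 'rV[{mpoly k[n]}]_c := \row_l a l.
have G0 : (\det G)@_0 = 1.
  rewrite -det_map_mx (_ : map_mx _ _ = 1%:M) ?det1 // -MC.
  apply/matrixP => l l'; rewrite [LHS]mxE [G l l']mxE raddf_sum [RHS]mxE.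
  apply: eq_bigr => i _ /=.
  by rewrite mcoeff0M mcoeffC eqxx mulr1 !mxE.
have detI l : I (a l * \det G).
  have -> : a l * \det G = (av *m G *m \adj G) 0 l.
    by rewrite -mulmxA mul_mx_adj mul_mx_scalar !mxE mulrC.
  rewrite mxE; apply: ideal_sum => // l' _ _; apply: idealMr => //.
  rewrite mxE; under eq_bigr do rewrite !mxE mulr_sumr.
  rewrite exchange_big /=; apply: ideal_sum => // i _ _.
  under eq_bigr do rewrite mulrA.
  by rewrite -mulr_suml; apply: idealMr.
exists (\det G * u); first by rewrite mcoeff0M G0 u0 mulr1.
rewrite -mulrA ea mulr_sumr; apply: ideal_sum; first exact: ideal_gen_ideal.
by move=> l _ _; rewrite mulrA [\det G * _]mulrC; apply: mem_square_ideal.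
Qed.
End LocalStructure.

(** * Polynomials in two sets of variables *)

Section PairSubstitution.
Variables (k : fieldType) (n m N : nat).

Definition pair_subst (u : 'I_n -> {mpoly k[N]}) (v : 'I_m -> {mpoly k[N]})
  (i : 'I_(n + m)) : {mpoly k[N]} :=
  match split i with inl i1 => u i1 | inr i2 => v i2 end.

Lemma pair_substl u v i : pair_subst u v (lshift m i) = u i.
Proof. by rewrite /pair_subst (unsplitK (inl i)). Qed.
Lemma pair_substr u v i : pair_subst u v (rshift n i) = v i.
Proof. by rewrite /pair_subst (unsplitK (inr i)). Qed.

Lemma subst_inx u v a : subst (pair_subst u v) (inx m a) = subst u a.
Proof.
rewrite /inx -/(subst _ _) subst_comp; apply: eq_subst => i.
by rewrite substX pair_substl.
Qed.
Lemma subst_iny u v b : subst (pair_subst u v) (iny n b) = subst v b.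
Proof.
rewrite /iny -/(subst _ _) subst_comp; apply: eq_subst => i.
by rewrite substX pair_substr.
Qed.

End PairSubstitution.

Lemma subst_pair (k : fieldType) (n m N N' : nat) (w : 'I_N -> {mpoly k[N']})
    (u : 'I_n -> {mpoly k[N]}) (v : 'I_m -> {mpoly k[N]}) p :
  subst w (subst (pair_subst u v) p) =
  subst (pair_subst (fun i => subst w (u i)) (fun i => subst w (v i))) p.
Proof.
rewrite subst_comp; apply: eq_subst => i.
by rewrite /pair_subst; case: split.
Qed.

Section TensorCalculus.
Variables (k : fieldType) (n m : nat).

Lemma inx_mderiv (a : {mpoly k[n]}) j :
  (inx m a)^`M(lshift m j) = inx m (a^`M(j)).
Proof.
rewrite /inx -!/(subst _ _) mderiv_subst (bigD1 j) //= mderivXU eqxx mulr1.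
rewrite big1 ?addr0 // => i ij.
by rewrite mderivXU (inj_eq (@lshift_inj _ _)) (negPf ij) mulr0.
Qed.

Lemma iny_mderiv (b : {mpoly k[m]}) j : (iny n b)^`M(lshift m j) = 0.
Proof.
rewrite /iny -!/(subst _ _) mderiv_subst big1 // => i _.
by rewrite mderivXU eq_rlshift mulr0.
Qed.

Lemma tens_mderiv (a : {mpoly k[n]}) (b : {mpoly k[m]}) j :
  (tens a b)^`M(lshift m j) = tens (a^`M(j)) b.
Proof. by rewrite /tens mderivM inx_mderiv iny_mderiv mulr0 addr0. Qed.

Lemma mderiv_pair_subst N (u : 'I_n -> {mpoly k[N]}) (v : 'I_m -> {mpoly k[N]}) p j :
  (forall i, (v i)^`M(j) = 0) ->
  (subst (pair_subst u v) p)^`M(j) =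
  \sum_i subst (pair_subst u v) (p^`M(lshift m i)) * (u i)^`M(j).
Proof.
move=> vj; rewrite mderiv_subst big_split_ord /= addrC big1 ?add0r => [|i _].
  by apply: eq_bigr => i _; rewrite pair_substl.
by rewrite pair_substr vj mulr0.
Qed.
End TensorCalculus.

Lemma taylor_square (k : fieldType) (n N : nat) (K : {mpoly k[N]} -> Prop)
    (a b : 'I_n -> {mpoly k[N]}) p : is_ideal K -> (forall i, K (a i - b i)) ->
  square_ideal K
    (subst a p - subst b p - \sum_i subst b (p^`M(i)) * (a i - b i)).
Proof.
move=> idK Kab; have idK2 : is_ideal (square_ideal K) by apply: ideal_gen_ideal.
elim/mpoly_ring_ind: p => [c|i|p q IHp IHq|p q IHp IHq].
- rewrite !substC subrr sub0r big1 ?oppr0 => [|i _]; first exact: ideal0.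
  by rewrite mderivC rmorph0 mul0r.
- rewrite !substX (bigD1 i) //= mderivXU eqxx rmorph1 mul1r big1 => [|j ji].
    by rewrite addr0 subrr; apply: ideal0.
  by rewrite mderivXU eq_sym (negPf ji) rmorph0 mul0r.
- rewrite !rmorphD /=.
  have -> : \sum_i subst b (p + q)^`M(i) * (a i - b i) =
      \sum_i subst b p^`M(i) * (a i - b i) + \sum_i subst b q^`M(i) * (a i - b i).
    by rewrite -big_split; apply: eq_bigr => i _; rewrite mderivD rmorphD mulrDl.
  have -> (x y z t u v : {mpoly k[N]}) :
      x + y - (z + t) - (u + v) = (x - z - u) + (y - t - v).
    by ring.
  exact: (idealD idK2 IHp IHq).
- rewrite !rmorphM /=.
  have -> : \sum_i subst b (p * q)^`M(i) * (a i - b i) =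
      subst b q * \sum_i subst b p^`M(i) * (a i - b i) +
      subst b p * \sum_i subst b q^`M(i) * (a i - b i).
    rewrite !mulr_sumr -big_split; apply: eq_bigr => i _ /=.
    rewrite mderivM rmorphD !rmorphM /=.
    by ring.
  have -> (x y z t u v : {mpoly k[N]}) :
      x * y - z * t - (t * u + z * v) =
      (x - z) * (y - t) + (z * (y - t - v) + t * (x - z - u)).
    by ring.
  have abp r : K (subst a r - subst b r) by apply: (subst_congr _ idK).
  apply: (idealD idK2 (mem_square_ideal (abp p) (abp q))).
  exact: (idealD idK2 (idealMl _ idK2 IHq) (idealMl _ idK2 IHp)).
Qed.

(** * Group laws on tuples of polynomials *)

HB.instance Definition _ (k : fieldType) (n : nat) (A : comAlgType k)
  (v : {ffun 'I_n -> A}) := GRing.RMorphism.copy (peval v) (mmap (in_alg A) v).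

Lemma pevalX (k : fieldType) (n : nat) (A : comAlgType k) (v : {ffun 'I_n -> A}) i :
  peval v 'X_i = v i.
Proof. by rewrite /peval mmapX mmap1U. Qed.

Lemma pevalC (k : fieldType) (n : nat) (A : comAlgType k) (v : {ffun 'I_n -> A}) c :
  peval v c%:MP = c%:A.
Proof. by rewrite /peval mmapC. Qed.

Lemma peval0 (k : fieldType) (n : nat) (A : comAlgType k) (q : {mpoly k[n]}) :
  peval [ffun=> 0 : A] q = (q@_0)%:A.
Proof.
elim/mpoly_ring_ind: q => [c|i|p q IHp IHq|p q IHp IHq].
- by rewrite pevalC mcoeffC eqxx mulr1.
- by rewrite pevalX ffunE mcoeffX mnm1_eq0 scale0r.
- by rewrite rmorphD /= IHp IHq mcoeffD scalerDl.
- by rewrite rmorphM /= IHp IHq mcoeff0M -scalerAl mul1r scalerA.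
Qed.

Lemma peval_subst (k : fieldType) (n N : nat) (A : comAlgType k)
    (a : {ffun 'I_N -> A}) (u : 'I_n -> {mpoly k[N]}) p :
  peval a (subst u p) = peval [ffun i => peval a (u i)] p.
Proof.
rewrite /peval mmap_subst; congr (mmap _ _ p).
by apply/funext => i; rewrite ffunE.
Qed.

Lemma peval_pair_subst (k : fieldType) (n m N : nat) (A : comAlgType k)
    (a : {ffun 'I_N -> A}) (u : 'I_n -> {mpoly k[N]}) (v : 'I_m -> {mpoly k[N]}) p :
  peval a (subst (pair_subst u v) p) =
  peval (pair_pt [ffun i => peval a (u i)] [ffun i => peval a (v i)]) p.
Proof.
rewrite peval_subst; congr (peval _ p); apply/ffunP => i; rewrite !ffunE.
by rewrite /pair_subst; case: split => j; rewrite ffunE.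
Qed.

Section GroupTuples.
Variables (k : fieldType) (n : nat) (G : kgroup k) (E : closed_embedding n G).
Variables (Delta : 'I_n -> {mpoly k[n + n]}) (sigma : 'I_n -> {mpoly k[n]}).
Hypothesis mulE : forall (A : comAlgType k) (g h : G A) i,
  coord E A (gmul g h) i = peval (pair_pt (coord E A g) (coord E A h)) (Delta i).
Hypothesis invE : forall (A : comAlgType k) (g : G A) i,
  coord E A (ginv g) i = peval (coord E A g) (sigma i).
Hypothesis oneE : forall (A : comAlgType k) i, coord E A (gone G A) i = 0.

Local Notation I := (eqs E).

(* A tuple u with [in_group K u] is a point of G over k[x_1, .., x_N] / K. *)
Definition in_group N (K : {mpoly k[N]} -> Prop) (u : 'I_n -> {mpoly k[N]}) :=
  forall q, I q -> K (subst u q).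

Definition mul_tuple N (u v : 'I_n -> {mpoly k[N]}) i :=
  subst (pair_subst u v) (Delta i).
Definition inv_tuple N (u : 'I_n -> {mpoly k[N]}) i := subst u (sigma i).

Section Laws.
Variables (N : nat) (K : {mpoly k[N]} -> Prop).
Hypothesis idK : is_ideal K.
Implicit Types u v w : 'I_n -> {mpoly k[N]}.

Lemma in_group_point u (A : comAlgType k) (a : {ffun 'I_N -> A}) :
  in_group K u -> (forall q, K q -> peval a q = 0) ->
  exists g, coord E A g = [ffun i => peval a (u i)].
Proof.
move=> Ku aK; apply/(coord_image E) => q Iq.
by rewrite -peval_subst; apply/aK/Ku.
Qed.

Lemma point_in_group u :
  (forall (A : comAlgType k) (a : {ffun 'I_N -> A}),
    (forall q, K q -> peval a q = 0) ->
    exists g, coord E A g = [ffun i => peval a (u i)]) -> in_group K u.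
Proof.
move=> h q Iq; apply: ideal_points => // A a /h[g e].
rewrite peval_subst -e.
by apply: (proj1 (coord_image E _)) Iq; exists g.
Qed.

Lemma mul_tupleE u v (A : comAlgType k) (a : {ffun 'I_N -> A}) g h :
  coord E A g = [ffun i => peval a (u i)] ->
  coord E A h = [ffun i => peval a (v i)] ->
  coord E A (gmul g h) = [ffun i => peval a (mul_tuple u v i)].
Proof.
move=> eg eh; apply/ffunP => i.
by rewrite mulE eg eh -peval_pair_subst ffunE.
Qed.

Lemma inv_tupleE u (A : comAlgType k) (a : {ffun 'I_N -> A}) g :
  coord E A g = [ffun i => peval a (u i)] ->
  coord E A (ginv g) = [ffun i => peval a (inv_tuple u i)].
Proof.
by move=> eg; apply/ffunP => i; rewrite invE eg -peval_subst ffunE.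
Qed.

Lemma one_tupleE (A : comAlgType k) (a : {ffun 'I_N -> A}) :
  coord E A (gone G A) = [ffun i => peval a 0].
Proof. by apply/ffunP => i; rewrite oneE ffunE rmorph0. Qed.

Lemma in_group_mul u v : in_group K u -> in_group K v ->
  in_group K (mul_tuple u v).
Proof.
move=> Ku Kv; apply: point_in_group => A a aK.
have [g eg] := in_group_point Ku aK; have [h eh] := in_group_point Kv aK.
by exists (gmul g h); apply: mul_tupleE.
Qed.

Lemma in_group_inv u : in_group K u -> in_group K (inv_tuple u).
Proof.
move=> Ku; apply: point_in_group => A a aK.
have [g eg] := in_group_point Ku aK.
by exists (ginv g); apply: inv_tupleE.
Qed.

(** Identities modulo K are tested on the points of all algebras, where they become the group
    axioms. *)
Let congr_points u v :
  (forall (A : comAlgType k) (a : {ffun 'I_N -> A}),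
    (forall q, K q -> peval a q = 0) ->
    [ffun i => peval a (u i)] = [ffun i => peval a (v i)]) ->
  forall i, K (u i - v i).
Proof.
move=> h i; apply: ideal_points => // A a /h/ffunP/(_ i).
by rewrite !ffunE rmorphB => /= ->; rewrite subrr.
Qed.

Lemma mul_tuple1 u i : in_group K u -> K (mul_tuple u (fun=> 0) i - u i).
Proof.
move=> Ku; move: i; apply: congr_points => A a aK.
have [g eg] := in_group_point Ku aK.
by rewrite -(mul_tupleE eg (one_tupleE a)) gmulg1 eg.
Qed.

Lemma mul_1tuple u i : in_group K u -> K (mul_tuple (fun=> 0) u i - u i).
Proof.
move=> Ku; move: i; apply: congr_points => A a aK.
have [g eg] := in_group_point Ku aK.
by rewrite -(mul_tupleE (one_tupleE a) eg) gmul1g eg.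
Qed.

Lemma mul_tupleV u i : in_group K u -> K (mul_tuple u (inv_tuple u) i).
Proof.
move=> Ku; rewrite -[mul_tuple _ _ _]subr0.
move: i; apply: (@congr_points _ (fun=> 0)) => A a aK.
have [g eg] := in_group_point Ku aK.
by rewrite -(mul_tupleE eg (inv_tupleE eg)) gmulgV -(one_tupleE a).
Qed.

Lemma mul_tupleVK u v i : in_group K u -> in_group K v ->
  K (mul_tuple (mul_tuple u (inv_tuple v)) v i - u i).
Proof.
move=> Ku Kv; move: i; apply: congr_points => A a aK.
have [g eg] := in_group_point Ku aK; have [h eh] := in_group_point Kv aK.
by rewrite -(mul_tupleE (mul_tupleE eg (inv_tupleE eh)) eh) -gmulA gmulVg gmulg1 eg.
Qed.
End Laws.

Lemma eqs_coeff0 q : I q -> q@_0 = 0.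
Proof.
(* Polynomials in no variables play the role of k as an algebra over itself. *)
move=> Iq; pose A : comAlgType k := {mpoly k[0]}.
have : peval (coord E A (gone G A)) q = 0.
  by apply: (proj1 (coord_image E _)) Iq; eexists.
have -> : coord E A (gone G A) = [ffun=> 0] by apply/ffunP => i; rewrite oneE ffunE.
by rewrite peval0 => /eqP; rewrite scaler_eq0 oner_eq0 orbF => /eqP.
Qed.
End GroupTuples.

(** * The conormal sequence of a group *)

Lemma subst0 (k : fieldType) (n N : nat) (p : {mpoly k[n]}) :
  subst (fun=> 0) p = (p@_0)%:MP :> {mpoly k[N]}.
Proof.
elim/mpoly_ring_ind: p => [c|i|p q IHp IHq|p q IHp IHq].
- by rewrite substC mcoeffC eqxx mulr1.
- by rewrite substX mcoeffX mnm1_eq0.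
- by rewrite rmorphD /= mcoeffD mpolyCD IHp IHq.
- by rewrite rmorphM /= mcoeff0M mpolyCM IHp IHq.
Qed.

Lemma subst_diag (k : fieldType) (n : nat) (a b : {mpoly k[n]}) :
  subst (pair_subst (fun i => 'X_i) (fun i => 'X_i)) (tens a b) = a * b.
Proof. by rewrite rmorphM /= subst_inx subst_iny !subst_id. Qed.

Section SumIdeal.
Variables (k : fieldType) (n m : nat).
Variables (I : {mpoly k[n]} -> Prop) (J : {mpoly k[m]} -> Prop).

Lemma sum_ideal_ideal : is_ideal (sum_ideal I J).
Proof. exact: ideal_gen_ideal. Qed.

Lemma sum_ideal_inx a : I a -> sum_ideal I J (inx m a).
Proof. by move=> Ia; apply: mem_ideal_gen; left; exists a. Qed.

Lemma sum_ideal_iny b : J b -> sum_ideal I J (iny n b).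
Proof. by move=> Jb; apply: mem_ideal_gen; right; exists b. Qed.

Lemma sum_ideal_square x : is_ideal I -> is_ideal J ->
  square_ideal (sum_ideal I J) x -> sum_ideal (square_ideal I) J x.
Proof.
move=> idI idJ; apply: ideal_gen_min; first exact: ideal_gen_ideal.
have idS : is_ideal (sum_ideal (square_ideal I) J) by apply: ideal_gen_ideal.
move=> _ [a [b [Sa Sb ->]]].
move: Sa; apply: (@ideal_gen_min _ _ (fun a => sum_ideal (square_ideal I) J (a * b))).
  split; first by rewrite mul0r; apply: ideal0.
    by move=> x' y hx hy; rewrite mulrDl; apply: idealD.
  by move=> c x' hx; rewrite -mulrA; apply: idealMl.
move=> _ [[i Ii ->]|[j Jj ->]]; last first.
  by apply: idealMr => //; apply: mem_ideal_gen; right; exists j.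
move: Sb; apply: (@ideal_gen_min _ _
    (fun b => sum_ideal (square_ideal I) J (inx m i * b))).
  split; first by rewrite mulr0; apply: ideal0.
    by move=> x' y hx hy; rewrite mulrDr; apply: idealD.
  by move=> c x' hx; rewrite mulrCA; apply: idealMl.
move=> _ [[i' Ii' ->]|[j Jj ->]]; last first.
  by apply: idealMl => //; apply: mem_ideal_gen; right; exists j.
apply: mem_ideal_gen; left; exists (i * i'); last by rewrite rmorphM.
exact: mem_square_ideal.
Qed.
End SumIdeal.

(* The kernel of multiplication by f on (k[x] / I^2) (x) (k[x] / I) comes from
   the annihilator of f, so one may restrict to the diagonal. *)
Lemma diagonal_square (k : fieldType) (n : nat) (I : {mpoly k[n]} -> Prop) f w :
  is_ideal I -> I f -> sum_ideal (square_ideal I) I (inx n f * w) ->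
  square_ideal I (f * subst (pair_subst (fun i => 'X_i) (fun i => 'X_i)) w).
Proof.
move=> idI If.
have idI2 : is_ideal (square_ideal I) by apply: ideal_gen_ideal.
have [r [a [c [s [cf sI ->]]]]] := tens_decomp_free w idI.
rewrite mulrDr => Sfw.
have af l : square_ideal I (f * a l).
  move: l; apply: (free_mod_sum_ideal (I := square_ideal I) idI2 idI cf).
  have -> : \sum_l tens (f * a l) (c l) = inx n f * \sum_l tens (a l) (c l).
    by rewrite mulr_sumr; apply: eq_bigr => l _; rewrite /tens rmorphM mulrA.
  rewrite -[X in sum_ideal _ _ X](addrK (inx n f * \sum_(x <- s) tens x.1 x.2)).
  apply: idealB => //; first exact: ideal_gen_ideal.
  apply: idealMl; first exact: ideal_gen_ideal.
  apply: ideal_sum; first exact: ideal_gen_ideal.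
  move=> x xs _; apply: idealMl; first exact: ideal_gen_ideal.
  by apply: sum_ideal_iny; apply: sI.
rewrite rmorphD !rmorph_sum mulrDr; apply: idealD => //.
  rewrite mulr_sumr; apply: ideal_sum => // l _ _ /=.
  by rewrite subst_diag mulrA; apply: idealMr.
rewrite mulr_sumr; apply: ideal_sum => // x xs _ /=.
rewrite subst_diag mulrCA; apply: idealMl => //.
by apply: mem_square_ideal => //; apply: sI.
Qed.

Section Conormal.
Variables (k : fieldType) (n : nat) (G : kgroup k) (E : closed_embedding n G).
Variables (Delta : 'I_n -> {mpoly k[n + n]}) (sigma : 'I_n -> {mpoly k[n]}).
Hypothesis mulE : forall (A : comAlgType k) (g h : G A) i,
  coord E A (gmul g h) i = peval (pair_pt (coord E A g) (coord E A h)) (Delta i).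
Hypothesis invE : forall (A : comAlgType k) (g : G A) i,
  coord E A (ginv g) i = peval (coord E A g) (sigma i).
Hypothesis oneE : forall (A : comAlgType k) i, coord E A (gone G A) i = 0.

Local Notation I := (eqs E).
Let idI : is_ideal I := eqs_ideal E.
Let S : {mpoly k[n + n]} -> Prop := sum_ideal I I.
Let idS : is_ideal S := sum_ideal_ideal I I.
Let idI2 : is_ideal (square_ideal I).
Proof. exact: ideal_gen_ideal. Qed.
Let X (i : 'I_n) : {mpoly k[n]} := 'X_i.
Let Z (i : 'I_n) : {mpoly k[n + n]} := 'X_(lshift n i).
Let Y (i : 'I_n) : {mpoly k[n + n]} := 'X_(rshift n i).
Local Notation mul := (mul_tuple Delta).
Local Notation inv := (inv_tuple sigma).
Local Notation diag := (subst (pair_subst X X)).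

Let XI : in_group E I X.
Proof. by move=> q; rewrite /X subst_id. Qed.
Let ZS : in_group E S Z.
Proof. by move=> q Iq; apply: sum_ideal_inx. Qed.
Let YS : in_group E S Y.
Proof. by move=> q Iq; apply: sum_ideal_iny. Qed.

(** Translation without points. Write f(z y) = \sum_l w_l(z) c_l(y) modulo I in y, with the c_l free
    modulo I. Then the w_l and their derivatives lie in I, and u w_l lies in I^2 for a common u with
    u(1) = 1. So u(z) f(z y) vanishes in k[z] / I^2 (x) k[y] / I. Replacing z by z y^-1 shows that
    u(z y^-1) f(z) vanishes there too, and on the diagonal u(z z^-1) is 1 modulo I. *)
Lemma conormal_injective :
  (forall f, I f -> (forall i, I f^`M(i)) ->
    exists2 u, u@_0 = 1 & square_ideal I (u * f)) ->
  forall f, I f -> (forall i, I f^`M(i)) -> square_ideal I f.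
Proof.
move=> loc f If dIf.
pose W := subst (mul Z Y) f.
have ZYS := in_group_mul mulE idS ZS YS.
have SW : S W := ZYS _ If.
have dSW j : S W^`M(lshift n j).
  rewrite mderiv_subst; apply: (ideal_sum idS) => i _ _.
  by apply: (idealMr _ idS); apply: ZYS.
have [r [w [c [s [cf sI eW]]]]] := tens_decomp_free W idI.
have Ss (F : {mpoly k[n]} -> {mpoly k[n]}) : S (\sum_(x <- s) tens (F x.1) x.2).
  apply: (ideal_sum idS) => x xs _; apply: (idealMl _ idS).
  by apply: sum_ideal_iny; apply: sI.
have Iw l : I (w l).
  move: l; apply: (free_mod_sum_ideal idI idI cf).
  rewrite -[X in sum_ideal _ _ X](addrK (\sum_(x <- s) tens x.1 x.2)) -eW.
  exact: (idealB idS SW (Ss id)).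
have dIw l j : I (w l)^`M(j).
  move: l; apply: (free_mod_sum_ideal idI idI cf).
  rewrite -[X in sum_ideal _ _ X](addrK (\sum_(x <- s) tens x.1^`M(j) x.2)).
  apply: (idealB idS _ (Ss (mderiv j))).
  have := dSW j; rewrite eW mderivD !raddf_sum /=; congr (S (_ + _)).
    by apply: eq_bigr => l _; rewrite tens_mderiv.
  by apply: eq_bigr => l _; rewrite tens_mderiv.
have /choice[u0 u0P] : forall l, exists u, u@_0 = 1 /\ square_ideal I (u * w l).
  by move=> l; have [u ? ?] := loc _ (Iw l) (dIw l); exists u.
pose u := \prod_l u0 l.
have u1 : u@_0 = 1.
  rewrite (rmorph_prod (@mcoeff n k 0%MM)) big1 // => l _.
  by have [] := u0P l.
have uw l : square_ideal I (u * w l).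
  rewrite /u (bigD1 l) //= mulrAC; apply: (idealMr _ idI2).
  by have [] := u0P l.
pose S2 := sum_ideal (square_ideal I) I.
have idS2 : is_ideal S2 by apply: ideal_gen_ideal.
have S2uW : S2 (inx n u * W).
  rewrite eW mulrDr; apply: (idealD idS2); rewrite mulr_sumr.
    apply: (ideal_sum idS2) => l _ _; rewrite /tens mulrA -rmorphM.
    exact: (idealMr _ idS2 (sum_ideal_inx _ (uw l))).
  apply: (ideal_sum idS2) => x xs _; rewrite /tens mulrA.
  exact: (idealMl _ idS2 (sum_ideal_iny _ (sI _ xs))).
pose V := mul Z (inv Y).
have VS : in_group E S V := in_group_mul mulE idS ZS (in_group_inv invE idS YS).
have subst_sq a : square_ideal I a -> square_ideal S (subst V a).
  apply: ideal_gen_morph => _ [b [b' [Ib Ib' ->]]]; rewrite rmorphM.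
  exact: (mem_square_ideal (VS _ Ib) (VS _ Ib')).
have S2v : S2 (subst (pair_subst V Y) (inx n u * W)).
  apply: (ideal_gen_min (ideal_preimage _ idS2) _ S2uW).
  move=> _ [[a I2a ->]|[b Ib ->]]; last first.
    by rewrite /= subst_iny; apply: sum_ideal_iny Ib.
  by rewrite /= subst_inx; apply: (sum_ideal_square idI idI); apply: subst_sq.
have eW' : subst (pair_subst V Y) W = subst (mul V Y) f.
  rewrite /W subst_comp; apply: eq_subst => i; rewrite /mul_tuple subst_pair.
  apply: eq_subst => j; rewrite /pair_subst.
  case: (split j) => l; first by rewrite /Z substX; apply: pair_substl.
  by rewrite /Y substX; apply: pair_substr.
have VYZ i : S (mul V Y i - Z i) := mul_tupleVK mulE invE idS i ZS YS.
(* (z y^-1) y equals z only modulo S. The first order error lies in the square of S because the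
   derivatives of f lie in I. *)
have S2f : S2 (subst (mul V Y) f - inx n f).
  have := sum_ideal_square idI idI (taylor_square f idS VYZ).
  set t := \sum_i _ => h; rewrite -[X in S2 X](subrK t).
  apply: (idealD idS2 h); apply: (ideal_sum idS2) => i _ _.
  apply: (sum_ideal_square idI idI); apply: (mem_square_ideal _ (VYZ i)).
  exact: (sum_ideal_inx _ (dIf i)).
have S2fu : S2 (inx n f * subst V u).
  move: S2v; rewrite rmorphM /= subst_inx eW' => S2v.
  rewrite -[X in S2 X](subrK (subst V u * subst (mul V Y) f)).
  apply: (idealD idS2 _ S2v); rewrite mulrC -mulrBr -opprB.
  exact: (idealMl _ idS2 (idealN idS2 S2f)).
have I2f := diagonal_square idI If S2fu.
have Iu : I (diag (subst V u) - 1).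
  rewrite subst_comp -(mpolyC1 n k) -u1 -(subst0 n u); apply: (subst_congr _ idI) => i.
  rewrite subr0 /V /mul_tuple subst_pair.
  have -> : (fun i => diag (Z i)) = X.
    by apply/funext => j; rewrite /Z substX pair_substl.
  have -> : (fun i => diag (inv Y i)) = inv X.
    apply/funext => j; rewrite /inv_tuple subst_comp; apply: eq_subst => l.
    by rewrite /Y substX pair_substr.
  exact: (mul_tupleV mulE invE oneE idI i XI).
rewrite -[f]mulr1 -[1](subKr (diag (subst V u))) mulrBr.
exact: (idealB idI2 I2f (mem_square_ideal If Iu)).
Qed.
End Conormal.

(** * Invariant vector fields and the splitting of the conormal sequence *)

Lemma mderiv_sum (R : comNzRingType) (n : nat) (T : Type) (r : seq T)
    (Q : pred T) (F : T -> {mpoly R[n]}) j :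
  (\sum_(i <- r | Q i) F i)^`M(j) = \sum_(i <- r | Q i) (F i)^`M(j).
Proof. exact: raddf_sum. Qed.

Section Splitting.
Variables (k : fieldType) (n : nat) (G : kgroup k) (E : closed_embedding n G).
Variables (Delta : 'I_n -> {mpoly k[n + n]}) (sigma : 'I_n -> {mpoly k[n]}).
Hypothesis mulE : forall (A : comAlgType k) (g h : G A) i,
  coord E A (gmul g h) i = peval (pair_pt (coord E A g) (coord E A h)) (Delta i).
Hypothesis invE : forall (A : comAlgType k) (g : G A) i,
  coord E A (ginv g) i = peval (coord E A g) (sigma i).
Hypothesis oneE : forall (A : comAlgType k) i, coord E A (gone G A) i = 0.

Local Notation I := (eqs E).
Let idI : is_ideal I := eqs_ideal E.
Let S : {mpoly k[n + n]} -> Prop := sum_ideal I I.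
Let idS : is_ideal S := sum_ideal_ideal I I.
Let X (i : 'I_n) : {mpoly k[n]} := 'X_i.
Let Z (i : 'I_n) : {mpoly k[n + n]} := 'X_(lshift n i).
Let Y (i : 'I_n) : {mpoly k[n + n]} := 'X_(rshift n i).
Local Notation mul := (mul_tuple Delta).
Local Notation inv := (inv_tuple sigma).
Local Notation diag := (subst (pair_subst X X)).
Local Notation at1 := (subst (pair_subst (fun=> 0) X)).

Let XI : in_group E I X.
Proof. by move=> q; rewrite /X subst_id. Qed.
Let ZS : in_group E S Z.
Proof. by move=> q Iq; apply: sum_ideal_inx. Qed.
Let YS : in_group E S Y.
Proof. by move=> q Iq; apply: sum_ideal_iny. Qed.

Let subst_pairZY p : subst (pair_subst Z Y) p = p.
Proof.
rewrite -[RHS]subst_id; apply: eq_subst => i.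
by rewrite /pair_subst -[in RHS](splitK i) /unsplit; case: (split i).
Qed.

(* The right invariant vector fields, in coordinates. *)
Definition translation_matrix i j : {mpoly k[n]} := at1 (Delta i)^`M(lshift n j).
Local Notation A := translation_matrix.

Let A0 i j : (A i j)@_0 = ((Delta i)^`M(lshift n j))@_0.
Proof.
apply: subst_coeff0 => l; rewrite /pair_subst; case: split => j'.
  by rewrite mcoeff0.
by rewrite mcoeffX mnm1_eq0.
Qed.

(** Differentiate the law x 1 = x at the origin along v. The law holds modulo I, and a tangent
    vector v kills the linear parts of I. *)
Lemma translation_matrix_tangent (v : 'I_n -> k) i :
  (forall f, I f -> \sum_i (f^`M(i))@_0 * v i = 0) ->
  (\sum_j v j *: A i j)@_0 = v i.
Proof.
move=> tv; have := tv _ (mul_tuple1 mulE oneE idI i XI).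
rewrite raddf_sum /=; under eq_bigr => j _.
  rewrite mderivB mcoeffB /mul_tuple.
  have -> : (subst (pair_subst X (fun=> 0)) (Delta i))^`M(j) =
      subst (pair_subst X (fun=> 0)) (Delta i)^`M(lshift n j).
    rewrite mderiv_pair_subst => [|l]; last exact: mderiv0.
    rewrite (bigD1 j) //= /X mderivXU eqxx mulr1 big1 ?addr0 // => l lj.
    by rewrite mderivXU (negPf lj) mulr0.
  rewrite subst_coeff0; last first.
    move=> l; rewrite /pair_subst; case: split => j'; last by rewrite mcoeff0.
    by rewrite mcoeffX mnm1_eq0.
  rewrite -A0 /X mderivXU mulrBl; over.
rewrite sumrB [X in _ - X](_ : _ = v i); last first.
  rewrite (bigD1 i) //= eqxx mcoeff1 eqxx mul1r big1 ?addr0 // => j ji.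
  by rewrite eq_sym (negPf ji) mcoeff0 mul0r.
move/eqP; rewrite subr_eq0 => /eqP <-.
by apply: eq_bigr => j _; rewrite mcoeffZ mulrC.
Qed.

(** Differentiating in z along v at z = 1 induces a map from k[G x G] to k[G], since v kills the
    first copy of I and the second copy is constant in z. *)
Let tangent_derivation (v : 'I_n -> k) w :
  (forall f, I f -> \sum_i (f^`M(i))@_0 * v i = 0) ->
  S w -> I (\sum_j v j *: at1 w^`M(lshift n j)).
Proof.
move=> tv [s sP ->]; rewrite (eq_bigr (fun j => \sum_(ab <- s)
  v j *: at1 (ab.1 * ab.2)^`M(lshift n j))); last first.
  by move=> j _; rewrite mderiv_sum rmorph_sum scaler_sumr.
rewrite exchange_big /=; apply: ideal_sum => // -[a b] /sP /= [] [i Ii ->] _.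
  rewrite (_ : \sum_j _ = 0); first exact: ideal0.
  have e : \sum_j at1 a * ((i^`M(j))@_0 * v j)%:MP = 0.
    by rewrite -mulr_sumr -rmorph_sum /= tv // mpolyC0 mulr0.
  rewrite -[RHS]e; apply: eq_bigr => j _.
  rewrite mderivM rmorphD !rmorphM /= inx_mderiv !subst_inx.
  rewrite !subst0 (eqs_coeff0 oneE Ii) mpolyC0 mulr0 add0r -mul_mpolyC.
  by ring.
apply: ideal_sum => // j _ _; rewrite -mul_mpolyC; apply: idealMl => //.
rewrite mderivM iny_mderiv mulr0 addr0 rmorphM /= subst_iny.
by apply: idealMl => //; apply: XI.
Qed.

(** This is [tangent_derivation] for f(z y), evaluated by the chain rule and the law 1 y = y. *)
Lemma translation_matrix_field (v : 'I_n -> k) f :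
  (forall f, I f -> \sum_i (f^`M(i))@_0 * v i = 0) -> I f ->
  I (\sum_i f^`M(i) * \sum_j v j *: A i j).
Proof.
move=> tv If.
have := tangent_derivation tv (in_group_mul mulE idS ZS YS If).
set a := \sum_j _ => Ia; set b := \sum_i _; rewrite -(subrK a b).
apply: idealD => //; rewrite /b /a.
rewrite (eq_bigr (fun i => \sum_j v j *: (f^`M(i) * A i j))); last first.
  by move=> i _; rewrite mulr_sumr; apply: eq_bigr => j _; rewrite scalerAr.
rewrite exchange_big -sumrB; apply: ideal_sum => // j _ _ /=.
rewrite -scaler_sumr -scalerBr -mul_mpolyC; apply: idealMl => //.
rewrite mderiv_subst rmorph_sum -sumrB; apply: ideal_sum => // i _ _ /=.
rewrite rmorphM /= /(mul Z Y) subst_pairZY -mulrBl; apply: idealMr => //.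
rewrite subst_comp -opprB; apply: idealN => //.
rewrite -{2}(subst_id f^`M(i)); apply: subst_congr => // l.
rewrite /mul_tuple subst_pairZY; exact: (mul_1tuple mulE oneE idI).
Qed.

(** The source of elements of I with prescribed gradient modulo I. On the diagonal the z-gradient of
    a(z, y) i(z) is that of a(x, x) i(x) modulo I, and the z-gradient of a(z, y) i(y) is 0 modulo
    I. *)
Let diagonal_derivative w : S w -> exists2 i, I i &
  forall j, I (diag w^`M(lshift n j) - i^`M(j)).
Proof.
case=> s sP ->.
have /choice[t tP] : forall ab : {mpoly k[n + n]} * {mpoly k[n + n]}, exists i,
    ab \in s -> I i /\ forall j, I (diag (ab.1 * ab.2)^`M(lshift n j) - i^`M(j)).
  move=> ab; have [abs|abs] := boolP (ab \in s); last by exists 0.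
  case: ab abs => a b /sP /= [] [i Ii ->].
    exists (diag a * i) => _; split; first exact: idealMl.
    move=> j; rewrite !mderivM rmorphD !rmorphM /= inx_mderiv !subst_inx !subst_id.
    rewrite opprD addrACA subrr addr0 -mulrBl.
    exact: (idealMl _ idI Ii).
  exists 0 => _; split; first exact: ideal0.
  move=> j; rewrite mderivM iny_mderiv mulr0 addr0 mderiv0 subr0 rmorphM /=.
  by rewrite subst_iny subst_id; apply: (idealMl _ idI Ii).
exists (\sum_(ab <- s) t ab).
  by apply: (ideal_sum idI) => ab abs _; case: (tP ab abs).
move=> j; rewrite !mderiv_sum rmorph_sum -sumrB; apply: (ideal_sum idI) => ab abs _.
by case: (tP ab abs) => _; apply.
Qed.

Let V := mul Z (inv Y).
(** The right invariant Maurer-Cartan form: the derivative of z y^-1 in z at y = z. It goes from the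
    tangent space at x to that at 1, opposite to [A]. *)
Let B b j := diag (V b)^`M(lshift n j).

Let diagV i : I (diag (V i)).
Proof.
rewrite /V /mul_tuple subst_pair.
have -> : (fun i => diag (Z i)) = X.
  by apply/funext => j; rewrite /Z substX pair_substl.
have -> : (fun i => diag (inv Y i)) = inv X.
  apply/funext => j; rewrite /inv_tuple subst_comp; apply: eq_subst => l.
  by rewrite /Y substX pair_substr.
exact: (mul_tupleV mulE invE oneE idI i XI).
Qed.

(** Apply [diagonal_derivative] to f(z y^-1); on the diagonal the inner derivatives of f are taken
    at z z^-1 = 1. *)
Let lift_grad f : I f -> exists2 e, I e &
  forall j, I (\sum_b (f^`M(b))@_0 *: B b j - e^`M(j)).
Proof.
move=> If.
have [e Ie eP] := diagonal_derivative
  (in_group_mul mulE idS ZS (in_group_inv invE idS YS) If).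
exists e => // j; set a := \sum_b _; rewrite -(subrK (diag (subst V f)^`M(lshift n j)) a).
rewrite -addrA; apply: (idealD idI _ (eP j)).
rewrite mderiv_subst rmorph_sum -sumrB; apply: (ideal_sum idI) => b _ _ /=.
rewrite rmorphM /= -mul_mpolyC -mulrBl; apply: (idealMr _ idI).
rewrite subst_comp -opprB -(subst0 n); apply: (idealN idI).
by apply: (subst_congr _ idI) => i; rewrite subr0.
Qed.

(** Apply [diagonal_derivative] to z - (z y^-1) y: A and B are inverse up to gradients of elements
    of I. *)
Let lift_identity i : exists2 e, I e &
  forall j, I ((i == j)%:R - \sum_b A i b * B b j - e^`M(j)).
Proof.
have SVZ : S (Z i - mul V Y i).
  by rewrite -opprB; apply: (idealN idS (mul_tupleVK mulE invE idS i ZS YS)).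
have [e Ie eP] := diagonal_derivative SVZ.
exists e => // j; have := eP j; rewrite mderivB rmorphB /= /Z mderivXU.
rewrite (inj_eq (@lshift_inj _ _)) /(mul V Y) mderiv_pair_subst; last first.
  by move=> l; rewrite /Y mderivXU eq_rlshift.
rewrite rmorph_sum (_ : diag (i == j)%:R = (i == j)%:R); last first.
  by case: eqP; rewrite ?rmorph1 ?rmorph0.
set a := \sum_b _ => Ia; set b := \sum_b _.
rewrite -[X in I X](subrK ((i == j)%:R - a - e^`M(j))); apply: (idealD idI _ Ia).
have -> (x y z t : {mpoly k[n]}) : x - y - z - (x - t - z) = t - y by ring.
rewrite /a /b -sumrB; apply: (ideal_sum idI) => l _ _ /=.
rewrite rmorphM /= -mulrBl; apply: (idealMr _ idI).
rewrite subst_pair; apply: (subst_congr _ idI) => i'.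
rewrite -(splitK i'); case: (split i') => l' /=.
  by rewrite !pair_substl subr0.
by rewrite /Y !(pair_substr, substX) subrr; apply: ideal0.
Qed.

Variables (c : nat) (h : 'I_c -> {mpoly k[n]}) (C : 'M[k]_(n, c)).
Hypotheses (Ih : forall l, I (h l)).
Hypothesis MC : (\matrix_l grad0 (h l)) *m C = 1%:M.
Hypothesis gradM : forall f, I f -> exists a, grad0 f = a *m \matrix_l grad0 (h l).
Hypothesis injI : forall f, I f -> (forall i, I f^`M(i)) -> square_ideal I f.

(** In matrix form, modulo I, the gradients obtained so far are 1 - A B for [e2] and M B for [e1].
    So e = e2 + A C e1 has gradient 1 - A P B with P = 1 - C M. For f in I the gradient of f -
    \sum_i (d f / d x_i) e_i is then (grad f) A P B modulo I. It lies in I because the columns of A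
    P are invariant fields along tangent vectors, and [injI] applies. *)
Lemma conormal_split : exists e : 'I_n -> {mpoly k[n]}, (forall i, I (e i)) /\
  forall f, I f -> square_ideal I (f - \sum_i f^`M(i) * e i).
Proof.
pose M := \matrix_l grad0 (h l); pose P : 'M[k]_n := 1%:M - C *m M.
have PE a b : P a b = (a == b)%:R - (C *m M) a b.
  by rewrite /P [LHS]mxE [(1%:M : 'M[k]_n) a b]mxE [(- (C *m M)) a b]mxE.
have tangentP b f : I f -> \sum_i (f^`M(i))@_0 * P i b = 0.
  move=> /gradM[a fa]; have : grad0 f *m P = 0.
    by rewrite fa -mulmxA mulmxBr mulmx1 mulmxA MC mul1mx subrr mulmx0.
  move=> /matrixP/(_ 0 b); rewrite [LHS]mxE [RHS]mxE => e; rewrite -[RHS]e.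
  by apply: eq_bigr => i _; rewrite [grad0 f 0 i]mxE.
have /choice[e1 e1P] : forall l, exists e, I e /\
    forall j, I (\sum_b ((h l)^`M(b))@_0 *: B b j - e^`M(j)).
  by move=> l; have [e] := lift_grad (Ih l); exists e.
have /choice[e2 e2P] : forall i, exists e, I e /\
    forall j, I ((i == j)%:R - \sum_b A i b * B b j - e^`M(j)).
  by move=> i; have [e] := lift_identity i; exists e.
pose AC i l := \sum_a C a l *: A i a.
pose e i := e2 i + \sum_l AC i l * e1 l.
have Ie i : I (e i).
  apply: (idealD idI); first by have [] := e2P i.
  by apply: (ideal_sum idI) => l _ _; apply: (idealMl _ idI); have [] := e1P l.
have de i j : I ((i == j)%:R - \sum_b (\sum_a P a b *: A i a) * B b j - (e i)^`M(j)).
  have I2 := (e2P i).2 j.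
  have I1 : I (\sum_l AC i l * (\sum_b ((h l)^`M(b))@_0 *: B b j - (e1 l)^`M(j))).
    by apply: (ideal_sum idI) => l _ _; apply: (idealMl _ idI); apply: (e1P l).2.
  have I0 : I (\sum_l (AC i l)^`M(j) * e1 l).
    by apply: (ideal_sum idI) => l _ _; apply: (idealMl _ idI); apply: (e1P l).1.
  have := idealB idI (idealD idI I2 I1) I0; congr I.
  rewrite /e mderivD mderiv_sum.
  have -> : \sum_l (AC i l * e1 l)^`M(j) =
      \sum_l (AC i l)^`M(j) * e1 l + \sum_l AC i l * (e1 l)^`M(j).
    by rewrite -big_split; apply: eq_bigr => l _; rewrite mderivM.
  have -> : \sum_l AC i l * (\sum_b ((h l)^`M(b))@_0 *: B b j - (e1 l)^`M(j)) =
      \sum_l AC i l * (\sum_b ((h l)^`M(b))@_0 *: B b j) -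
      \sum_l AC i l * (e1 l)^`M(j).
    by rewrite -sumrB; apply: eq_bigr => l _; rewrite mulrBr.
  have -> : \sum_b (\sum_a P a b *: A i a) * B b j = \sum_b A i b * B b j -
      \sum_l AC i l * (\sum_b ((h l)^`M(b))@_0 *: B b j).
    have -> : \sum_l AC i l * (\sum_b ((h l)^`M(b))@_0 *: B b j) =
        \sum_b (\sum_a (C *m M) a b *: A i a) * B b j.
      rewrite (eq_bigr (fun l => \sum_b AC i l * (((h l)^`M(b))@_0 *: B b j))).
        rewrite exchange_big /=; apply: eq_bigr => b _; rewrite mulr_suml.
        rewrite (eq_bigr (fun l => \sum_a (C a l * M l b) *: (A i a * B b j))).
          rewrite exchange_big /=; apply: eq_bigr => a _.
          by rewrite [(C *m M) a b]mxE -scalerAl scaler_suml.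
        move=> l _; rewrite /AC mulr_suml; apply: eq_bigr => a _.
        by rewrite !mxE -scalerAl -scalerAr scalerA.
      by move=> l _; rewrite mulr_sumr.
    rewrite -sumrB; apply: eq_bigr => b _; rewrite -mulrBl; congr (_ * _).
    under eq_bigr do rewrite PE scalerBl.
    rewrite sumrB; congr (_ - _); rewrite (bigD1 b) //= eqxx scale1r.
    by rewrite big1 ?addr0 // => a /negPf ->; rewrite scale0r.
  by ring.
exists e; split=> // f If; apply: injI.
  apply: (idealB idI If); apply: (ideal_sum idI) => i _ _.
  exact: (idealMl _ idI (Ie i)).
move=> j; rewrite mderivB mderiv_sum.
have I1 : I (\sum_i f^`M(i)^`M(j) * e i).
  by apply: (ideal_sum idI) => i _ _; exact: (idealMl _ idI (Ie i)).
have I2 : I (\sum_i f^`M(i) *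
    ((i == j)%:R - \sum_b (\sum_a P a b *: A i a) * B b j - (e i)^`M(j))).
  by apply: (ideal_sum idI) => i _ _; exact: (idealMl _ idI (de i j)).
have I3 : I (\sum_b (\sum_i f^`M(i) * \sum_a P a b *: A i a) * B b j).
  apply: (ideal_sum idI) => b _ _; apply: (idealMr _ idI).
  exact: (translation_matrix_field (tangentP b) If).
have := idealB idI (idealD idI I2 I3) I1; congr I.
have -> : \sum_i f^`M(i) *
    ((i == j)%:R - \sum_b (\sum_a P a b *: A i a) * B b j - (e i)^`M(j)) =
    \sum_i f^`M(i) * (i == j)%:R -
    \sum_i f^`M(i) * (\sum_b (\sum_a P a b *: A i a) * B b j) -
    \sum_i f^`M(i) * (e i)^`M(j).
  by rewrite -!sumrB; apply: eq_bigr => i _; rewrite !mulrBr.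
have -> : \sum_i (f^`M(i) * e i)^`M(j) =
    \sum_i f^`M(i)^`M(j) * e i + \sum_i f^`M(i) * (e i)^`M(j).
  by rewrite -big_split; apply: eq_bigr => i _; rewrite mderivM.
have -> : \sum_i f^`M(i) * (i == j)%:R = f^`M(j).
  by rewrite (bigD1 j) //= eqxx mulr1 big1 ?addr0 // => i /negPf ->; rewrite mulr0.
have -> : \sum_b (\sum_i f^`M(i) * \sum_a P a b *: A i a) * B b j =
    \sum_i f^`M(i) * (\sum_b (\sum_a P a b *: A i a) * B b j).
  under eq_bigr do rewrite mulr_suml.
  rewrite exchange_big; apply: eq_bigr => i _ /=; rewrite mulr_sumr.
  by apply: eq_bigr => b _; rewrite mulrA.
by ring.
Qed.
End Splitting.

(** * Translation to the origin *)

Lemma tdeg_leM (k : fieldType) (n a b : nat) (p q : {mpoly k[n]}) :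
  tdeg_le a p -> tdeg_le b q -> tdeg_le (a + b) (p * q).
Proof.
rewrite /tdeg_le => pa qb.
have [->|p0] := eqVneq p 0; first by rewrite mul0r msize0.
have [->|q0] := eqVneq q 0; first by rewrite mulr0 msize0.
rewrite msizeM // -subn1 leq_subLR add1n -addSn -addnS.
exact: leq_add.
Qed.

Lemma tdeg_le_sum (k : fieldType) (n d : nat) (T : eqType) (r : seq T)
    (F : T -> {mpoly k[n]}) :
  (forall i, i \in r -> tdeg_le d (F i)) -> tdeg_le d (\sum_(i <- r) F i).
Proof.
move=> h; apply: leq_trans (msize_sum _ _ _) _.
by apply/bigmax_leqP_seq => i ir _; apply: h.
Qed.

Lemma tdeg_le_subst (k : fieldType) (n N d : nat) (v : 'I_n -> {mpoly k[N]}) q :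
  (forall i, tdeg_le 1 (v i)) -> tdeg_le d q -> tdeg_le d (subst v q).
Proof.
move=> v1 qd; rewrite [q]mpolyE rmorph_sum; apply: tdeg_le_sum => u uq /=.
rewrite substZ; apply: leq_trans (msizeZ_le _ _) _.
have : tdeg_le (mdeg u) (subst v 'X_[u]).
  rewrite /subst mmapX /mmap1 mdegE.
  elim/big_rec2: _ => [|i a b _ IH]; first by rewrite /tdeg_le msize1.
  apply: tdeg_leM => //; elim: (u i) => [|e IHe]; first by rewrite /tdeg_le msize1.
  by rewrite exprS -add1n; apply: tdeg_leM.
move=> /leq_trans; apply.
by apply: leq_trans qd; apply: msize_mdeg_lt.
Qed.

Section Translation.
Variables (k : fieldType) (n : nat) (F : kfunctor k) (E : closed_embedding n F).
Variable (eps : 'I_n -> k).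

Definition shift (c : 'I_n -> k) i : {mpoly k[n]} := 'X_i + (c i)%:MP.

Lemma subst_shift c c' q : (forall i, c i + c' i = 0) ->
  subst (shift c) (subst (shift c') q) = q.
Proof.
move=> cc; rewrite subst_comp -[RHS]subst_id; apply: eq_subst => i.
by rewrite rmorphD /= substX substC /shift -addrA -mpolyCD cc mpolyC0 addr0.
Qed.

Lemma peval_shift (A : comAlgType k) (v : {ffun 'I_n -> A}) c q :
  peval v (subst (shift c) q) = peval [ffun i => v i + (c i)%:A] q.
Proof.
rewrite peval_subst; congr (peval _ q); apply/ffunP => i.
by rewrite !ffunE rmorphD /= pevalX pevalC.
Qed.

Let neps i := - eps i.

Let translate_fun (A : comAlgType k) (x : F A) : affine_space k n A :=
  [ffun i => coord E A x i + (neps i)%:A].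

Let translate_nat (A B : comAlgType k) (f : {lrmorphism A -> B}) (x : F A) :
  translate_fun (fmap f x) = fmap f (translate_fun x).
Proof.
apply/ffunP => i; rewrite !ffunE rmorphD /= rmorph_alg.
by rewrite (trans_nat (coord E)) ffunE.
Qed.

Let translate_inj (A : comAlgType k) : injective (@translate_fun A).
Proof.
move=> x y /ffunP e; apply: (coord_inj (c := E)); apply/ffunP => i.
by have := e i; rewrite !ffunE => /addIr.
Qed.

Let translate_image (A : comAlgType k) (v : affine_space k n A) :
  (exists x, translate_fun x = v) <->
  (forall p, eqs E (subst (shift neps) p) -> peval v p = 0).
Proof.
split=> [[x <-] p Ip|h].
  rewrite /translate_fun -(peval_shift (coord E A x) neps p).
  by apply: (proj1 (coord_image E _)) Ip; exists x.
have [|x ex] := proj2 (coord_image E [ffun i => v i + (eps i)%:A]).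
  move=> p Ip; rewrite -peval_shift; apply: h.
  by rewrite subst_shift // => i; rewrite /neps addNr.
exists x; apply/ffunP => i; rewrite ffunE ex ffunE /neps.
by rewrite -addrA -scalerDl subrr scale0r addr0.
Qed.

Definition translate_embedding : closed_embedding n F :=
  @ClosedEmbedding k n F (KTrans translate_nat)
    (fun p => eqs E (subst (shift neps) p))
    (ideal_preimage (subst (shift neps)) (eqs_ideal E))
    translate_inj translate_image.
End Translation.

(* The conormal sequence of G in affine space is split exact. *)
Lemma group_conormal_split (k : fieldType) (n d D p : nat) (G : kgroup k)
    (E : closed_embedding n G) (Delta : 'I_n -> {mpoly k[n + n]})
    (sigma : 'I_n -> {mpoly k[n]}) (eps : 'I_n -> k) :
  (0 < d)%N -> p \in [pchar k] -> (D < p)%N ->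
  (forall (F : 'I_n -> {mpoly k[n]}) (q : {mpoly k[n]}),
    (forall i, (msize (F i) <= d.+1)%N) -> (msize q <= d.+1)%N ->
    (forall N, (N <= D)%N -> vanish_order N.+1 (iter N (subst F) q)) ->
    forall N, vanish_order N.+1 (iter N (subst F) q)) ->
  gen_tdeg_le d (eqs E) ->
  (forall (A : comAlgType k) (g h : G A) i,
    coord E A (gmul g h) i = peval (pair_pt (coord E A g) (coord E A h)) (Delta i)) ->
  (forall (A : comAlgType k) (g : G A) i,
    coord E A (ginv g) i = peval (coord E A g) (sigma i)) ->
  (forall (A : comAlgType k) i, coord E A (gone G A) i = (eps i)%:A) ->
  exists e : 'I_n -> {mpoly k[n]}, (forall i, eqs E (e i)) /\
    forall f, eqs E f -> square_ideal (eqs E) (f - \sum_i f^`M(i) * e i).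
Proof.
move=> d0 charp Dp unifD [P Pd IP] mulE invE oneE.
pose neps i := - eps i.
have epsK i : eps i + neps i = 0 by rewrite subrr.
have nepsK i : neps i + eps i = 0 by rewrite addNr.
pose E' := translate_embedding E eps.
pose Delta' i := subst (pair_subst (fun j => 'X_(lshift n j) + (eps j)%:MP)
  (fun j => 'X_(rshift n j) + (eps j)%:MP)) (Delta i) - (eps i)%:MP.
pose sigma' i := subst (shift eps) (sigma i) - (eps i)%:MP.
have coordE' (A : comAlgType k) (g : G A) i : coord E' A g i = coord E A g i - (eps i)%:A.
  by rewrite ffunE scaleNr.
have coordE (A : comAlgType k) (g : G A) :
    [ffun i => coord E' A g i + (eps i)%:A] = coord E A g.
  by apply/ffunP => i; rewrite ffunE coordE' subrK.
have mulE' (A : comAlgType k) (g h : G A) i : coord E' A (gmul g h) i =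
    peval (pair_pt (coord E' A g) (coord E' A h)) (Delta' i).
  rewrite coordE' mulE rmorphB /= pevalC peval_pair_subst.
  congr (peval (pair_pt _ _) _ - _); rewrite -[LHS]coordE; apply/ffunP => j;
    rewrite [LHS]ffunE [RHS]ffunE rmorphD /= pevalC pevalX; congr (_ + _);
    rewrite [RHS]ffunE.
    by rewrite (unsplitK (inl j)).
  by rewrite (unsplitK (inr j)).
have invE' (A : comAlgType k) (g : G A) i :
    coord E' A (ginv g) i = peval (coord E' A g) (sigma' i).
  by rewrite coordE' invE rmorphB /= pevalC peval_shift coordE.
have oneE' (A : comAlgType k) i : coord E' A (gone G A) i = 0.
  by rewrite coordE' oneE subrr.
have I0 := eqs_coeff0 oneE'.
(* A translation does not raise degrees, so the bound passes to the translated generators. *)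
pose P' q := exists2 r, P r & q = subst (shift eps) r.
have P'd q : P' q -> tdeg_le d q.
  move=> [r /Pd rd ->]; apply: tdeg_le_subst rd => i.
  apply: leq_trans (msizeD_le _ _) _; rewrite msizeX mdeg1 geq_max /=.
  by rewrite msizeC; case: (_ != 0).
have IP' q : eqs E' q <-> ideal_gen P' q.
  split=> [/IP Iq|].
    rewrite -(subst_shift q epsK); apply: ideal_gen_morph Iq => r Pr.
    by apply: mem_ideal_gen; exists r.
  apply: ideal_gen_min => [|_ [r Pr ->]]; first exact: eqs_ideal.
  rewrite /= (subst_shift _ nepsK); apply/IP; exact: mem_ideal_gen.
have P'I q : P' q -> eqs E' q by move=> Pq; apply/IP'; apply: mem_ideal_gen.
have [c [h [C [hP MC gradM']]]] := linear_parts (fun f Pf => I0 f (P'I f Pf)).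
have gradM f : eqs E' f -> exists a, grad0 f = a *m \matrix_l grad0 (h l).
  by move=> /IP'; apply: gradM'.
have fields v : (forall f, eqs E' f -> \sum_i (f^`M(i))@_0 * v i = 0) ->
    exists delta : 'I_n -> {mpoly k[n]}, (forall i, (delta i)@_0 = v i) /\
      forall f, eqs E' f -> eqs E' (\sum_i f^`M(i) * delta i).
  move=> tv; exists (fun i => \sum_j v j *: translation_matrix Delta' i j).
  split=> [i|f If]; first exact: (translation_matrix_tangent mulE' oneE').
  exact: (translation_matrix_field mulE' oneE').
have hI l : eqs E' (h l) by apply: P'I.
have loc := local_conormal charp (eqs_ideal E') I0 fields hI MC gradM
  d0 P'd IP' hP unifD Dp.
have inj := conormal_injective mulE' invE' oneE' loc.
have [e [Ie eP]] := conormal_split mulE' invE' oneE' hI MC gradM inj.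
exists (fun i => subst (shift neps) (e i)); split=> // f If.
have If' : eqs E' (subst (shift eps) f) by rewrite /= (subst_shift _ nepsK).
have := eP _ If' => /(ideal_gen_morph (f := subst (shift neps))).
move=> /(_ (fun z => exists a b, [/\ eqs E a, eqs E b & z = a * b])).
rewrite rmorphB /= (subst_shift _ nepsK) rmorph_sum /=.
have -> : \sum_i subst (shift neps) ((subst (shift eps) f)^`M(i) * e i) =
    \sum_i f^`M(i) * subst (shift neps) (e i).
  apply: eq_bigr => i _; rewrite rmorphM /=; congr (_ * _).
  rewrite mderiv_subst (bigD1 i) //= big1 => [|j ji].
    rewrite addr0 /shift mderivD mderivC mderivXU eqxx addr0 mulr1.
    exact: (subst_shift _ nepsK).
  by rewrite /shift mderivD mderivC mderivXU (negPf ji) addr0 mulr0.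
apply=> _ [a [b [Ia Ib ->]]]; apply: mem_ideal_gen.
exists (subst (shift neps) a), (subst (shift neps) b); split=> //.
by rewrite rmorphM.
Qed.

(** * Equations of the centraliser *)

Lemma rmorph_lrmorph (k : fieldType) (A B : comAlgType k) (f : {rmorphism A -> B}) :
  (forall c : k, f c%:A = c%:A) -> exists g : {lrmorphism A -> B}, g =1 f.
Proof.
move=> fC.
have [||||g gE] := quotient_lift (phi := in_alg A) (pi := idfun) (f := f) => //.
- by move=> y; exists y.
- by move=> x /= ->; rewrite rmorph0.
by exists g.
Qed.

(** A maximal ideal containing the annihilator of d, so that d stays nonzero in the localisation at
    it. *)
Lemma annihilator_maximal (B : comNzRingType) (d : B) : d != 0 ->
  exists M : B -> Prop, [/\ is_ideal M, ~ M 1, forall b, b * d = 0 -> M b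
    & forall b, ~ M b -> exists m c, M m /\ 1 = m + c * b].
Proof.
move=> d0.
pose P M := [/\ is_ideal M, ~ M 1 & forall b, b * d = 0 -> M b].
have [||M [idM M1 Md] Mmax] := @maximal_predicate B P (fun b => b * d = 0).
- split=> //; last by move=> /eqP; rewrite mul1r; apply/negP.
  split; first by rewrite mul0r.
    by move=> x y ex ey; rewrite mulrDl ex ey addr0.
  by move=> a x ex; rewrite -mulrA ex mulr0.
- move=> C [L CL] CP Ctot; split.
  + by apply: chain_ideal => //; [exists L | move=> L' /CP[]].
  + by case=> L' /CP[].
  + by move=> b bd; exists L => //; case: (CP _ CL) => _ _; apply.
exists M; split=> // b Mb; apply: contrapT => nb.
pose M' x := exists m c, M m /\ x = m + c * b.
apply: Mb; apply: (Mmax M').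
- split.
  + split.
    * by exists 0, 0; rewrite mul0r addr0; split=> //; apply: ideal0.
    * move=> _ _ [m [c [Mm ->]]] [m' [c' [Mm' ->]]]; exists (m + m'), (c + c').
      by rewrite mulrDl addrACA; split=> //; apply: idealD.
    * move=> a _ [m [c [Mm ->]]]; exists (a * m), (a * c).
      by rewrite mulrDr mulrA; split=> //; apply: idealMl.
  + by move=> [m [c [Mm e]]]; apply: nb; exists m, c.
  + by move=> x /Md Mx; exists x, 0; rewrite mul0r addr0.
- by move=> x Mx; exists x, 0; rewrite mul0r addr0.
- by exists 0, 1; rewrite mul1r add0r; split=> //; apply: ideal0.
Qed.

(** In c = q (a X - 1) the coefficients of q are forced to be - a^i c, and all but finitely many of
    them vanish. *)
Lemma localisation_kernel (B : comNzRingType) (a c : B) :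
  ideal_gen (fun q : {poly B} => q = a%:P * 'X - 1) c%:P -> exists s, a ^+ s * c = 0.
Proof.
move=> h; have [q cq] : exists q, c%:P = q * (a%:P * 'X - 1).
  apply: (@ideal_gen_min _ _ (fun x => exists q, x = q * (a%:P * 'X - 1))) h.
    split.
    - by exists 0; rewrite mul0r.
    - by move=> _ _ [q ->] [r ->]; exists (q + r); rewrite mulrDl.
    - by move=> r _ [q ->]; exists (r * q); rewrite mulrA.
  by move=> _ ->; exists 1; rewrite mul1r.
have qE i : q`_i = - (a ^+ i * c).
  elim: i => [|i IH].
    rewrite expr0 mul1r -[c in RHS](coefC c 0) ?eqxx //.
    have := congr1 (fun r : {poly B} => r`_0) cq.
    rewrite mulrBr mulr1 coefB mulrCA mulrA coefMX coefC /= sub0r => ->.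
    by rewrite opprK.
  have := congr1 (fun r : {poly B} => r`_i.+1) cq.
  rewrite mulrBr mulr1 coefB mulrA coefMX coefC /= coefMC IH => /esym/eqP.
  by rewrite subr_eq0 => /eqP <-; rewrite exprS mulNr [X in - X]mulrC mulrA.
exists (size q); apply/eqP; rewrite -oppr_eq0 -qE; apply/eqP.
exact: nth_default.
Qed.

(** Let M be a maximal ideal containing the annihilator of d. Over the field B / M the point h lies
    in some chart, so the ideal of B describing where h lies in this chart contains an element a
    outside M. Take L = B[1/a]: if d vanished there, a power of a would annihilate d and lie in
    M. *)
Lemma chart_detection (k : fieldType) (X : lfp_scheme k) (B : comAlgType k)
    (h : X B) (d : B) : d != 0 ->
  exists j (L : comAlgType k) (l : {lrmorphism B -> L}),
    chart j L (fmap l h) /\ l d != 0.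
Proof.
move=> d0; have [M [idM M1 Md Mmax]] := annihilator_maximal d0.
have [K [pi [piC pi0 pis]]] := quotient_algebraP (in_alg B) idM M1.
have [pi' pi'E] := rmorph_lrmorph piC.
have Kfield (a : K) : a <> 0 -> exists b, a * b = 1.
  have [b <-] := pis a => pib; have [Mb|c [m [Mm e]]] := Mmax b.
    by case: pib; apply/pi0.
  exists (pi m); rewrite mulrC -rmorphM -(rmorph1 pi) e rmorphD.
  by rewrite (proj2 (pi0 c)) // add0r.
have [j hj] := chart_cover Kfield (fmap pi' h); exists j.
have [J idJ JP] := chart_open j h.
have [a [Ja Ma]] : exists a, J a /\ ~ M a.
  apply: contrapT => nJ; have := proj1 (JP _ pi') hj.
  case=> s sP /eqP; rewrite big_seq big1 ?oner_eq0 // => ab /sP[b Jb ->].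
  rewrite pi'E (proj2 (pi0 b)) ?mulr0 //; apply: contrapT => Mb.
  by apply: nJ; exists b.
have Mpow s : ~ M (a ^+ s).
  move=> /pi0; rewrite rmorphXn => /= e.
  have [|b ab] := Kfield (pi a); first by move=> /pi0.
  have : (pi a * b) ^+ s = 1 by rewrite ab expr1n.
  by move/eqP; rewrite exprMn e mul0r eq_sym oner_eq0.
pose I := ideal_gen (fun q : {poly B} => q = a%:P * 'X - 1).
have I1 : ~ I 1.
  rewrite -polyC1 => /localisation_kernel[s]; rewrite mulr1 => e.
  by apply: (Mpow s); rewrite e; apply: ideal0.
have [L [lam [lamC lam0 _]]] :=
  quotient_algebraP (polyC \o in_alg B) (ideal_gen_ideal _) I1.
have [l lE] := rmorph_lrmorph (f := lam \o polyC) lamC.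
exists L, l; split.
  apply/(JP _ l); exists [:: (lam 'X, l a)].
    by move=> ab; rewrite inE => /eqP ->; exists a.
  rewrite big_seq1 lE /= -rmorphM mulrC -(rmorph1 lam); apply/eqP.
  rewrite eq_sym -subr_eq0 -rmorphB; apply/eqP/lam0.
  exact: mem_ideal_gen.
apply/eqP; rewrite lE /= => /lam0 /localisation_kernel[s /Md].
exact: Mpow.
Qed.

Section PairEvaluation.
Variables (k : fieldType) (n m : nat) (A : comAlgType k).
Variables (u : {ffun 'I_n -> A}) (v : {ffun 'I_m -> A}).

Lemma peval_inx a : peval (pair_pt u v) (inx m a) = peval u a.
Proof.
rewrite /inx -/(subst _ _) peval_subst; congr (peval _ a).
by apply/ffunP => j; rewrite ffunE pevalX ffunE (unsplitK (inl j)).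
Qed.

Lemma peval_iny b : peval (pair_pt u v) (iny n b) = peval v b.
Proof.
rewrite /iny -/(subst _ _) peval_subst; congr (peval _ b).
by apply/ffunP => j; rewrite ffunE pevalX ffunE (unsplitK (inr j)).
Qed.

Lemma peval_tens a b : peval (pair_pt u v) (tens a b) = peval u a * peval v b.
Proof. by rewrite /tens rmorphM /= peval_inx peval_iny. Qed.
End PairEvaluation.

(** * Fixed points and the centraliser in the charts *)

Section Centraliser.
Variables (k : fieldType) (n d : nat) (G : kgroup k) (E : closed_embedding n G).
Variables (X : lfp_scheme k) (alpha : action G X) (Y : subfunctor X).
Hypotheses (sepX : separated X) (closedY : closed_sub Y).

Definition chart_ideal i (p : {mpoly k[nvars i]}) : Prop :=
  forall (B : comAlgType k) (h : functor_of_sub (chart i) B),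
    Y B (proj1_sig h) -> peval (coord (chart_emb i) B h) p = 0.
Arguments chart_ideal : clear implicits.

Lemma chart_ideal_ideal i : is_ideal (chart_ideal i).
Proof.
split=> [B h _|p q hp hq B h Yh|a p hp B h Yh].
- exact: rmorph0.
- by rewrite rmorphD /= hp // hq // addr0.
- by rewrite rmorphM /= hp // mulr0.
Qed.

Lemma chart_ideal_eqs i p : eqs (chart_emb i) p -> chart_ideal i p.
Proof.
move=> Ip B h _.
by apply: (proj1 (coord_image (chart_emb i) _)) Ip; exists h.
Qed.

(** Since Y is closed, its pullback to the generic point of the chart is given by an ideal, and that
    ideal consists of functions vanishing on Y. The point [h0] ensures that the coordinate ring of
    the chart is nonzero. *)
Lemma chart_ideal_points i (B0 : comAlgType k) (h0 : functor_of_sub (chart i) B0)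
    (A : comAlgType k) (v : {ffun 'I_(nvars i) -> A}) :
  (forall p, chart_ideal i p -> peval v p = 0) ->
  exists u, coord (chart_emb i) A u = v /\ Y A (proj1_sig u).
Proof.
move=> vJ.
have eqs1 : ~ eqs (chart_emb i) 1.
  move=> h1; have : peval (coord (chart_emb i) B0 h0) 1 = 0.
    by apply: (proj1 (coord_image (chart_emb i) _)) h1; exists h0.
  by move/eqP; rewrite rmorph1 oner_eq0.
have [R [vu [vu0 vuf vus]]] := generic_point (eqs_ideal (chart_emb i)) eqs1.
have [xu exu] : exists x, coord (chart_emb i) R x = vu.
  by apply/(coord_image (chart_emb i)) => p /vu0.
have map_pt (B : comAlgType k) (h : functor_of_sub (chart i) B)
    (f : {lrmorphism R -> B}) :
    aff_fmap f vu = coord (chart_emb i) B h -> fmap f xu = h.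
  move=> e; apply: (coord_inj (c := chart_emb i)).
  by rewrite (trans_nat (coord (chart_emb i))) exu.
have [u eu] : exists u, coord (chart_emb i) A u = v.
  by apply/(coord_image (chart_emb i)) => p /chart_ideal_eqs/vJ.
exists u; split=> //.
have [f fv] : exists f : {lrmorphism R -> A}, aff_fmap f vu = v.
  by apply: vuf => p /chart_ideal_eqs/vJ.
have [J idJ JP] := closedY (proj1_sig xu).
have <- : fmap f (proj1_sig xu) = proj1_sig u.
  by rewrite -(map_pt A u f) // eu.
apply/JP => a Ja; have [p ep] := vus a; rewrite ep peval_fmap fv; apply: vJ.
move=> B h Yh.
have [g gv] : exists g : {lrmorphism R -> B},
    aff_fmap g vu = coord (chart_emb i) B h.
  apply: vuf => q Iq.
  by apply: (proj1 (coord_image (chart_emb i) _)) Iq; exists h.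
rewrite -gv -peval_fmap -ep; apply: (proj1 (JP B g)) => //.
by move: Yh; rewrite -(map_pt B h g).
Qed.

(** Separatedness makes the fixed locus closed in G x X_i. The ideal describing it at the generic
    point of G x X_i consists of functions in [fix_ideal]. *)
Lemma fix_ideal_points i (B : comAlgType k)
    (u : prod_functor G (functor_of_sub (chart i)) B) :
  (forall p, fix_ideal E alpha (i := i) p ->
    peval (pair_pt (coord E B u.1) (coord (chart_emb i) B u.2)) p = 0) ->
  alpha B u.1 (proj1_sig u.2) = proj1_sig u.2.
Proof.
move=> uF.
pose m := nvars i; pose K : {mpoly k[n + m]} -> Prop :=
  sum_ideal (eqs E) (eqs (chart_emb i)).
have idK : is_ideal K by apply: ideal_gen_ideal.
have KP (A : comAlgType k) (w : prod_functor G (functor_of_sub (chart i)) A) p :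
    K p -> peval (pair_pt (coord E A w.1) (coord (chart_emb i) A w.2)) p = 0.
  apply: (@ideal_gen_min _ _ (fun p =>
    peval (pair_pt (coord E A w.1) (coord (chart_emb i) A w.2)) p = 0)).
    exact: kernel_ideal.
  move=> _ [[a Ia ->]|[b Ib ->]]; rewrite ?peval_inx ?peval_iny.
    by apply: (proj1 (coord_image E _)) Ia; exists w.1.
  by apply: (proj1 (coord_image (chart_emb i) _)) Ib; exists w.2.
have K1 : ~ K 1.
  by move=> /(KP B u) /eqP; rewrite rmorph1 oner_eq0.
have [R [w [w0 wf ws]]] := generic_point idK K1.
pose w1 := [ffun j => w (lshift m j)]; pose w2 := [ffun j => w (rshift n j)].
have ew : w = pair_pt w1 w2.
  apply/ffunP => j; rewrite ffunE -[in LHS](splitK j).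
  by case: (split j) => j' /=; rewrite ffunE.
have [g eg] : exists g, coord E R g = w1.
  apply/(coord_image E) => p Ip; rewrite -(peval_inx w1 w2) -ew.
  by apply/w0/sum_ideal_inx.
have [h eh] : exists h, coord (chart_emb i) R h = w2.
  apply/(coord_image (chart_emb i)) => p Ip; rewrite -(peval_iny w1 w2) -ew.
  by apply/w0/sum_ideal_iny.
have lift (A : comAlgType k) (v : prod_functor G (functor_of_sub (chart i)) A) :
    exists f : {lrmorphism R -> A}, [/\ fmap f g = v.1, fmap f h = v.2 &
      aff_fmap f w = pair_pt (coord E A v.1) (coord (chart_emb i) A v.2)].
  have [f fw] := wf _ _ (KP A v).
  exists f; split=> //.
    apply: (coord_inj (c := E)); rewrite (trans_nat (coord E)) eg.
    apply/ffunP => j; have /ffunP/(_ (lshift m j)) := fw.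
    by rewrite !ffunE (unsplitK (inl j)).
  apply: (coord_inj (c := chart_emb i)); rewrite (trans_nat (coord (chart_emb i))) eh.
  apply/ffunP => j; have /ffunP/(_ (rshift n j)) := fw.
  by rewrite !ffunE (unsplitK (inr j)).
have [D idD DP] := sepX (beta_on alpha (chart i) R (g, h)).
have lift_diag (A : comAlgType k) (f : {lrmorphism R -> A}) :
    (forall a, D a -> f a = 0) <->
    alpha A (fmap f g) (proj1_sig (fmap f h)) = proj1_sig (fmap f h).
  by rewrite -DP /= act_nat.
have [f [fg fh fw]] := lift B u.
have /lift_diag : forall a, D a -> f a = 0; last by rewrite fg fh.
move=> a Da; have [p ep] := ws a; rewrite ep peval_fmap fw.
apply: uF => A v vdiag; have [f' [fg' fh' fw']] := lift A v.
rewrite -fw' -peval_fmap -ep; apply: (proj2 (lift_diag A f')) => //.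
by rewrite fg' fh'.
Qed.

Hypothesis GD : GDelta_complexity_le d E alpha.

(** All functions of degree at most d that vanish on the centraliser. The degree bound is thus built
    in, and the content is that they suffice to cut it out. *)
Definition centraliser_eq (q : {mpoly k[n]}) : Prop :=
  tdeg_le d q /\ forall (A : comAlgType k) (g : G A),
    centraliser_mem alpha Y g -> peval (coord E A g) q = 0.

Lemma chart_ideal_free1 i (B0 : comAlgType k) (h0 : functor_of_sub (chart i) B0) :
  Y B0 (proj1_sig h0) -> ~ chart_ideal i 1.
Proof.
by move=> Y0 /(_ B0 h0 Y0)/eqP; rewrite rmorph1 oner_eq0.
Qed.

(* The generic point of Y in a chart, after base change to A. *)
Lemma generic_chart_point i (A : comAlgType k) : ~ chart_ideal i 1 ->
  exists (T : comAlgType k) (l : {lrmorphism A -> T})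
    (pi : {rmorphism {mpoly A[nvars i]} -> T}) (v : {ffun 'I_(nvars i) -> T}),
  [/\ forall a, l a = pi a%:MP,
      forall x, pi x = 0 ->
        ideal_gen (fun z => exists2 p, chart_ideal i p & z = map_mpoly (in_alg A) p) x,
      forall p, peval v p = pi (map_mpoly (in_alg A) p)
    & forall p, chart_ideal i p -> peval v p = 0].
Proof.
move=> J1; set m := nvars i.
pose K := ideal_gen (fun z : {mpoly A[m]} =>
  exists2 p, chart_ideal i p & z = map_mpoly (in_alg A) p).
have K1 : ~ K 1.
  move=> hK.
  have idJ := chart_ideal_ideal i.
  have id0 : is_ideal (fun a : A => a = 0) := kernel_ideal idfun.
  (* The family consisting of 1 alone is free modulo a proper ideal, and stays so after base
     change. *)
  pose c := fun _ : 'I_1 => 1 : {mpoly k[m]}.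
  have cf : free_mod (chart_ideal i) c.
    move=> a; rewrite big_ord1 => ha j; rewrite ord1; apply: contra_notP J1 => /eqP a0.
    have := idealMl ((a 0)^-1)%:MP idJ ha.
    by rewrite mul_mpolyC scalerA mulVf // scale1r.
  have := free_mod_base_change (w := fun=> 1) id0 idJ cf.
  rewrite big_ord1 /c !rmorph1 mulr1 => h.
  suff /eqP : (1 : A) = 0 by rewrite oner_eq0.
  apply: (h _ 0).
  by apply: ideal_gen_sub hK => z [p Jp ->]; right; exists p.
have [T [pi [piC pi0 _]]] :=
  quotient_algebraP (@mpolyC m A \o in_alg A) (ideal_gen_ideal _) K1.
have [l lE] := rmorph_lrmorph (f := pi \o @mpolyC m A) piC.
pose v := [ffun j : 'I_m => pi 'X_j].
have vE p : peval v p = pi (map_mpoly (in_alg A) p).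
  rewrite -[in RHS](mmap_id p); symmetry.
  apply: (mmap_morph (h := pi \o map_mpoly (in_alg A))) => [c|j] /=.
    by rewrite map_mpolyC piC.
  by rewrite map_mpolyX ffunE.
exists T, l, pi, v; split=> // [x /pi0 //|p Jp].
by rewrite vE; apply/pi0; apply: mem_ideal_gen; exists p.
Qed.

(** A point g of the centraliser over A fixes the generic point of Y in the chart, so \sum a(g) (x)
    b vanishes in A (x) k[Y_i], where Y_i is the part of Y in the chart. Expanding the b along the
    free family c, each coefficient vanishes at g. *)
Lemma centraliser_eq_coef i (f : seq ({mpoly k[n]} * {mpoly k[nvars i]}))
    (r : nat) (c : 'I_r -> {mpoly k[nvars i]})
    (t : {mpoly k[n]} * {mpoly k[nvars i]} -> 'I_r -> k) :
  ~ chart_ideal i 1 ->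
  fix_ideal E alpha (i := i) (\sum_(ab <- f) tens ab.1 ab.2) ->
  (forall ab, ab \in f -> tdeg_le d ab.1) ->
  free_mod (chart_ideal i) c ->
  (forall ab, ab \in f -> chart_ideal i (ab.2 - \sum_l t ab l *: c l)) ->
  forall l, centraliser_eq (\sum_(ab <- f) t ab l *: ab.1).
Proof.
move=> J1 fF fd cf tP l; split.
  apply: tdeg_le_sum => ab abf; apply: leq_trans (msizeZ_le _ _) _.
  exact: fd.
move=> A g gC; have [T [lam [pi [v [lamE pi0 vE vJ]]]]] := generic_chart_point A J1.
have [B0 [h0 Y0]] : exists (B0 : comAlgType k) (h0 : functor_of_sub (chart i) B0),
    Y B0 (proj1_sig h0).
  apply: contrapT => nY; apply: J1 => B h Yh; case: nY.
  by exists B, h.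
have [u [eu Yu]] := chart_ideal_points h0 vJ.
have fixu : alpha T (fmap lam g) (proj1_sig u) = proj1_sig u by apply: gC.
have := fF T (fmap lam g, u) fixu; rewrite /= eu (trans_nat (coord E)) /= => fu.
have idJ := chart_ideal_ideal i; pose m := nvars i.
pose K := ideal_gen (fun z : {mpoly A[m]} => (exists2 q, q = 0 & z = q%:MP) \/
  (exists2 p, chart_ideal i p & z = map_mpoly (in_alg A) p)).
have idK : is_ideal K by apply: ideal_gen_ideal.
have Kf : K (\sum_(ab <- f) (peval (coord E A g) ab.1)%:MP * map_mpoly (in_alg A) ab.2).
  suff /pi0 : pi (\sum_(ab <- f) (peval (coord E A g) ab.1)%:MP *
      map_mpoly (in_alg A) ab.2) = 0.
    by apply: ideal_gen_sub => z hz; right.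
  rewrite -[RHS]fu !rmorph_sum; apply: eq_bigr => ab _ /=.
  by rewrite peval_tens rmorphM /= -lamE peval_fmap vE.
have id0 : is_ideal (fun a : A => a = 0) := kernel_ideal idfun.
move: l; apply: (free_mod_base_change id0 idJ cf).
have -> : \sum_l (peval (coord E A g) (\sum_(ab <- f) t ab l *: ab.1))%:MP *
    map_mpoly (in_alg A) (c l) =
    \sum_(ab <- f) (peval (coord E A g) ab.1)%:MP *
      map_mpoly (in_alg A) (\sum_l t ab l *: c l).
  transitivity (\sum_l \sum_(ab <- f) (peval (coord E A g) ab.1)%:MP *
      map_mpoly (in_alg A) (t ab l *: c l)).
    apply: eq_bigr => l _.
    rewrite (rmorph_sum (peval (coord E A g))) (rmorph_sum (@mpolyC m A)) mulr_suml.
    apply: eq_bigr => ab _; rewrite -!mul_mpolyC !rmorphM /= map_mpolyC pevalC.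
    by rewrite mulrCA mulrA.
  rewrite exchange_big; apply: eq_bigr => ab _ /=.
  by rewrite (rmorph_sum (map_mpoly (in_alg A))) mulr_sumr.
rewrite -[X in ideal_gen _ X](subKr (\sum_(ab <- f)
  (peval (coord E A g) ab.1)%:MP * map_mpoly (in_alg A) ab.2)).
apply: (idealB idK Kf); rewrite -sumrB; apply: (ideal_sum idK) => ab abf _.
rewrite -mulrBr -rmorphB; apply: (idealMl _ idK); apply: mem_ideal_gen.
by right; exists (ab.2 - \sum_l t ab l *: c l) => //; apply: tP.
Qed.

(** At (g, h) each generator of the fixed point ideal becomes a combination of its coefficients at
    g, since the remainders of the expansion vanish at the point h of Y. *)
Lemma centraliser_eq_chart i (A : comAlgType k) (g : G A) (B : comAlgType k)
    (f : {lrmorphism A -> B}) (h : functor_of_sub (chart i) B) :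
  (forall q, centraliser_eq q -> peval (coord E A g) q = 0) -> Y B (proj1_sig h) ->
  alpha B (fmap f g) (proj1_sig h) = proj1_sig h.
Proof.
move=> gP Yh; apply: (@fix_ideal_points i B (fmap f g, h)) => p Fp.
have [fs fsd fsP] := GD i; move/fsP: (Fp).
set ev := peval _; apply: (@ideal_gen_min _ _ (fun p => ev p = 0)).
  exact: kernel_ideal.
rewrite /ev => _ [[a Ia ->]|[b Ib ->]|[F Ffs ->]].
- rewrite peval_inx; apply: (proj1 (coord_image E _)) Ia.
  by exists (fmap f g).
- rewrite peval_iny; apply: (proj1 (coord_image (chart_emb i) _)) Ib.
  by exists h.
have J1 := chart_ideal_free1 Yh; have idJ := chart_ideal_ideal i.
have subJ : is_subspace (chart_ideal i) by case: idJ => *; apply: ideal_subspace.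
have [r [c [cf cs _]]] := free_mod_extract subJ [seq ab.2 | ab <- F].
have /choice[t tP] : forall ab : {mpoly k[n]} * {mpoly k[nvars i]},
    exists t : 'I_r -> k, ab \in F -> chart_ideal i (ab.2 - \sum_l t l *: c l).
  move=> ab; have [abF|abF] := boolP (ab \in F); last by exists (fun=> 0).
  suff [t ?] : span_mod (chart_ideal i) c ab.2 by exists t.
  by apply: cs; apply: map_f.
have FF : fix_ideal E alpha (i := i) (\sum_(ab <- F) tens ab.1 ab.2).
  by apply/fsP; apply: mem_ideal_gen; apply: Or33; exists F.
have qP := centraliser_eq_coef J1 FF (fun ab => @fsd F ab Ffs) cf tP.
rewrite (rmorph_sum (peval _)).
transitivity (\sum_(ab <- F) \sum_l
    f (peval (coord E A g) (t ab l *: ab.1)) * peval (coord (chart_emb i) B h) (c l)).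
  rewrite big_seq [RHS]big_seq; apply: eq_bigr => ab abF /=.
  rewrite peval_tens (trans_nat (coord E)) /= -peval_fmap.
  have := tP ab abF B h Yh; rewrite rmorphB /= => /eqP; rewrite subr_eq0 => /eqP ->.
  rewrite (rmorph_sum (peval _)) mulr_sumr; apply: eq_bigr => l _ /=.
  rewrite -!mul_mpolyC !rmorphM /= !pevalC rmorph_alg.
  by rewrite mulrCA mulrA.
rewrite exchange_big big1 // => l _ /=.
by rewrite -mulr_suml -(rmorph_sum f) -(rmorph_sum (peval _)) /= gP ?rmorph0 ?mul0r.
Qed.

(** The point h need not lie in a single chart. The locus in Spec B where g fixes h is closed; a
    nonzero b in its ideal would survive in a localisation where h lies in a chart, and there the
    chart case gives b = 0. *)
Lemma centraliser_eqP (A : comAlgType k) (g : G A) :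
  (forall q, centraliser_eq q -> peval (coord E A g) q = 0) ->
  centraliser_mem alpha Y g.
Proof.
move=> gP B f h Yh.
have [D idD DP] := sepX ((alpha B (fmap f g) h, h) : prod_functor X X B).
suff D0 b : D b -> b = 0.
  have := proj2 (DP B idfun) D0.
  by rewrite /= /prod_fmap /= !fmap_id.
move=> Db; apply: contrapT => /eqP b0.
have [j [L [l [hj /eqP]]]] := chart_detection h b0; apply.
apply: (proj1 (DP L l)) => //=.
rewrite act_nat -fmap_comp.
apply: (@centraliser_eq_chart j A g L (l \o f) (exist _ (fmap l h) hj)) => //.
exact: sub_stable.
Qed.
End Centraliser.

(** * Smoothness *)

(** The substitution x |-> x - e(x) is the identity modulo I and maps I into I^2, by Taylor
    expansion. Any lift of the coordinates of y to A kills I^2, the kernel of f having square zero;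
    composed with this substitution it kills I and still lifts y. *)
Lemma smooth_of_split (k : fieldType) (n : nat) (F : kfunctor k)
    (E : closed_embedding n F) (e : 'I_n -> {mpoly k[n]}) :
  (forall i, eqs E (e i)) ->
  (forall f, eqs E f -> square_ideal (eqs E) (f - \sum_i f^`M(i) * e i)) ->
  smooth F.
Proof.
move=> Ie eP; split.
  by exists n, E; apply: noetherian_mpoly; apply: eqs_ideal.
move=> A B f fs f2 y.
have /choice[a aP] : forall i, exists a, f a = coord E B y i by [].
pose a0 : {ffun 'I_n -> A} := [ffun i => a i].
have fa0 : aff_fmap f a0 = coord E B y.
  by apply/ffunP => i; rewrite !ffunE aP.
have fI q : eqs E q -> f (peval a0 q) = 0.
  move=> Iq; rewrite peval_fmap fa0.
  by apply: (proj1 (coord_image E _)) Iq; exists y.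
have I2 q : square_ideal (eqs E) q -> peval a0 q = 0.
  apply: (@ideal_gen_min _ _ (fun q => peval a0 q = 0) _ (kernel_ideal (peval a0))).
  by move=> _ [b [c [Ib Ic ->]]]; rewrite rmorphM /=; apply: f2; apply: fI.
pose v i := 'X_i - e i.
have idI2 : is_ideal (square_ideal (eqs E)) by apply: ideal_gen_ideal.
have vI q : eqs E q -> square_ideal (eqs E) (subst v q).
  move=> Iq; have vX i : v i - 'X_i = - e i by rewrite /v addrC addKr.
  have vXI i : eqs E (v i - 'X_i).
    by rewrite vX; apply: (idealN (eqs_ideal E)).
  have := idealD idI2 (taylor_square q (eqs_ideal E) vXI) (eP q Iq).
  rewrite subst_id; congr (square_ideal _ _).
  have -> : \sum_i subst (fun i => 'X_i) q^`M(i) * (v i - 'X_i) =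
      - \sum_i q^`M(i) * e i.
    by rewrite -sumrN; apply: eq_bigr => i _; rewrite vX subst_id mulrN.
  by ring.
have [x ex] := proj2 (coord_image E [ffun i => peval a0 (v i)])
  (fun q Iq => etrans (esym (peval_subst a0 v q)) (I2 _ (vI q Iq))).
exists x; apply: (coord_inj (c := E)).
rewrite (trans_nat (coord E)) ex -fa0; apply/ffunP => i; rewrite !ffunE.
by rewrite /v rmorphB /= rmorphB /= (fI _ (Ie i)) subr0 pevalX ffunE.
Qed.

(** * The centraliser as a group with equations of bounded degree *)

Section CentraliserGroup.
Variables (k : fieldType) (G : kgroup k) (X : kfunctor k) (alpha : action G X).
Variable Y : subfunctor X.
Local Notation C := (centraliser alpha Y).
Local Notation FC := (functor_of_sub C).

Lemma centraliser_mul (A : comAlgType k) (g h : FC A) :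
  C A (gmul (proj1_sig g) (proj1_sig h)).
Proof.
move=> B f x Yx; rewrite gmul_nat actM.
by rewrite (proj2_sig h B f x Yx) (proj2_sig g B f x Yx).
Qed.

Lemma centraliser_inv (A : comAlgType k) (g : FC A) : C A (ginv (proj1_sig g)).
Proof.
move=> B f x Yx; rewrite -[in LHS](proj2_sig g B f x Yx) -actM ginv_nat.
by rewrite gmulVg act1.
Qed.

Lemma centraliser_one (A : comAlgType k) : C A (gone G A).
Proof. by move=> B f x Yx; rewrite gone_nat act1. Qed.

(** A group in its own right, so that the splitting theorem applies to it and not to G. It is
    transparent, so that its functor computes to that of the subfunctor. *)
Definition centraliser_group : kgroup k.
refine (@KGroup k FC
  (fun A g h => exist _ (gmul (proj1_sig g) (proj1_sig h)) (centraliser_mul g h))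
  (fun A g => exist _ (ginv (proj1_sig g)) (centraliser_inv g))
  (fun A => exist _ (gone G A) (@centraliser_one A))
  _ _ _ _ _ _ _ _).
- by move=> A B f g h; apply: sig_eqP; apply: gmul_nat.
- by move=> A B f g; apply: sig_eqP; apply: ginv_nat.
- by move=> A B f; apply: sig_eqP; apply: gone_nat.
- by move=> A g h l; apply: sig_eqP; apply: gmulA.
- by move=> A g; apply: sig_eqP; apply: gmul1g.
- by move=> A g; apply: sig_eqP; apply: gmulg1.
- by move=> A g; apply: sig_eqP; apply: gmulVg.
- by move=> A g; apply: sig_eqP; apply: gmulgV.
Defined.
End CentraliserGroup.

Section CentraliserEmbedding.
Variables (k : fieldType) (n d : nat) (G : kgroup k) (E : closed_embedding n G).
Variables (X : lfp_scheme k) (alpha : action G X) (Y : subfunctor X).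
Hypotheses (sepX : separated X) (closedY : closed_sub Y).
Hypotheses (GD : GDelta_complexity_le d E alpha) (Ed : gen_tdeg_le d (eqs E)).

Local Notation C := (centraliser alpha Y).
Local Notation FC := (functor_of_sub C).
Local Notation eqsC := (ideal_gen (centraliser_eq d E alpha Y)).

Lemma centraliser_points (A : comAlgType k) (g : G A) :
  C A g <-> forall q, eqsC q -> peval (coord E A g) q = 0.
Proof.
split=> [gC q|h].
  apply: (@ideal_gen_min _ _ (fun q => _ = 0) _ (kernel_ideal (peval (coord E A g)))).
  by move=> r [_]; apply.
by apply: (centraliser_eqP sepX closedY GD) => q Pq; apply/h/mem_ideal_gen.
Qed.

Lemma centraliser_closed : closed_sub C.
Proof.
move=> A g; exists (ideal_gen (fun a => exists2 q, eqsC q & a = peval (coord E A g) q)).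
  exact: ideal_gen_ideal.
move=> B f; rewrite centraliser_points (trans_nat (coord E)); split=> [h a|h q Pq].
  apply: (@ideal_gen_min _ _ (fun a => f a = 0) _ (kernel_ideal f)).
  by move=> _ [q Pq ->]; rewrite peval_fmap; apply: h.
by rewrite /= -peval_fmap; apply: h; apply: mem_ideal_gen; exists q.
Qed.

Let coordC_fun (A : comAlgType k) (g : FC A) : affine_space k n A :=
  coord E A (proj1_sig g).
Let coordC_nat (A B : comAlgType k) (f : {lrmorphism A -> B}) (g : FC A) :
  coordC_fun (fmap f g) = fmap f (coordC_fun g).
Proof. exact: (trans_nat (coord E)). Qed.
Let coordC_inj (A : comAlgType k) : injective (@coordC_fun A).
Proof. by move=> g h e; apply: sig_eqP; apply: (coord_inj (c := E)). Qed.
Let coordC_image (A : comAlgType k) (v : affine_space k n A) :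
  (exists x, coordC_fun x = v) <-> (forall p, eqsC p -> peval v p = 0).
Proof.
split=> [[[g gC] <-]|h]; first exact/centraliser_points.
have [g eg] : exists g, coord E A g = v.
  (* The ideal of G is contained in [eqsC]: its generators have degree at most d and vanish on the
     centraliser. *)
  apply/(coord_image E) => p Ip; apply: h.
  have [P Pd IP] := Ed; move/IP: Ip; apply: ideal_gen_sub => q Pq.
  split; first exact: Pd.
  move=> B g _; apply: (proj1 (coord_image E _)); first by exists g.
  by apply/IP; apply: mem_ideal_gen.
have gC : C A g by apply/centraliser_points; rewrite eg.
by exists (exist _ g gC).
Qed.

Definition centraliser_embedding : closed_embedding n (centraliser_group alpha Y) :=
  @ClosedEmbedding k n (centraliser_group alpha Y) (KTrans coordC_nat) eqsC
    (ideal_gen_ideal _) coordC_inj coordC_image.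
End CentraliserEmbedding.

Theorem corollary4p8 (d n : nat) :
  exists p0 : nat, prime p0 /\
  forall (k : fieldType) (p : nat), p \in [pchar k]%R -> (p0 <= p)%N ->
  forall (G : kgroup k) (E : closed_embedding n G),
    group_complexity_le d E ->
  forall (X : lfp_scheme k) (alpha : action G X),
    separated X -> scheme_complexity_le d X ->
    GDelta_complexity_le d E alpha ->
  forall Y : subfunctor X, closed_sub Y ->
    closed_sub (centraliser alpha Y) /\
    smooth (functor_of_sub (centraliser alpha Y)).
Proof.
(* The maximum with 1 leaves room for the linear term of F when d = 0. *)
have [D DP] := uniform_vanishing n (maxn d 1).
have [p0 Dp0 p0_prime] := prime_above D.
exists p0; split=> // k p charp p0p G E [Ed [Delta [sigma [eps [_ mulE invE oneE]]]]].
move=> X alpha sepX _ GD Y closedY.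
split; first exact: (centraliser_closed sepX closedY GD).
pose EC := centraliser_embedding sepX closedY GD Ed.
have ECd : gen_tdeg_le (maxn d 1) (eqs EC).
  exists (centraliser_eq d E alpha Y) => // q [qd _].
  by apply: leq_trans qd _; rewrite ltnS leq_maxl.
(* The polynomials for product, inverse and unit of G serve the centraliser, whose coordinates are
   those of G. *)
have [e [Ie eP]] := @group_conormal_split k n (maxn d 1) D p _ EC Delta sigma eps
  (leq_maxr _ _) charp (leq_trans Dp0 p0p) (DP k) ECd
  (fun A g h => mulE A (proj1_sig g) (proj1_sig h))
  (fun A g => invE A (proj1_sig g)) oneE.
exact: (smooth_of_split Ie eP).
Qed.
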